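(* Fix $C\geq 1$, $D\geq 0$. Let $\mathfrak A=\overline{\bigcup_{n\in\mathbb N}\mathfrak A_n}^{\|\cdot\|_{\mathfrak A}}$ be a unital inductive limit of C*-algebras. If $\mathfrak A$ is $((\mathfrak A_n,\mathsf L_{\mathfrak A_n}))_{n\in\mathbb N}$-propinquity approximable for some sequence of $(C,D)$-quasi-Leibniz compact quantum metric spaces and some summable $(\beta(j))_{j\in\mathbb N}\subset(0,\infty)$, then the sequence $((\mathfrak A_n,\mathsf L_{\mathfrak A_n}))_{n\in\mathbb N}$ is $\mathfrak A$-C*-convergent with respect to $(\mathfrak F^{\tau},\mathsf L_{\tau})$, where: (1) $\tau=(\tau_{n,n+1})_{n\in\mathbb N}$ is the sequence of evident tunnels and $(\mathfrak F^{\tau},\mathsf L_\tau)$ is the space constructed from it (as described in the context); (2) there exists a unital *-isomorphism $\psi:\mathfrak A\to\mathfrak F^{\tau}$ such that $\psi=\psi^{(n)}$ on $\mathfrak A_n$ for all $n\in\mathbb N$; and (3) if we define $\mathsf L_{\mathfrak A}:=\mathsf L_\tau\circ\psi$, then $(\mathfrak A,\mathsf L_{\mathfrak A})$ is a $(C,D)$-quasi-Leibniz compact quantum metric space such that $\bigcup_{n\in\mathbb N}\operatorname{dom}(\mathsf L_{\mathfrak A_n})\subseteq\operatorname{dom}(\mathsf L_{\mathfrak A})$, with $$\mathsf\Lambda^\ast\big((\mathfrak A_n,\mathsf L_{\mathfrak A_n}),(\mathfrak A,\mathsf L_{\mathfrak A})\big)\leq 4\sum_{j=n}^\infty\beta(j)\quad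 (n\in\mathbb N)\qquad\text{and}\qquad \lim_{n\to\infty}\mathsf\Lambda^\ast\big((\mathfrak A_n,\mathsf L_{\mathfrak A_n}),(\mathfrak A,\mathsf L_{\mathfrak A})\big)=0.$$
   Context: $\mathbb N=\{0,1,2,\dots\}$; $\mathfrak{sa}(\mathfrak A)$ is the set of self-adjoint elements and $\mathscr S(\mathfrak A)$ the state space of a unital C*-algebra $\mathfrak A$. Compact quantum metric spaces. A compact quantum metric space $(\mathfrak A,\mathsf L)$ is a unital C*-algebra $\mathfrak A$ with a $[0,\infty]$-valued seminorm $\mathsf L$ (over $\mathbb R$) on $\mathfrak{sa}(\mathfrak A)$ (called a Lip-norm), whose domain $\operatorname{dom}(\mathsf L)=\{a\in\mathfrak{sa}(\mathfrak A):\mathsf L(a)<\infty\}$ is a unital dense real subspace of $\mathfrak{sa}(\mathfrak A)$, such that $\{a:\mathsf L(a)=0\}=\mathbb R1_{\mathfrak A}$; the Monge–Kantorovich metric $\mathsf{mk}_{\mathsf L}(\varphi,\psi)=\sup\{|\varphi(a)-\psi(a)|:a\in\operatorname{dom}(\mathsf L),\mathsf L(a)\le1\}$ metrizes the weak* topology of $\mathscr S(\mathfrak A)$; and $\mathsf L$ is lower semi-continuous for $\|\cdot\|_{\mathfrak A}$. If a seminorm is given on all of $\mathfrak A$, it is regarded as a Lip-norm via its restriction to $\mathfrak{sa}(\mathfrak A)$. It is $(C,D)$-quasi-Leibniz ($C\ge1,D\ge0$) if for all $a,b\in\operatorname{dom}(\mathsf L)$, $\max\{\mathsf L(\frac{ab+ba}2),\mathsf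 L(\frac{ab-ba}{2i})\}\le C(\|a\|\mathsf L(b)+\|b\|\mathsf L(a))+D\,\mathsf L(a)\mathsf L(b)$. Dual propinquity. A $(C,D)$-tunnel from $(\mathfrak A_1,\mathsf L_1)$ to $(\mathfrak A_2,\mathsf L_2)$ is $(\mathfrak D,\mathsf L_{\mathfrak D},\pi_1,\pi_2)$ with $(\mathfrak D,\mathsf L_{\mathfrak D})$ a $(C,D)$-quasi-Leibniz compact quantum metric space and $\pi_j:\mathfrak D\to\mathfrak A_j$ unital *-epimorphisms with $\mathsf L_j(a)=\inf\{\mathsf L_{\mathfrak D}(d):d\in\mathfrak{sa}(\mathfrak D),\pi_j(d)=a\}$ for all $a\in\mathfrak{sa}(\mathfrak A_j)$. Its extent is $\max_{j=1,2}\mathrm{Haus}_{\mathsf{mk}_{\mathsf L_{\mathfrak D}}}(\mathscr S(\mathfrak D),\{\varphi\circ\pi_j:\varphi\in\mathscr S(\mathfrak A_j)\})$ (Hausdorff distance). The dual Gromov–Hausdorff propinquity $\mathsf\Lambda^\ast$ between two $(C,D)$-quasi-Leibniz compact quantum metric spaces is the infimum of the extents of all $(C,D)$-tunnels between them. It is a complete metric up to quantum isometry, i.e. up to *-isomorphisms $\pi$ with $\mathsf L_{\mathfrak B}\circ\pi=\mathsf L_{\mathfrak A}$. Inductive limits. $\mathfrak A=\overline{\bigcup_n\mathfrak A_n}^{\|\cdot\|_{\mathfrak A}}$ is a unital inductive limit of C*-algebras if $\mathfrak A$ is a unital C*-algebra and $(\mathfrak A_n)_{n\in\mathbb N}$ is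 a non-decreasing sequence of unital C*-subalgebras of $\mathfrak A$ (with the unit $1_{\mathfrak A}$). If $((\mathfrak A_n,\mathsf L_{\mathfrak A_n}))_n$ is a Cauchy sequence for $\mathsf\Lambda^\ast$ of $(C,D)$-quasi-Leibniz compact quantum metric spaces with limit $(\mathfrak B,\mathsf L_{\mathfrak B})$, it is called $\mathfrak A$-C*-convergent (with respect to $(\mathfrak B,\mathsf L_{\mathfrak B})$) if $\mathfrak A$ is *-isomorphic to $\mathfrak B$. Approximability. $\mathfrak A$ is $((\mathfrak A_n,\mathsf L_{\mathfrak A_n}))_n$-propinquity approximable with respect to $(\beta(j))_j\subset(0,\infty)$, $\sum_j\beta(j)<\infty$, if for every $n$: (i) $\mathsf L_{\mathfrak A_n}$ is a $(C,D)$-quasi-Leibniz Lip-norm that is defined on all of $\mathfrak A_n$ (with values in $[0,\infty]$) and $\{a\in\mathfrak A_n:\mathsf L_{\mathfrak A_n}(a)<\infty\}$ is a dense *-subalgebra of $\mathfrak A_n$; (ii) $\mathsf L_{\mathfrak A_{n+1}}(a)\le\mathsf L_{\mathfrak A_n}(a)$ for $a\in\mathfrak A_n$; (iii) the length of the evident bridge from $\mathfrak A_n$ to $\mathfrak A_{n+1}$ is at most $\beta(n)$, i.e. the maximum of $\sup_a\inf_b\|a-b\|_{\mathfrak A}$ and $\sup_b\inf_a\|a-b\|_{\mathfrak A}$ is $\le\beta(n)$, where $a$ ranges over $a\in\mathfrak{sa}(\mathfrak A_n)$, $\mathsf L_{\mathfrak A_n}(a)\le1$ and $b$ over $b\in\mathfrak{sa}(\mathfrak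 A_{n+1})$, $\mathsf L_{\mathfrak A_{n+1}}(b)\le1$. The evident tunnel $\tau_{n,n+1}$ is $(\mathfrak D_n,\mathsf L^n,\pi_n,\omega_n)$ with $\mathfrak D_n=\mathfrak A_n\oplus\mathfrak A_{n+1}$, $\mathsf L^n(a,b)=\max\{\mathsf L_{\mathfrak A_n}(a),\mathsf L_{\mathfrak A_{n+1}}(b),\frac{\|a-b\|_{\mathfrak A}}{2\beta(n)}\}$, $\pi_n(a,b)=a$, $\omega_n(a,b)=b$; it is a $(C,D)$-tunnel from $(\mathfrak A_n,\mathsf L_{\mathfrak A_n})$ to $(\mathfrak A_{n+1},\mathsf L_{\mathfrak A_{n+1}})$. The space $(\mathfrak F^\tau,\mathsf L_\tau)$. Let $\mathfrak D=\prod_n\mathfrak D_n$ be the C*-algebra of bounded sequences, and $S_0((d_n)_n)=\sup_n\mathsf L^n(d_n)$ on $\mathfrak{sa}(\mathfrak D)$. Put $\mathfrak K_0=\{d\in\mathfrak{sa}(\mathfrak D):\pi_{n+1}(d_{n+1})=\omega_n(d_n)\ \forall n\}$, $\mathfrak L_0=\{d\in\mathfrak K_0:S_0(d)<\infty\}$, $\mathfrak S_0=\{d\in\mathfrak D:\frac{d+d^*}2,\frac{d-d^*}{2i}\in\mathfrak L_0\}$, $\mathfrak G_0=\overline{\mathfrak S_0}^{\|\cdot\|_{\mathfrak D}}$, $\mathfrak I_0=\{d\in\mathfrak G_0:\lim_n\|d_n\|_{\mathfrak D_n}=0\}$. Then (Latrémolière) $\mathfrak G_0$ is a unital C*-subalgebra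 of $\mathfrak D$, $\mathfrak I_0$ is a closed two-sided ideal of it; set $\mathfrak F^\tau=\mathfrak G_0/\mathfrak I_0$ with quotient map $q$, and $\mathsf L_\tau(a)=\inf\{S_0(d):d\in\mathfrak{sa}(\mathfrak G_0),q(d)=a\}$ for $a\in\mathfrak{sa}(\mathfrak F^\tau)$. The maps $\psi^{(n)}$. Define $\psi_0:\mathfrak A_0\to\mathfrak D$ by $\psi_0(a)=((a,a))_{n\in\mathbb N}$, and for $n\ge1$, $\psi_n:\mathfrak A_n\to\mathfrak D$ by $\psi_n(a)=((0,0),\dots,(0,0),(0,a),(a,a),(a,a),\dots)$, where $(0,a)$ sits in $\mathfrak D_{n-1}=\mathfrak A_{n-1}\oplus\mathfrak A_n$. One has $\psi_n(\mathfrak A_n)\subseteq\mathfrak G_0$; set $\psi^{(n)}=q\circ\psi_n:\mathfrak A_n\to\mathfrak F^\tau$. *)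

(* Defs.v *)
From HB Require Import structures.
From mathcomp Require Import all_boot all_order all_algebra.
From mathcomp Require Import complex.
From mathcomp Require Import all_classical all_reals.
From mathcomp Require Import ereal topology normedtype sequences.

Set Implicit Arguments.
Unset Strict Implicit.
Unset Printing Implicit Defensive.

Import Order.TTheory GRing.Theory Num.Theory.
Import numFieldNormedType.Exports.
Import ComplexField.Normc.

Local Open Scope classical_set_scope.
Local Open Scope complex_scope.
Local Open Scope ring_scope.

Definition norm_ball (R : realType) (A : zmodType) (nm : A -> R)
  (a : A) (e : R) : set A := [set b | nm (a - b) < e].

(* The norm is a separate operation, and not the norm of a normedModType,
   because MathComp has no structure below numDomainType that joins a ring
   and a normed Z-module.  The uniform structure is the one of the norm.
   An algType is nontrivial, so the zero algebra is excluded; the norm of 1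
   is then 1 in every C*-algebra. *)
HB.mixin Record isNormedStarAlgebra (R : realType) A
    of Uniform A & GRing.Algebra R[i] A := {
  cnorm : A -> R;
  cnormD : forall a b : A, cnorm (a + b) <= cnorm a + cnorm b;
  cnormZ : forall (l : R[i]) (a : A), cnorm (l *: a) = normc l * cnorm a;
  cnorm_eq0 : forall a : A, cnorm a = 0 -> a = 0;
  cnorm1 : cnorm (1 : A) = 1;
  cnormM : forall a b : A, cnorm (a * b) <= cnorm a * cnorm b;
  entourage_cnorm :
    (entourage : set_system (A * A)) = entourage_ (norm_ball cnorm);
  star : A -> A;
  starK : involutive star;
  starD : {morph star : a b / a + b};
  starZ : forall (l : R[i]) (a : A), star (l *: a) = l^*%C *: star a;
  starM : forall a b : A, star (a * b) = star b * star a;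
  cnorm_star : forall a : A, cnorm (star a) = cnorm a
}.

#[short(type="normedStarAlgType")]
HB.structure Definition NormedStarAlgebra (R : realType) :=
  {A of Uniform A & GRing.Algebra R[i] A & isNormedStarAlgebra R A}.

Definition norm_uniform (R : realType) (A : zmodType) (nm : A -> R)
  (nmD : forall a b, nm (a + b) <= nm a + nm b)
  (nmN : forall a, nm (- a) = nm a) (nm0 : nm 0 = 0) : Type := A.

Section norm_uniform.
Variables (R : realType) (A : zmodType) (nm : A -> R).
Hypotheses (nmD : forall a b, nm (a + b) <= nm a + nm b).
Hypotheses (nmN : forall a, nm (- a) = nm a) (nm0 : nm 0 = 0).
Let T := norm_uniform nmD nmN nm0.
Let ent : set_system (T * T) := entourage_ (norm_ball nm).
Let nbhsT (a : T) : set_system T := nbhs_ ent a.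

HB.instance Definition _ := Choice.copy T A.
HB.instance Definition _ := hasNbhs.Build T nbhsT.

Let nbhsE : nbhs = nbhs_ ent. Proof. by []. Qed.

Let ball_center (a : T) (e : R) : 0 < e -> norm_ball nm a e a.
Proof. by rewrite /norm_ball /= subrr nm0. Qed.

Let ball_sym (a b : T) (e : R) : norm_ball nm a e b -> norm_ball nm b e a.
Proof. by rewrite /norm_ball /= -nmN opprB. Qed.

Let ball_triangle (a b c : T) (e1 e2 : R) :
  norm_ball nm a e1 b -> norm_ball nm b e2 c -> norm_ball nm a (e1 + e2) c.
Proof.
rewrite /norm_ball /= => ab bc.
have -> : (a : A) - c = (a - b) + (b - c) by rewrite addrA subrK.
by rewrite (le_lt_trans (nmD _ _)) // ltrD.
Qed.

Let entE : ent = entourage_ (norm_ball nm). Proof. by []. Qed.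

HB.instance Definition _ := @Nbhs_isPseudoMetric.Build R T
  ent nbhsE (norm_ball nm) ball_center ball_sym ball_triangle entE.

Lemma norm_uniform_entourage :
  (entourage : set_system (T * T)) = entourage_ (norm_ball nm).
Proof. by []. Qed.

End norm_uniform.

HB.factory Record Algebra_isNormedStarAlgebra (R : realType) A
    of GRing.Algebra R[i] A := {
  cnorm : A -> R;
  cnormD : forall a b : A, cnorm (a + b) <= cnorm a + cnorm b;
  cnormZ : forall (l : R[i]) (a : A), cnorm (l *: a) = normc l * cnorm a;
  cnorm_eq0 : forall a : A, cnorm a = 0 -> a = 0;
  cnorm1 : cnorm (1 : A) = 1;
  cnormM : forall a b : A, cnorm (a * b) <= cnorm a * cnorm b;
  star : A -> A;
  starK : involutive star;
  starD : {morph star : a b / a + b};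
  starZ : forall (l : R[i]) (a : A), star (l *: a) = l^*%C *: star a;
  starM : forall a b : A, star (a * b) = star b * star a;
  cnorm_star : forall a : A, cnorm (star a) = cnorm a
}.

HB.builders Context R A of Algebra_isNormedStarAlgebra R A.

Let nmN (a : A) : cnorm (- a) = cnorm a.
Proof. by rewrite -scaleN1r cnormZ normcN normc1 mul1r. Qed.

Let nm0 : cnorm (0 : A) = 0.
Proof. by rewrite -(scale0r (0 : A)) cnormZ normc0 mul0r. Qed.

HB.instance Definition _ := Uniform.copy A (norm_uniform cnormD nmN nm0).

HB.instance Definition _ := isNormedStarAlgebra.Build R A
  cnormD cnormZ cnorm_eq0 cnorm1 cnormM
  (norm_uniform_entourage cnormD nmN nm0)
  starK starD starZ starM cnorm_star.

HB.end.

Section normed_star_algebra_theory.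
Variables (R : realType) (A : normedStarAlgType R).
Implicit Types (a b : A) (X : set A).

Lemma cnorm0 : cnorm (0 : A) = 0.
Proof. by rewrite -(scale0r (0 : A)) cnormZ normc0 mul0r. Qed.

Lemma cnormN a : cnorm (- a) = cnorm a.
Proof. by rewrite -scaleN1r cnormZ normcN normc1 mul1r. Qed.

Lemma cdistC a b : cnorm (a - b) = cnorm (b - a).
Proof. by rewrite -cnormN opprB. Qed.

Lemma cnorm_ge0 a : 0 <= cnorm a.
Proof.
have := cnormD a (- a); rewrite subrr cnorm0 cnormN -mulr2n.
by rewrite pmulrn_lge0.
Qed.

Lemma cnormB a b : cnorm (a - b) <= cnorm a + cnorm b.
Proof. by rewrite (le_trans (cnormD _ _)) // cnormN. Qed.

Lemma star0 : star (0 : A) = 0.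
Proof. by apply: (@addrI _ (star (0 : A))); rewrite -starD !addr0. Qed.

Lemma starN a : star (- a) = - star a.
Proof. by apply: (@addrI _ (star a)); rewrite -starD !subrr star0. Qed.

Lemma starB a b : star (a - b) = star a - star b.
Proof. by rewrite starD starN. Qed.

Lemma star1 : star (1 : A) = 1.
Proof. by rewrite -[LHS]mulr1 -{2}(starK 1) -starM mulr1 starK. Qed.

Lemma closure_cnormP X a :
  closure X a <-> forall e : R, 0 < e -> exists2 x, X x & cnorm (a - x) < e.
Proof.
have nbhs_cnorm U : nbhs a U <-> exists2 e : R, 0 < e & norm_ball (@cnorm R A) a e `<=` U.
  rewrite -nbhs_entourageE /nbhs_ entourage_cnorm; split.
    move=> [E [e /= e0 eE] EU]; exists e => // b ab.
    by apply: EU; rewrite /xsection /= inE; apply: eE.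
  move=> [e e0 eU]; exists [set p | norm_ball (@cnorm R A) p.1 e p.2].
    by exists e => // -[].
  by move=> b; rewrite /xsection /= inE => ab; exact: eU.
split=> [cX e e0|H B /nbhs_cnorm[e e0 eB]].
  have [|b [Xb ab]] := cX (norm_ball (@cnorm R A) a e); last by exists b.
  by apply/nbhs_cnorm; exists e.
by have [x Xx ax] := H _ e0; exists x; split=> //; exact: eB.
Qed.

End normed_star_algebra_theory.

Section self_adjoint.
Variables (R : realType) (A : normedStarAlgType R).

Definition self_adjoint : set A := [set a | star a = a].

Definition re_part (a : A) : A := (2 : R[i])^-1 *: (a + star a).
Definition im_part (a : A) : A := (2 * 'i%C : R[i])^-1 *: (a - star a).

Definition jordan (a b : A) : A := (2 : R[i])^-1 *: (a * b + b * a).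
Definition lie (a b : A) : A := (2 * 'i%C : R[i])^-1 *: (a * b - b * a).

(* Completeness and the C*-identity; the rest is in the structure. *)
Definition cstar_algebra : Prop :=
  (forall F : set_system A, ProperFilter F -> cauchy F ->
    exists a : A, F --> a) /\
  (forall a : A, cnorm (star a * a) = cnorm a ^+ 2).

End self_adjoint.

Definition star_preserving (R : realType) (A B : normedStarAlgType R)
  (f : A -> B) : Prop := forall a, f (star a) = star (f a).

Definition star_isomorphic (R : realType) (A B : normedStarAlgType R) : Prop :=
  exists2 f : {lrmorphism A -> B}, bijective f & star_preserving f.

Section product.
Variables (R : realType) (A B : normedStarAlgType R).
Let T := (A * B)%type.

Definition pair_cnorm (x : T) : R := Num.max (cnorm x.1) (cnorm x.2).
Definition pair_star (x : T) : T := (star x.1, star x.2).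

Let nmD (x y : T) : pair_cnorm (x + y) <= pair_cnorm x + pair_cnorm y.
Proof.
rewrite /pair_cnorm ge_max; apply/andP; split;
  rewrite (le_trans (cnormD _ _)) // lerD // le_max lexx ?orbT //.
Qed.

Let nmZ (l : R[i]) (x : T) : pair_cnorm (l *: x) = normc l * pair_cnorm x.
Proof. by rewrite /pair_cnorm !cnormZ maxr_pMr //; case: l => a b; exact: sqrtr_ge0. Qed.

Let nm_eq0 (x : T) : pair_cnorm x = 0 -> x = 0.
Proof.
move=> x0; have : pair_cnorm x <= 0 by rewrite x0.
rewrite /pair_cnorm ge_max => /andP[x1 x2]; rewrite [x]surjective_pairing.
by congr (_, _); apply: cnorm_eq0; apply/le_anti; rewrite ?x1 ?x2 cnorm_ge0.
Qed.

Let nm1 : pair_cnorm (1 : T) = 1.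
Proof. by rewrite /pair_cnorm /= !cnorm1 maxxx. Qed.

Let nmM (x y : T) : pair_cnorm (x * y) <= pair_cnorm x * pair_cnorm y.
Proof.
rewrite /pair_cnorm ge_max; apply/andP; split;
  rewrite (le_trans (cnormM _ _)) // ler_pM ?cnorm_ge0 // le_max lexx ?orbT //.
Qed.

Let entP :
  (entourage : set_system (T * T)) = entourage_ (norm_ball pair_cnorm).
Proof.
rewrite predeqE => E; split.
  move=> [[P Q] /= [PA QB] PQE]; move: PA QB.
  rewrite !entourage_cnorm => -[e /= e0 eP] [e' /= e'0 eQ].
  exists (Num.min e e'); first by rewrite /= lt_min e0 e'0.
  move=> [x y]; rewrite /norm_ball /pair_cnorm /= gt_max !lt_min.
  move=> /andP[/andP[xye _] /andP[_ xye']].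
  have [] := PQE ((x.1, y.1), (x.2, y.2)); first by split; [exact: eP | exact: eQ].
  move: x y xye xye' => [a b] [c d] /= _ _ [[p1 p2] [q1 q2]] /= + [<- <- <- <-].
  by [].
move=> [e /= e0 eE].
have eA : entourage [set p : A * A | norm_ball (@cnorm R A) p.1 e p.2].
  by rewrite entourage_cnorm; exists e => // -[].
have eB : entourage [set p : B * B | norm_ball (@cnorm R B) p.1 e p.2].
  by rewrite entourage_cnorm; exists e => // -[].
apply: filterS (prod_entP eA eB) => -[x y] /= [xye xye']; apply: eE.
by rewrite /norm_ball /pair_cnorm /= gt_max xye.
Qed.

Let stK : involutive pair_star.
Proof. by move=> [a b]; rewrite /pair_star /= !starK. Qed.

Let stD : {morph pair_star : x y / x + y}.
Proof. by move=> [a b] [c d]; rewrite /pair_star /= !starD. Qed.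

Let stZ (l : R[i]) (x : T) : pair_star (l *: x) = l^*%C *: pair_star x.
Proof. by case: x => a b; rewrite /pair_star /= !starZ. Qed.

Let stM (x y : T) : pair_star (x * y) = pair_star y * pair_star x.
Proof. by case: x y => [a b] [c d]; rewrite /pair_star /= !starM. Qed.

Let nm_star (x : T) : pair_cnorm (pair_star x) = pair_cnorm x.
Proof. by rewrite /pair_cnorm /= !cnorm_star. Qed.

HB.instance Definition _ := @isNormedStarAlgebra.Build R (A * B)%type
  pair_cnorm nmD nmZ nm_eq0 nm1 nmM entP pair_star stK stD stZ stM nm_star.

End product.

Section subalgebra.
Variables (R : realType) (A : normedStarAlgType R).

Definition cstar_subalgebra (X : set A) : Prop :=
  [/\ X 1,
      forall (l : R[i]) a b, X a -> X b -> X (l *: a + b),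
      forall a b, X a -> X b -> X (a * b),
      forall a, X a -> X (star a) &
      closed X].

Record cstar_sub := CStarSub {
  csub_set : set A;
  csubP : cstar_subalgebra csub_set
}.

Definition csub_pred (X : cstar_sub) : {pred A} := fun a => `[< csub_set X a >].

Definition csub_sort (X : cstar_sub) : Type := {a : A | csub_pred X a}.

End subalgebra.

Coercion csub_sort : cstar_sub >-> Sortclass.

Section subalgebra_instances.
Variables (R : realType) (A : normedStarAlgType R) (X : cstar_sub A).

Let X_subalg : GRing.subalg_closed (csub_pred X).
Proof.
have [X1 XL XM _ _] := csubP X; split; first exact/asboolP.
  by move=> l a b /asboolP Xa /asboolP Xb; apply/asboolP; exact: XL.
by move=> a b /asboolP Xa /asboolP Xb; apply/asboolP; exact: XM.
Qed.

HB.instance Definition _ :=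
  GRing.isSubalgClosed.Build R[i] A (csub_pred X) (GRing.subalg_closed_semi X_subalg).

HB.instance Definition _ := [isSub of csub_sort X for @sval A (csub_pred X)].
HB.instance Definition _ := [Choice of csub_sort X by <:].
HB.instance Definition _ := [SubChoice_isSubAlgebra of csub_sort X by <:].

Definition csub_val (x : X) : A := sval x.

Lemma csub_val_inj : injective csub_val.
Proof. exact: val_inj. Qed.

Let val_zmod : zmod_morphism csub_val. Proof. by []. Qed.
Let val_scal : scalable csub_val. Proof. by []. Qed.
Let val_monoid : monoid_morphism csub_val. Proof. by []. Qed.
HB.instance Definition _ :=
  GRing.isZmodMorphism.Build (csub_sort X) A csub_val val_zmod.
HB.instance Definition _ :=
  GRing.isScalable.Build R[i] (csub_sort X) A *:%R csub_val val_scal.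
HB.instance Definition _ :=
  GRing.isMonoidMorphism.Build (csub_sort X) A csub_val val_monoid.

Lemma csub_valD (x y : X) : csub_val (x + y) = csub_val x + csub_val y.
Proof. by []. Qed.

Lemma csub_valM (x y : X) : csub_val (x * y) = csub_val x * csub_val y.
Proof. by []. Qed.

Lemma csub_valZ (l : R[i]) (x : X) : csub_val (l *: x) = l *: csub_val x.
Proof. by []. Qed.

Lemma csub_valP (x : X) : csub_set X (csub_val x).
Proof. exact/asboolP/(valP x). Qed.

Definition csub_elt (a : A) (Xa : csub_set X a) : X := Sub a (asboolT Xa).

Let st_in (x : X) : csub_set X (star (csub_val x)).
Proof. by have [_ _ _ XS _] := csubP X; exact/XS/csub_valP. Qed.

Definition csub_star (x : X) : X := csub_elt (st_in x).

Let nmD (x y : X) : cnorm (csub_val (x + y)) <= cnorm (csub_val x) + cnorm (csub_val y).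
Proof. by rewrite csub_valD cnormD. Qed.

Let nmZ (l : R[i]) (x : X) : cnorm (csub_val (l *: x)) = normc l * cnorm (csub_val x).
Proof. by rewrite csub_valZ cnormZ. Qed.

Let nm_eq0 (x : X) : cnorm (csub_val x) = 0 -> x = 0.
Proof. by move=> /cnorm_eq0 x0; apply: csub_val_inj; rewrite x0 raddf0. Qed.

Let nm1 : cnorm (csub_val (1 : X)) = 1.
Proof. exact: cnorm1. Qed.

Let nmM (x y : X) : cnorm (csub_val (x * y)) <= cnorm (csub_val x) * cnorm (csub_val y).
Proof. by rewrite csub_valM cnormM. Qed.

Let val_star (x : X) : csub_val (csub_star x) = star (csub_val x).
Proof. by []. Qed.

Let stK : involutive csub_star.
Proof. by move=> x; apply: csub_val_inj; rewrite !val_star starK. Qed.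

Let stD : {morph csub_star : x y / x + y}.
Proof.
by move=> x y; apply: csub_val_inj; rewrite !(val_star, csub_valD) starD.
Qed.

Let stZ (l : R[i]) (x : X) : csub_star (l *: x) = l^*%C *: csub_star x.
Proof. by apply: csub_val_inj; rewrite !(val_star, csub_valZ) starZ. Qed.

Let stM (x y : X) : csub_star (x * y) = csub_star y * csub_star x.
Proof. by apply: csub_val_inj; rewrite !(val_star, csub_valM) starM. Qed.

Let nm_star (x : X) : cnorm (csub_val (csub_star x)) = cnorm (csub_val x).
Proof. by rewrite val_star cnorm_star. Qed.

HB.instance Definition _ := Algebra_isNormedStarAlgebra.Build R (csub_sort X)
  nmD nmZ nm_eq0 nm1 nmM stK stD stZ stM nm_star.

End subalgebra_instances.

Section bounded_product.
Variables (R : realType) (B : nat -> normedStarAlgType R).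

Record bounded_product := BoundedProduct {
  bp_val :> forall n, B n;
  bp_bounded : exists M : R, forall n, cnorm (bp_val n) <= M
}.

HB.instance Definition _ := gen_eqMixin bounded_product.
HB.instance Definition _ := gen_choiceMixin bounded_product.

Implicit Types x y z : bounded_product.

Lemma bp_eq x y : (forall n, x n = y n) -> x = y.
Proof.
case: x y => [x xb] [y yb] /= xy.
have {}xy : x = y by apply: functional_extensionality_dep.
by rewrite xy in xb yb *; congr BoundedProduct; exact: Prop_irrelevance.
Qed.

Let bp0_bounded : exists M : R, forall n, cnorm (0 : B n) <= M.
Proof. by exists 0 => n; rewrite cnorm0. Qed.
Definition bp_zero := BoundedProduct bp0_bounded.

Let bp1_bounded : exists M : R, forall n, cnorm (1 : B n) <= M.
Proof. by exists 1 => n; rewrite cnorm1. Qed.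
Definition bp_one := BoundedProduct bp1_bounded.

Let bpD_bounded x y : exists M : R, forall n, cnorm (x n + y n) <= M.
Proof.
have [[M xM] [N yN]] := (bp_bounded x, bp_bounded y).
by exists (M + N) => n; rewrite (le_trans (cnormD _ _)) // lerD.
Qed.
Definition bp_add x y := BoundedProduct (bpD_bounded x y).

Let bpN_bounded x : exists M : R, forall n, cnorm (- x n) <= M.
Proof.
by have [M xM] := bp_bounded x; exists M => n; rewrite cnormN.
Qed.
Definition bp_opp x := BoundedProduct (bpN_bounded x).

Let bpM_bounded x y : exists M : R, forall n, cnorm (x n * y n) <= M.
Proof.
have [[M xM] [N yN]] := (bp_bounded x, bp_bounded y).
exists (M * N) => n; rewrite (le_trans (cnormM _ _)) //.
by rewrite ler_pM ?cnorm_ge0.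
Qed.
Definition bp_mul x y := BoundedProduct (bpM_bounded x y).

Let bpZ_bounded (l : R[i]) x : exists M : R, forall n, cnorm (l *: x n) <= M.
Proof.
have [M xM] := bp_bounded x; exists (normc l * M) => n.
by rewrite cnormZ ler_wpM2l //; case: (l) => a b; exact: sqrtr_ge0.
Qed.
Definition bp_scale (l : R[i]) x := BoundedProduct (bpZ_bounded l x).

Let bpS_bounded x : exists M : R, forall n, cnorm (star (x n)) <= M.
Proof.
by have [M xM] := bp_bounded x; exists M => n; rewrite cnorm_star.
Qed.
Definition bp_star x := BoundedProduct (bpS_bounded x).

Fact bp_addA : associative bp_add.
Proof. by move=> x y z; apply: bp_eq => n /=; rewrite addrA. Qed.
Fact bp_addC : commutative bp_add.
Proof. by move=> x y; apply: bp_eq => n /=; rewrite addrC. Qed.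
Fact bp_add0 : left_id bp_zero bp_add.
Proof. by move=> x; apply: bp_eq => n /=; rewrite add0r. Qed.
Fact bp_addN : left_inverse bp_zero bp_opp bp_add.
Proof. by move=> x; apply: bp_eq => n /=; rewrite addNr. Qed.
HB.instance Definition _ := GRing.isZmodule.Build bounded_product
  bp_addA bp_addC bp_add0 bp_addN.

Fact bp_mulA : associative bp_mul.
Proof. by move=> x y z; apply: bp_eq => n /=; rewrite mulrA. Qed.
Fact bp_mul1l : left_id bp_one bp_mul.
Proof. by move=> x; apply: bp_eq => n /=; rewrite mul1r. Qed.
Fact bp_mul1r : right_id bp_one bp_mul.
Proof. by move=> x; apply: bp_eq => n /=; rewrite mulr1. Qed.
Fact bp_mulDl : left_distributive bp_mul +%R.
Proof. by move=> x y z; apply: bp_eq => n /=; rewrite mulrDl. Qed.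
Fact bp_mulDr : right_distributive bp_mul +%R.
Proof. by move=> x y z; apply: bp_eq => n /=; rewrite mulrDr. Qed.
Fact bp_one_neq0 : bp_one != 0.
Proof.
apply/eqP => /(congr1 (fun x : bounded_product => x 0%N)) /= /eqP.
by rewrite oner_eq0.
Qed.
HB.instance Definition _ := GRing.Zmodule_isNzRing.Build bounded_product
  bp_mulA bp_mul1l bp_mul1r bp_mulDl bp_mulDr bp_one_neq0.

Fact bp_scaleA (k l : R[i]) x : bp_scale k (bp_scale l x) = bp_scale (k * l) x.
Proof. by apply: bp_eq => n /=; rewrite scalerA. Qed.
Fact bp_scale1 : left_id 1 bp_scale.
Proof. by move=> x; apply: bp_eq => n /=; rewrite scale1r. Qed.
Fact bp_scaleDr : right_distributive bp_scale +%R.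
Proof. by move=> k x y; apply: bp_eq => n /=; rewrite scalerDr. Qed.
Fact bp_scaleDl x : {morph bp_scale^~ x : k l / k + l}.
Proof. by move=> k l; apply: bp_eq => n /=; rewrite scalerDl. Qed.
HB.instance Definition _ := GRing.Zmodule_isLmodule.Build R[i] bounded_product
  bp_scaleA bp_scale1 bp_scaleDr bp_scaleDl.

Fact bp_scaleAl (k : R[i]) x y : k *: (x * y) = k *: x * y.
Proof. by apply: bp_eq => n /=; rewrite scalerAl. Qed.
HB.instance Definition _ :=
  GRing.Lmodule_isLalgebra.Build R[i] bounded_product bp_scaleAl.

Fact bp_scaleAr (k : R[i]) x y : k *: (x * y) = x * (k *: y).
Proof. by apply: bp_eq => n /=; rewrite scalerAr. Qed.
HB.instance Definition _ :=
  GRing.Lalgebra_isAlgebra.Build R[i] bounded_product bp_scaleAr.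

Definition bp_cnorm x : R := sup (range (fun n => cnorm (x n))).

Lemma bp_cnorm_ub x n : cnorm (x n) <= bp_cnorm x.
Proof.
apply: ub_le_sup; last by exists n.
by have [M xM] := bp_bounded x; exists M => _ [k _ <-].
Qed.

Lemma bp_cnorm_le x (M : R) : (forall n, cnorm (x n) <= M) -> bp_cnorm x <= M.
Proof.
move=> xM; apply: ge_sup; first by exists (cnorm (x 0%N)); exists 0%N.
by move=> _ [k _ <-].
Qed.

Let nm_ge0 x : 0 <= bp_cnorm x.
Proof. exact: le_trans (cnorm_ge0 (x 0%N)) (bp_cnorm_ub _ _). Qed.

Let nmD x y : bp_cnorm (x + y) <= bp_cnorm x + bp_cnorm y.
Proof.
apply: bp_cnorm_le => n; rewrite (le_trans (cnormD _ _)) //.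
by rewrite lerD ?bp_cnorm_ub.
Qed.

Let nmZ_le (l : R[i]) x : bp_cnorm (l *: x) <= normc l * bp_cnorm x.
Proof.
apply: bp_cnorm_le => n; rewrite cnormZ ler_wpM2l ?bp_cnorm_ub //.
by case: (l) => a b; exact: sqrtr_ge0.
Qed.

Let nmZ (l : R[i]) x : bp_cnorm (l *: x) = normc l * bp_cnorm x.
Proof.
have [->|l0] := eqVneq l 0.
  apply/le_anti/andP; split; first exact: nmZ_le.
  by rewrite normc0 mul0r nm_ge0.
apply/le_anti; rewrite nmZ_le /=.
have nl : 0 < normc l.
  rewrite lt0r; apply/andP; split; last by case: (l) => a b; exact: sqrtr_ge0.
  by apply: contra l0 => /eqP/eq0_normc ->.
rewrite mulrC -ler_pdivlMr // mulrC -normcV.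
by have := nmZ_le l^-1 (l *: x); rewrite scalerA mulVf // scale1r.
Qed.

Let nm_eq0 x : bp_cnorm x = 0 -> x = 0.
Proof.
move=> x0; apply: bp_eq => n; apply: cnorm_eq0; apply/le_anti.
by rewrite cnorm_ge0 andbT -x0 bp_cnorm_ub.
Qed.

Let nm1 : bp_cnorm 1 = 1.
Proof.
apply/le_anti; rewrite bp_cnorm_le /=; last by move=> n; rewrite cnorm1.
by have := bp_cnorm_ub 1 0%N; rewrite cnorm1.
Qed.

Let nmM x y : bp_cnorm (x * y) <= bp_cnorm x * bp_cnorm y.
Proof.
apply: bp_cnorm_le => n; rewrite (le_trans (cnormM _ _)) //.
by rewrite ler_pM ?cnorm_ge0 ?bp_cnorm_ub.
Qed.

Let stK : involutive bp_star.
Proof. by move=> x; apply: bp_eq => n /=; rewrite starK. Qed.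
Let stD : {morph bp_star : x y / x + y}.
Proof. by move=> x y; apply: bp_eq => n /=; rewrite starD. Qed.
Let stZ (l : R[i]) x : bp_star (l *: x) = l^*%C *: bp_star x.
Proof. by apply: bp_eq => n /=; rewrite starZ. Qed.
Let stM x y : bp_star (x * y) = bp_star y * bp_star x.
Proof. by apply: bp_eq => n /=; rewrite starM. Qed.
Let nm_star x : bp_cnorm (bp_star x) = bp_cnorm x.
Proof. by rewrite /bp_cnorm /=; under eq_fun do rewrite cnorm_star. Qed.

HB.instance Definition _ := Algebra_isNormedStarAlgebra.Build R bounded_product
  nmD nmZ nm_eq0 nm1 nmM stK stD stZ stM nm_star.

End bounded_product.

Local Open Scope quotient_scope.

Section quotient.
Variables (R : realType) (B : normedStarAlgType R).

Definition closed_star_ideal (I : set B) : Prop :=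
  [/\ I 0, forall a b, I a -> I b -> I (a - b),
      forall a b, I b -> I (a * b) /\ I (b * a),
      forall a, I a -> I (star a) &
      closed I] /\ ~ I 1.

Record star_ideal := StarIdeal {
  ideal_set : set B;
  idealP : closed_star_ideal ideal_set
}.

Definition ideal_pred (I : star_ideal) : {pred B} :=
  fun a => `[< ideal_set I a >].

Section zmod_closed.
Variable I : star_ideal.

Let I_zmod : zmod_closed (ideal_pred I).
Proof.
have [[I0 IB _ _ _] _] := idealP I; split; first exact/asboolP.
by move=> a b /asboolP Ia /asboolP Ib; apply/asboolP; exact: IB.
Qed.

HB.instance Definition _ := GRing.isZmodClosed.Build B (ideal_pred I) I_zmod.

End zmod_closed.

Variable I : star_ideal.

Definition quotient : Type := Quotient.quot (ideal_pred I).

HB.instance Definition _ := Choice.on quotient.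
HB.instance Definition _ := GRing.Zmodule.on quotient.
HB.instance Definition _ := EqQuotient.on quotient.

Definition quot_map (a : B) : quotient := \pi_quotient a.

Lemma quot_mapP (a b : B) : quot_map a = quot_map b <-> ideal_set I (a - b).
Proof.
rewrite /quot_map; split.
  by move=> /eqP; rewrite -Quotient.idealrBE => /asboolP.
by move=> Iab; apply/eqP; rewrite -Quotient.idealrBE; exact/asboolP.
Qed.

Lemma quot_map_surj (x : quotient) : exists a, quot_map a = x.
Proof. by exists (repr x); exact: reprK. Qed.

Lemma quot_mapD (a b : B) : quot_map (a + b) = quot_map a + quot_map b.
Proof. exact: Quotient.pi_add. Qed.

Definition quot_one : quotient := quot_map 1.
Definition quot_mul (x y : quotient) : quotient := quot_map (repr x * repr y).
Definition quot_scale (l : R[i]) (x : quotient) : quotient :=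
  quot_map (l *: repr x).
Definition quot_star (x : quotient) : quotient := quot_map (star (repr x)).

Let I_repr (a : B) : ideal_set I (repr (quot_map a) - a).
Proof. by apply/quot_mapP; exact: reprK. Qed.

Let I_mull (a b : B) : ideal_set I b -> ideal_set I (a * b).
Proof. by have [[_ _ IM _ _] _] := idealP I; case/(IM a). Qed.

Let I_mulr (a b : B) : ideal_set I a -> ideal_set I (a * b).
Proof. by have [[_ _ IM _ _] _] := idealP I; case/(IM b). Qed.

Let I_D (a b : B) : ideal_set I a -> ideal_set I b -> ideal_set I (a + b).
Proof.
have [[I0 IB _ _ _] _] := idealP I; move=> Ia Ib; rewrite -[b]opprK; apply: (IB) => //.
by rewrite -sub0r; exact: IB.
Qed.

Lemma quot_mapM (a b : B) : quot_mul (quot_map a) (quot_map b) = quot_map (a * b).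
Proof.
apply/quot_mapP; set a' := repr _; set b' := repr _.
have -> : a' * b' - a * b = (a' - a) * b' + a * (b' - b).
  by rewrite mulrBl mulrBr addrA subrK.
by apply: I_D; [exact/I_mulr/I_repr | exact/I_mull/I_repr].
Qed.

Lemma quot_mapZ (l : R[i]) (a : B) : quot_scale l (quot_map a) = quot_map (l *: a).
Proof.
apply/quot_mapP; rewrite -scalerBr -[X in l *: X]mul1r scalerAl.
exact/I_mull/I_repr.
Qed.

Lemma quot_map_star (a : B) : quot_star (quot_map a) = quot_map (star a).
Proof.
apply/quot_mapP; rewrite -starB.
by have [[_ _ _ IS _] _] := idealP I; exact/IS/I_repr.
Qed.

Fact quot_mulA : associative quot_mul.
Proof.
move=> x y z; have [a <-] := quot_map_surj x; have [b <-] := quot_map_surj y.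
by have [c <-] := quot_map_surj z; rewrite !quot_mapM mulrA.
Qed.
Fact quot_mul1l : left_id quot_one quot_mul.
Proof. by move=> x; have [a <-] := quot_map_surj x; rewrite quot_mapM mul1r. Qed.
Fact quot_mul1r : right_id quot_one quot_mul.
Proof. by move=> x; have [a <-] := quot_map_surj x; rewrite quot_mapM mulr1. Qed.
Fact quot_mulDl : left_distributive quot_mul +%R.
Proof.
move=> x y z; have [a <-] := quot_map_surj x; have [b <-] := quot_map_surj y.
have [c <-] := quot_map_surj z.
by rewrite -quot_mapD !quot_mapM mulrDl quot_mapD.
Qed.
Fact quot_mulDr : right_distributive quot_mul +%R.
Proof.
move=> x y z; have [a <-] := quot_map_surj x; have [b <-] := quot_map_surj y.
have [c <-] := quot_map_surj z.
by rewrite -quot_mapD !quot_mapM mulrDr quot_mapD.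
Qed.
Let quot_map0 : quot_map 0 = 0.
Proof. by apply: (@addrI _ (quot_map 0)); rewrite -quot_mapD !addr0. Qed.
Fact quot_one_neq0 : quot_one != 0.
Proof.
apply/eqP; rewrite -quot_map0 => /quot_mapP; rewrite subr0.
by have [_] := idealP I.
Qed.
HB.instance Definition _ := GRing.Zmodule_isNzRing.Build quotient
  quot_mulA quot_mul1l quot_mul1r quot_mulDl quot_mulDr quot_one_neq0.

Fact quot_scaleA (k l : R[i]) x : quot_scale k (quot_scale l x) = quot_scale (k * l) x.
Proof. by have [a <-] := quot_map_surj x; rewrite !quot_mapZ scalerA. Qed.
Fact quot_scale1 : left_id 1 quot_scale.
Proof. by move=> x; have [a <-] := quot_map_surj x; rewrite quot_mapZ scale1r. Qed.
Fact quot_scaleDr : right_distributive quot_scale +%R.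
Proof.
move=> k x y; have [a <-] := quot_map_surj x; have [b <-] := quot_map_surj y.
by rewrite -quot_mapD !quot_mapZ scalerDr quot_mapD.
Qed.
Fact quot_scaleDl x : {morph quot_scale^~ x : k l / k + l}.
Proof.
move=> k l; have [a <-] := quot_map_surj x.
by rewrite !quot_mapZ scalerDl quot_mapD.
Qed.
HB.instance Definition _ := GRing.Zmodule_isLmodule.Build R[i] quotient
  quot_scaleA quot_scale1 quot_scaleDr quot_scaleDl.

Fact quot_scaleAl (k : R[i]) (x y : quotient) : k *: (x * y) = k *: x * y.
Proof.
have [a <-] := quot_map_surj x; have [b <-] := quot_map_surj y.
rewrite [LHS](_ : _ = quot_scale k (quot_mul (quot_map a) (quot_map b))) //.
rewrite [RHS](_ : _ = quot_mul (quot_scale k (quot_map a)) (quot_map b)) //.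
by rewrite quot_mapZ !quot_mapM quot_mapZ scalerAl.
Qed.
HB.instance Definition _ :=
  GRing.Lmodule_isLalgebra.Build R[i] quotient quot_scaleAl.

Fact quot_scaleAr (k : R[i]) (x y : quotient) : k *: (x * y) = x * (k *: y).
Proof.
have [a <-] := quot_map_surj x; have [b <-] := quot_map_surj y.
rewrite [LHS](_ : _ = quot_scale k (quot_mul (quot_map a) (quot_map b))) //.
rewrite [RHS](_ : _ = quot_mul (quot_map a) (quot_scale k (quot_map b))) //.
by rewrite quot_mapZ !quot_mapM quot_mapZ scalerAr.
Qed.
HB.instance Definition _ :=
  GRing.Lalgebra_isAlgebra.Build R[i] quotient quot_scaleAr.

Definition quot_cnorm (x : quotient) : R :=
  inf [set cnorm a | a in [set a | quot_map a = x]].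

Lemma quot_cnorm_lb (a : B) : quot_cnorm (quot_map a) <= cnorm a.
Proof.
apply: ge_inf; last by exists a.
by exists 0 => _ [b _ <-]; exact: cnorm_ge0.
Qed.

Lemma quot_cnorm_lt (x : quotient) (e : R) : 0 < e ->
  exists2 a, quot_map a = x & cnorm a < quot_cnorm x + e.
Proof.
move=> e0; have hx : has_inf [set cnorm a | a in [set a | quot_map a = x]].
  split; first by have [a ax] := quot_map_surj x; exists (cnorm a), a.
  by exists 0 => _ [b _ <-]; exact: cnorm_ge0.
by have [_ [a ax <-] alt] := inf_adherent e0 hx; exists a.
Qed.

Let nm_ge0 (x : quotient) : 0 <= quot_cnorm x.
Proof.
apply/ler_addgt0Pr => e e0; have [a _ alt] := quot_cnorm_lt x e0.
exact: le_trans (cnorm_ge0 a) (ltW alt).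
Qed.

Let nmD (x y : quotient) : quot_cnorm (x + y) <= quot_cnorm x + quot_cnorm y.
Proof.
apply/ler_addgt0Pr => e e0; have e20 : 0 < e / 2 by rewrite divr_gt0.
have [a ax alt] := quot_cnorm_lt x e20; have [b bx blt] := quot_cnorm_lt y e20.
rewrite [e]splitr addrACA -ax -bx -quot_mapD (le_trans (quot_cnorm_lb _)) //.
by rewrite (le_trans (cnormD _ _)) // lerD // ltW // ?ax ?bx.
Qed.

Let normc_ge0 (l : R[i]) : 0 <= normc l.
Proof. by case: l => a b; exact: sqrtr_ge0. Qed.

Let nmZ_le (l : R[i]) (x : quotient) : quot_cnorm (l *: x) <= normc l * quot_cnorm x.
Proof.
apply/ler_addgt0Pr => e e0.
have l1 : 0 < normc l + 1 by rewrite ltr_wpDl.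
have [a ax alt] := quot_cnorm_lt x (divr_gt0 e0 l1).
rewrite -{1}ax -[l *: quot_map a]/(quot_scale l (quot_map a)) quot_mapZ.
rewrite (le_trans (quot_cnorm_lb _)) // cnormZ.
rewrite (le_trans (ler_wpM2l (normc_ge0 l) (ltW alt))) // mulrDr lerD2l.
by rewrite mulrCA ger_pMr // ler_pdivrMr // mul1r lerDl.
Qed.

Let nmZ (l : R[i]) (x : quotient) : quot_cnorm (l *: x) = normc l * quot_cnorm x.
Proof.
have [->|l0] := eqVneq l 0.
  by apply/le_anti/andP; split; [exact: nmZ_le | rewrite normc0 mul0r nm_ge0].
apply/le_anti/andP; split; first exact: nmZ_le.
have nl : 0 < normc l.
  rewrite lt0r normc_ge0 andbT.
  by apply: contra l0 => /eqP/eq0_normc ->.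
rewrite mulrC -ler_pdivlMr // mulrC -normcV.
by have := nmZ_le l^-1 (l *: x); rewrite scalerA mulVf // scale1r.
Qed.

Let nm_eq0 (x : quotient) : quot_cnorm x = 0 -> x = 0.
Proof.
have [a <-] := quot_map_surj x; move=> a0; rewrite -quot_map0; apply/quot_mapP.
rewrite subr0; have [[I0 IB _ _ clI] _] := idealP I.
apply: clI; apply/closure_cnormP => e e0.
have [b ba blt] := quot_cnorm_lt (quot_map a) e0.
exists (a - b); first exact/quot_mapP.
by rewrite opprB addrC subrK (lt_le_trans blt) // a0 add0r.
Qed.

Let nmM (x y : quotient) : quot_cnorm (x * y) <= quot_cnorm x * quot_cnorm y.
Proof.
apply/ler_addgt0Pr => e e0.
set M := quot_cnorm x + quot_cnorm y + 1.
have M0 : 0 < M by rewrite ltr_wpDl // addr_ge0.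
pose d := Num.min 1 (e / M).
have d0 : 0 < d by rewrite lt_min ltr01 divr_gt0.
have [a ax alt] := quot_cnorm_lt x d0; have [b bx blt] := quot_cnorm_lt y d0.
have -> : x * y = quot_map (a * b) by rewrite -ax -bx -quot_mapM.
rewrite (le_trans (quot_cnorm_lb _)) // (le_trans (cnormM _ _)) //.
rewrite (le_trans (ler_pM (cnorm_ge0 _) (cnorm_ge0 _) (ltW alt) (ltW blt))) //.
rewrite mulrDl mulrDr -addrA lerD2l.
rewrite mulrDr addrA (mulrC (quot_cnorm x)) -mulrDr -mulrDr.
have de : d * M <= e by rewrite -ler_pdivlMr // ge_min lexx orbT.
by rewrite (le_trans _ de) // ler_pM2l // lerD2l ge_min lexx.
Qed.

Let nm1 : quot_cnorm 1 = 1.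
Proof.
apply/le_anti/andP; split.
  by rewrite -(@cnorm1 R B) -[1 : quotient]/(quot_map 1) quot_cnorm_lb.
have n0 : 0 < quot_cnorm 1.
  rewrite lt0r nm_ge0 andbT; apply/eqP => /nm_eq0/eqP.
  by rewrite oner_eq0.
by have := nmM 1 1; rewrite mulr1 -{1}[quot_cnorm 1]mulr1 ler_pM2l.
Qed.

Let stK : involutive quot_star.
Proof.
by move=> x; have [a <-] := quot_map_surj x; rewrite !quot_map_star starK.
Qed.
Let stD : {morph quot_star : x y / x + y}.
Proof.
move=> x y; have [a <-] := quot_map_surj x; have [b <-] := quot_map_surj y.
by rewrite -quot_mapD !quot_map_star starD quot_mapD.
Qed.
Let stZ (l : R[i]) (x : quotient) : quot_star (l *: x) = l^*%C *: quot_star x.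
Proof.
have [a <-] := quot_map_surj x.
rewrite [l *: _](quot_mapZ l a) !quot_map_star starZ.
by rewrite [RHS](quot_mapZ l^*%C (star a)).
Qed.
Let stM (x y : quotient) : quot_star (x * y) = quot_star y * quot_star x.
Proof.
have [a <-] := quot_map_surj x; have [b <-] := quot_map_surj y.
rewrite [_ * _](quot_mapM a b) !quot_map_star starM.
by rewrite [RHS](quot_mapM (star b) (star a)).
Qed.
Let nm_star_le (x : quotient) : quot_cnorm (quot_star x) <= quot_cnorm x.
Proof.
apply/ler_addgt0Pr => e e0; have [a ax alt] := quot_cnorm_lt x e0.
rewrite -{1}ax quot_map_star (le_trans (quot_cnorm_lb _)) // cnorm_star ltW //.
Qed.
Let nm_star (x : quotient) : quot_cnorm (quot_star x) = quot_cnorm x.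
Proof.
by apply/le_anti; rewrite nm_star_le -{1}(stK x) nm_star_le.
Qed.

HB.instance Definition _ := Algebra_isNormedStarAlgebra.Build R quotient
  nmD nmZ nm_eq0 nm1 nmM stK stD stZ stM nm_star.

End quotient.

Local Open Scope ereal_scope.

Definition hausdorff (R : realType) (T : Type) (d : T -> T -> \bar R)
  (X Y : set T) : \bar R :=
  maxe (ereal_sup [set ereal_inf [set d x y | y in Y] | x in X])
       (ereal_sup [set ereal_inf [set d x y | x in X] | y in Y]).

Section lip_norm.
Variables (R : realType) (A : normedStarAlgType R).
Implicit Types (L : A -> \bar R) (phi psi : A -> R[i]).

(* In [mule], 0 * +oo = 0, so that the last clause at r = 0 says L 0 = 0. *)
Definition real_seminorm (X : set A) L : Prop :=
  [/\ forall a, X a -> 0 <= L a,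
      forall a b, X a -> X b -> L (a + b)%R <= L a + L b &
      forall (r : R) a, X a -> L (r%:C *: a)%R = `|r|%:E * L a].

Definition lip_dom L : set A := [set a | self_adjoint a /\ L a < +oo].

Definition lip_ball L : set A := [set a | self_adjoint a /\ L a <= 1].

Definition state : set (A -> R[i]) :=
  [set phi | [/\ scalar phi, phi 1%R = 1%R &
                 forall a : A, (0 <= phi (star a * a))%R]].

Definition mk L phi psi : \bar R :=
  ereal_sup [set (normc (phi a - psi a))%:E | a in lip_ball L].

(* The weak* topology is the trace on the state space of the topology of
   pointwise convergence. *)
Definition mk_metrizes L : Prop :=
  (forall phi psi, state phi -> state psi -> mk L phi psi < +oo) /\
  (forall phi, state phi -> forall U : set (A -> R[i]),
    within state (nbhs (phi : {ptws A -> R[i]^o})) U <->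
    exists2 e : R, (0 < e)%R &
      [set psi | state psi /\ mk L phi psi < e%:E] `<=` U).

(* Only the values of L on the self-adjoint elements matter. *)
Record compact_quantum_metric L : Prop := {
  cqm_cstar : cstar_algebra A;
  cqm_seminorm : real_seminorm (@self_adjoint R A) L;
  cqm_unital : lip_dom L 1%R;
  cqm_dense : self_adjoint (A := A) `<=` closure (lip_dom L);
  cqm_kernel : [set a | self_adjoint a /\ L a = 0] =
               range (fun r : R => (r%:C%:A)%R);
  cqm_mk : mk_metrizes L;
  cqm_lsc : lower_semicontinuous (L : subspace (@self_adjoint R A) -> \bar R)
}.

Definition quasi_leibniz (C D : R) L : Prop :=
  forall a b, lip_dom L a -> lip_dom L b ->
  maxe (L (jordan a b)) (L (lie a b)) <=
  C%:E * ((cnorm a)%:E * L b + (cnorm b)%:E * L a) + D%:E * (L a * L b).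

Definition quasi_leibniz_cqms (C D : R) L : Prop :=
  compact_quantum_metric L /\ quasi_leibniz C D L.

End lip_norm.

Definition quotient_lip (R : realType) (B A : normedStarAlgType R)
  (L : B -> \bar R) (p : B -> A) (a : A) : \bar R :=
  ereal_inf [set L d | d in [set d | self_adjoint d /\ p d = a]].

Section propinquity.
Variable R : realType.

Record tunnel (A1 A2 : normedStarAlgType R) := Tunnel {
  tunnel_alg : normedStarAlgType R;
  tunnel_lip : tunnel_alg -> \bar R;
  tunnel_fst : {lrmorphism tunnel_alg -> A1};
  tunnel_snd : {lrmorphism tunnel_alg -> A2}
}.

Arguments tunnel_lip {A1 A2} t _.

Variables (A1 A2 : normedStarAlgType R).

Definition is_tunnel (C D : R) (L1 : A1 -> \bar R) (L2 : A2 -> \bar R)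
    (t : tunnel A1 A2) : Prop :=
  [/\ quasi_leibniz_cqms C D (tunnel_lip t),
      star_preserving (tunnel_fst t) /\ range (tunnel_fst t) = setT,
      star_preserving (tunnel_snd t) /\ range (tunnel_snd t) = setT,
      forall a, self_adjoint a ->
        L1 a = quotient_lip (tunnel_lip t) (tunnel_fst t) a &
      forall a, self_adjoint a ->
        L2 a = quotient_lip (tunnel_lip t) (tunnel_snd t) a].

Definition extent (t : tunnel A1 A2) : \bar R :=
  maxe (hausdorff (mk (tunnel_lip t)) (@state R _)
          [set phi \o tunnel_fst t | phi in @state R A1])
       (hausdorff (mk (tunnel_lip t)) (@state R _)
          [set phi \o tunnel_snd t | phi in @state R A2]).

Definition propinquity (C D : R) (L1 : A1 -> \bar R) (L2 : A2 -> \bar R)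
    : \bar R :=
  ereal_inf [set x | exists2 t, is_tunnel C D L1 L2 t & x = extent t].

End propinquity.

Arguments tunnel_lip {R A1 A2} t _.

Section convergence.
Variables (R : realType) (C D : R).
Variables (A : normedStarAlgType R) (E : nat -> normedStarAlgType R).
Variable L : forall n, E n -> \bar R.
Arguments L n _ : clear implicits.

Definition propinquity_cauchy : Prop :=
  forall e : R, (0 < e)%R -> exists N, forall m n, (N <= m)%N -> (N <= n)%N ->
  propinquity C D (L m) (L n) < e%:E.

Definition cstar_convergent (B : normedStarAlgType R) (LB : B -> \bar R) : Prop :=
  [/\ forall n, quasi_leibniz_cqms C D (L n),
      propinquity_cauchy,
      quasi_leibniz_cqms C D LB,
      propinquity C D (L n) LB @[n --> \oo] --> 0 &
      star_isomorphic A B].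

End convergence.

Section tunnel_sequence.
Variables (R : realType) (E : nat -> normedStarAlgType R).
Variable (tau : forall n, tunnel (E n) (E n.+1)).

Definition tau_prod : Type :=
  bounded_product (fun n => tunnel_alg (tau n)).

Implicit Types d : tau_prod.

Definition tau_lip d : \bar R :=
  ereal_sup (range (fun n => tunnel_lip (tau n) (d n))).

Definition tau_K : set tau_prod :=
  [set d : tau_prod | self_adjoint d /\
     forall n, tunnel_fst (tau n.+1) (d n.+1) = tunnel_snd (tau n) (d n)].

Definition tau_L : set tau_prod := [set d : tau_prod | tau_K d /\ tau_lip d < +oo].

Definition tau_S : set tau_prod :=
  [set d : tau_prod | tau_L (re_part d) /\ tau_L (im_part d)].

Definition tau_G : set tau_prod := closure tau_S.

End tunnel_sequence.

Arguments tau_K {R E} tau _.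
Arguments tau_L {R E} tau _.
Arguments tau_S {R E} tau _.
Arguments tau_G {R E} tau _.

Section approximable.
Variables (R : realType) (A : normedStarAlgType R).
Variable (An : nat -> cstar_sub A).

Definition inductive_limit : Prop :=
  (forall n, csub_set (An n) `<=` csub_set (An n.+1)) /\
  closure (\bigcup_n csub_set (An n)) = setT.

Variables (C D : R) (L : forall n, An n -> \bar R) (beta : nat -> R).
Arguments L n _ : clear implicits.

Definition dense_star_subalgebra (B : normedStarAlgType R) (X : set B) : Prop :=
  [/\ forall (l : R[i]) a b, X a -> X b -> X (l *: a + b)%R,
      forall a b, X a -> X b -> X (a * b)%R,
      forall a, X a -> X (star a) &
      closure X = setT].

Record propinquity_approximable : Prop := {
  pa_beta_gt0 : forall n, (0 < beta n)%R;
  pa_beta_sum : cvgn (series beta);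
  pa_lip : forall n, quasi_leibniz_cqms C D (L n);
  pa_seminorm : forall n, real_seminorm setT (L n);
  pa_dom : forall n, dense_star_subalgebra [set a : An n | L n a < +oo];
  pa_decr : forall n (a : An n) (b : An n.+1),
    csub_val a = csub_val b -> L n.+1 b <= L n a;
  pa_bridge : forall n,
    hausdorff (fun a b : A => (cnorm (a - b))%:E)
      [set csub_val a | a in lip_ball (L n)]
      [set csub_val b | b in lip_ball (L n.+1)] <= (beta n)%:E
}.

Definition evident_lip n (d : An n * An n.+1) : \bar R :=
  maxe (maxe (L n d.1) (L n.+1 d.2))
       (cnorm (csub_val d.1 - csub_val d.2) / (2 * beta n))%:E.

Definition evident_tunnel n : tunnel (An n) (An n.+1) :=
  @Tunnel R (An n) (An n.+1) (An n * An n.+1)%type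
    (@evident_lip n) (@fst (An n) (An n.+1)) (@snd (An n) (An n.+1)).

End approximable.

Arguments propinquity_approximable {R A} An C D L beta.

Local Close Scope ereal_scope.

Section jordan_lie.
Variables (R : realType) (A : normedStarAlgType R).
Implicit Types a b : A.

Let conjV2 : ((2 : R[i])^-1)^*%C = 2^-1.
Proof. by rewrite rmorphV ?unitfE ?pnatr_eq0 // rmorph_nat. Qed.

Let conjV2i : ((2 * 'i%C : R[i])^-1)^*%C = - (2 * 'i%C)^-1.
Proof.
have i0 : ('i%C : R[i]) != 0 by rewrite eq_complex /= oner_eq0 andbF.
rewrite rmorphV ?unitfE ?mulf_neq0 ?pnatr_eq0 // rmorphM rmorph_nat /=.
rewrite -invrN; congr (_^-1); rewrite -mulrN; congr (_ * _).
by apply/eqP; rewrite eq_complex /= oppr0 !eqxx.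
Qed.

Lemma normcV2 : normc ((2 : R[i])^-1) = 2^-1.
Proof.
rewrite normcV; congr (_^-1).
have -> : (2 : R[i]) = 2%:C by rewrite rmorph_nat.
by rewrite /= expr0n addr0 sqrtr_sqr ger0_norm.
Qed.

Lemma normcV2i : normc ((2 * 'i%C : R[i])^-1) = 2^-1.
Proof.
rewrite normcV normcM; congr (_^-1).
rewrite -[RHS]invrK -normcV2 normcV invrK -[RHS]mulr1; congr (_ * _).
by rewrite /= expr0n add0r expr1n sqrtr1.
Qed.

Let half_double a : (2 : R[i])^-1 *: (a + a) = a.
Proof.
have -> : a + a = (2 : R[i]) *: a by rewrite scaler_nat mulr2n.
by rewrite scalerA mulVf ?pnatr_eq0 // scale1r.
Qed.

Lemma jordan_lieE a b : a * b = jordan a b + 'i%C *: lie a b.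
Proof.
have i0 : ('i%C : R[i]) != 0 by rewrite eq_complex /= oner_eq0 andbF.
rewrite /jordan /lie scalerA invfM mulrCA mulfV // mulr1 -scalerDr addrACA.
by rewrite subrr addr0 half_double.
Qed.

Lemma self_adjoint_jordan a b :
  self_adjoint a -> self_adjoint b -> self_adjoint (jordan a b).
Proof.
rewrite /self_adjoint /jordan /= starZ starD !starM => -> ->.
by rewrite addrC conjV2.
Qed.

Lemma self_adjoint_lie a b :
  self_adjoint a -> self_adjoint b -> self_adjoint (lie a b).
Proof.
rewrite /self_adjoint /lie /= starZ starB !starM => -> ->.
by rewrite conjV2i scaleNr -scalerN opprB.
Qed.

Lemma self_adjoint_re a : self_adjoint (re_part a).
Proof. by rewrite /self_adjoint /re_part /= starZ starD starK addrC conjV2. Qed.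

Lemma self_adjoint_im a : self_adjoint (im_part a).
Proof.
rewrite /self_adjoint /im_part /= starZ starB starK conjV2i.
by rewrite scaleNr -scalerN opprB.
Qed.

Lemma re_imE a : a = re_part a + 'i%C *: im_part a.
Proof.
have i0 : ('i%C : R[i]) != 0 by rewrite eq_complex /= oner_eq0 andbF.
rewrite /re_part /im_part scalerA invfM mulrCA mulfV // mulr1 -scalerDr addrACA.
by rewrite subrr addr0 half_double.
Qed.

Lemma star_iZ a : self_adjoint a -> star ('i%C *: a) = - ('i%C *: a).
Proof.
rewrite /self_adjoint /= starZ => ->; rewrite -scaleNr; congr (_ *: _).
by apply/eqP; rewrite eq_complex /= oppr0 !eqxx.
Qed.

Lemma re_part_pair a b : self_adjoint a -> self_adjoint b ->
  re_part (a + 'i%C *: b) = a.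
Proof.
move=> sa sb; rewrite /re_part starD star_iZ // sa addrACA subrr addr0.
by rewrite half_double.
Qed.

Lemma im_part_pair a b : self_adjoint a -> self_adjoint b ->
  im_part (a + 'i%C *: b) = b.
Proof.
have i0 : ('i%C : R[i]) != 0 by rewrite eq_complex /= oner_eq0 andbF.
move=> sa sb; rewrite /im_part starD star_iZ // sa opprD opprK addrACA subrr.
by rewrite add0r invfM mulrC -scalerA half_double scalerA mulVf // scale1r.
Qed.

Let half_norm (k : R[i]) (x y : A) (r : R) : normc k = 2^-1 ->
  cnorm x <= r -> cnorm y <= r -> cnorm (k *: (x + y)) <= r.
Proof.
move=> k2 xr yr; rewrite cnormZ k2 ler_pdivrMl //.
by rewrite (le_trans (cnormD _ _)) // mulr_natl mulr2n lerD.
Qed.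

Let mulB1 a b a' b' : cnorm (a * b - a' * b') <=
  cnorm a * cnorm (b - b') + cnorm (a - a') * cnorm b'.
Proof.
have -> : a * b - a' * b' = a * (b - b') + (a - a') * b'.
  by rewrite mulrBr mulrBl addrA subrK.
by rewrite (le_trans (cnormD _ _)) // lerD // cnormM.
Qed.

Let mulB2 a b a' b' : cnorm (b * a - b' * a') <=
  cnorm a * cnorm (b - b') + cnorm (a - a') * cnorm b'.
Proof.
have -> : b * a - b' * a' = (b - b') * a + b' * (a - a').
  by rewrite mulrBr mulrBl addrA subrK.
rewrite (le_trans (cnormD _ _)) // lerD //; last first.
  by rewrite [leRHS]mulrC cnormM.
by rewrite [leRHS]mulrC cnormM.
Qed.

Lemma cnorm_jordanB a b a' b' : cnorm (jordan a b - jordan a' b') <=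
  cnorm a * cnorm (b - b') + cnorm (a - a') * cnorm b'.
Proof.
rewrite /jordan -scalerBr opprD addrACA; apply: half_norm => //; exact: normcV2.
Qed.

Lemma cnorm_lieB a b a' b' : cnorm (lie a b - lie a' b') <=
  cnorm a * cnorm (b - b') + cnorm (a - a') * cnorm b'.
Proof.
rewrite /lie -scalerBr opprD addrACA -opprD; apply: half_norm.
- exact: normcV2i.
- exact: mulB1.
- by rewrite cnormN; exact: mulB2.
Qed.

End jordan_lie.

Section closure_subalgebra.
Variables (R : realType) (A : normedStarAlgType R) (X : set A).

Lemma closure_cstar_subalgebra :
  X 1 -> (forall (l : R[i]) a b, X a -> X b -> X (l *: a + b)) ->
  (forall a b, X a -> X b -> X (a * b)) -> (forall a, X a -> X (star a)) ->
  cstar_subalgebra (closure X).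
Proof.
move=> X1 XL XM XS; split.
- exact: subset_closure.
- move=> l a b /closure_cnormP Xa /closure_cnormP Xb.
  apply/closure_cnormP => e e0.
  have nl : 0 <= normc l by case: (l) => p q; exact: sqrtr_ge0.
  have l1 : 0 < normc l + 1 by rewrite ltr_wpDl.
  have e20 : 0 < e / 2 by rewrite divr_gt0.
  have [x Xx ax] := Xa _ (divr_gt0 e20 l1); have [y Xy by_] := Xb _ e20.
  exists (l *: x + y); first exact: XL.
  rewrite opprD addrACA -scalerBr (le_lt_trans (cnormD _ _)) // [e]splitr.
  rewrite ler_ltD // cnormZ (le_trans (ler_wpM2l nl (ltW ax))) //.
  by rewrite mulrCA ger_pMr // ler_pdivrMr // mul1r lerDl.
- move=> a b /closure_cnormP Xa /closure_cnormP Xb.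
  apply/closure_cnormP => e e0.
  have a1 : 0 < cnorm a + 1 by rewrite ltr_wpDl ?cnorm_ge0.
  have e20 : 0 < e / 2 by rewrite divr_gt0.
  have d0 : 0 < Num.min 1 (e / 2 / (cnorm a + 1)).
    by rewrite lt_min ltr01 divr_gt0.
  have [y Xy] := Xb _ d0; rewrite lt_min => /andP[by1 bye].
  have y1 : 0 < cnorm y + 1 by rewrite ltr_wpDl ?cnorm_ge0.
  have [x Xx ax] := Xa _ (divr_gt0 e20 y1).
  exists (x * y); first exact: XM.
  have -> : a * b - x * y = a * (b - y) + (a - x) * y.
    by rewrite mulrBr mulrBl addrA subrK.
  rewrite (le_lt_trans (cnormD _ _)) // [e]splitr ler_ltD //.
    rewrite (le_trans (cnormM _ _)) //.
    rewrite (le_trans (ler_wpM2l (cnorm_ge0 _) (ltW bye))) //.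
    by rewrite mulrCA ger_pMr // ler_pdivrMr // mul1r lerDl.
  rewrite (le_lt_trans (cnormM _ _)) //.
  have [y0|y0] := eqVneq (cnorm y) 0; first by rewrite y0 mulr0.
  have y00 : 0 < cnorm y by rewrite lt0r y0 cnorm_ge0.
  rewrite -ltr_pdivlMr // (lt_le_trans ax) //.
  by rewrite ler_pM2l // lef_pV2 ?posrE // lerDl.
- move=> a /closure_cnormP Xa; apply/closure_cnormP => e e0.
  have [x Xx ax] := Xa _ e0; exists (star x); first exact: XS.
  by rewrite -starB cnorm_star.
- exact: closed_closure.
Qed.

End closure_subalgebra.

Section evident_algebra.
Variables (R : realType) (A : normedStarAlgType R) (An : nat -> cstar_sub A).
Variables (C D : R) (L : forall n, An n -> \bar R) (beta : nat -> R).
Hypothesis h : propinquity_approximable An C D L beta.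

Let tau := evident_tunnel L beta.
Let P := tau_prod tau.
Implicit Types (x y : P) (M N : R).

Let c1 x n : An n := tunnel_fst (tau n) (bp_val x n).
Let c2 x n : An n.+1 := tunnel_snd (tau n) (bp_val x n).

Let c_le x n : cnorm (c1 x n) <= cnorm x /\ cnorm (c2 x n) <= cnorm x.
Proof.
have : pair_cnorm (bp_val x n : An n * An n.+1) <= cnorm x := bp_cnorm_ub x n.
by rewrite /pair_cnorm ge_max => /andP[].
Qed.

Let c1_le x n : cnorm (c1 x n) <= cnorm x. Proof. by case: (c_le x n). Qed.
Let c2_le x n : cnorm (c2 x n) <= cnorm x. Proof. by case: (c_le x n). Qed.

Definition evident_bound M x : Prop := forall n,
  [/\ (L (c1 x n) <= M%:E)%E, (L (c2 x n) <= M%:E)%E &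
      cnorm (csub_val (c1 x n) - csub_val (c2 x n)) <= M * (2 * beta n)].

Let beta2_gt0 n : 0 < 2 * beta n.
Proof. by rewrite mulr_gt0 // (pa_beta_gt0 h). Qed.

Let L_ge0 n (a : An n) : (0 <= L a)%E.
Proof. by have [+ _ _] := pa_seminorm h n; exact. Qed.

Let L0 n : L (0 : An n) = 0%E.
Proof.
have [_ _ LZ] := pa_seminorm h n.
by have := LZ 0 0 I; rewrite scaler0 normr0 mul0e.
Qed.

Let L1 n : L (1 : An n) = 0%E.
Proof.
have [/cqm_kernel kerL _] := pa_lip h n.
suff : [set a : An n | self_adjoint a /\ L a = 0%E] 1 by case.
by rewrite kerL; exists 1 => //; rewrite rmorph1 scale1r.
Qed.

Let evident_boundP x : (tau_lip x < +oo)%E <-> exists M, evident_bound M x.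
Proof.
split=> [xoo|[M xM]]; last first.
  apply: (@le_lt_trans _ _ M%:E); last exact: ltry.
  apply: ge_ereal_sup => _ [n _ <-]; have [xM1 xM2 xM3] := xM n.
  by rewrite /= /evident_lip !ge_max xM1 xM2 /= lee_fin ler_pdivrMr.
have ub n : (evident_lip L beta (bp_val x n) <= tau_lip x)%E.
  by apply: ereal_sup_ubound; exists n.
have x0 : (0 <= tau_lip x)%E.
  apply: le_trans (ub 0%N); rewrite /evident_lip le_max; apply/orP; right.
  by rewrite lee_fin divr_ge0 ?cnorm_ge0 ?ltW.
have xfin : tau_lip x \is a fin_num by rewrite ge0_fin_numE.
exists (fine (tau_lip x)) => n; have := ub n.
rewrite -(fineK xfin) /evident_lip !ge_max => /andP[/andP[-> ->]].
by rewrite lee_fin ler_pdivrMr //; split.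
Qed.

Let bound_ge0 M x : evident_bound M x -> 0 <= M.
Proof.
move=> xM; have [xM1 _ _] := xM 0%N.
by have := le_trans (L_ge0 _) xM1; rewrite lee_fin.
Qed.

Definition evident_compat x : Prop := forall n, c1 x n.+1 = c2 x n.

Lemma evident_LP x : tau_L tau x <-> [/\ self_adjoint x, evident_compat x & exists M, evident_bound M x].
Proof.
split; first by move=> [[sx cx] /evident_boundP].
by move=> [sx cx /evident_boundP].
Qed.

Let L_1 : tau_L tau (1 : P).
Proof.
apply/evident_LP; split; first exact: star1.
  by move=> n; apply: csub_val_inj.
exists 0 => n; split; rewrite ?L1 //.
by rewrite [X in cnorm X](_ : _ = 0) ?cnorm0 ?mul0r // -[RHS](subrr 1).
Qed.

Let L_D x y : tau_L tau x -> tau_L tau y -> tau_L tau (x + y).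
Proof.
move=> /evident_LP[sx cx [M xM]] /evident_LP[sy cy [N yN]]; apply/evident_LP; split.
- by rewrite /self_adjoint /= starD sx sy.
- by move=> n; rewrite -[LHS]/(c1 x n.+1 + c1 y n.+1) cx cy.
- exists (M + N) => n; have [_ LD _] := pa_seminorm h n.
  have [_ LD' _] := pa_seminorm h n.+1.
  have [x1 x2 x3] := xM n; have [y1 y2 y3] := yN n; split.
  + by rewrite EFinD (le_trans (LD (c1 x n) (c1 y n) I I)) // leeD.
  + by rewrite EFinD (le_trans (LD' (c2 x n) (c2 y n) I I)) // leeD.
  + rewrite [X in cnorm X](_ : _ =
      (csub_val (c1 x n) - csub_val (c2 x n)) +
      (csub_val (c1 y n) - csub_val (c2 y n))); last first.
      by rewrite -[csub_val (c1 (x + y) n)]/(csub_val (c1 x n) + csub_val (c1 y n))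
        -[csub_val (c2 (x + y) n)]/(csub_val (c2 x n) + csub_val (c2 y n)) opprD addrACA.
    by rewrite mulrDl (le_trans (cnormD _ _)) // lerD.
Qed.

Let L_Z (r : R) x : tau_L tau x -> tau_L tau (r%:C *: x).
Proof.
move=> /evident_LP[sx cx [M xM]]; apply/evident_LP; split.
- rewrite /self_adjoint /= starZ sx; congr (_ *: _).
  by rewrite /= oppr0.
- by move=> n; rewrite -[LHS]/(r%:C *: c1 x n.+1) cx.
- exists (`|r| * M) => n; have [_ _ LZ] := pa_seminorm h n.
  have [_ _ LZ'] := pa_seminorm h n.+1.
  have [x1 x2 x3] := xM n; split.
  + by rewrite EFinM -[c1 _ n]/(r%:C *: c1 x n) LZ // lee_wpmul2l.
  + by rewrite EFinM -[c2 _ n]/(r%:C *: c2 x n) LZ' // lee_wpmul2l.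
  + rewrite -[csub_val (c1 _ n)]/(r%:C *: csub_val (c1 x n))
      -[csub_val (c2 _ n)]/(r%:C *: csub_val (c2 x n)) -scalerBr cnormZ.
    have -> : normc r%:C = `|r| by rewrite /= expr0n addr0 sqrtr_sqr.
    by rewrite -mulrA ler_wpM2l.
Qed.

Let QL n (a b : An n) (K K' M N : R) : self_adjoint a -> self_adjoint b ->
  cnorm a <= K -> cnorm b <= K' -> (L a <= M%:E)%E -> (L b <= N%:E)%E ->
  (maxe (L (jordan a b)) (L (lie a b)) <=
   (`|C| * (K * N + K' * M) + `|D| * (M * N))%:E)%E.
Proof.
move=> sa sb aK bK aM bN; have [_ ql] := pa_lip h n.
have da : lip_dom (L (n := n)) a by split=> //; exact: le_lt_trans aM (ltry _).
have db : lip_dom (L (n := n)) b by split=> //; exact: le_lt_trans bN (ltry _).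
apply: (le_trans (ql a b da db)).
have [a0 b0] := (L_ge0 a, L_ge0 b).
have fa : L a \is a fin_num by rewrite ge0_fin_numE //; case: da.
have fb : L b \is a fin_num by rewrite ge0_fin_numE //; case: db.
move: a0 b0 aM bN; rewrite -(fineK fa) -(fineK fb) !lee_fin.
set la := fine _; set lb := fine _ => a0 b0 aM bN.
have [na nb] := (cnorm_ge0 a, cnorm_ge0 b).
rewrite lerD //.
  rewrite (le_trans (ler_norm _)) // normrM ler_wpM2l // ger0_norm.
    by rewrite lerD // ler_pM.
  by rewrite addr_ge0 // mulr_ge0.
rewrite (le_trans (ler_norm _)) // normrM ler_wpM2l // ger0_norm.
  by rewrite ler_pM.
by rewrite mulr_ge0.
Qed.

Let sa_c1 x n : self_adjoint x -> self_adjoint (c1 x n).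
Proof. by move=> sx; rewrite /self_adjoint /= -[in RHS]sx. Qed.

Let sa_c2 x n : self_adjoint x -> self_adjoint (c2 x n).
Proof. by move=> sx; rewrite /self_adjoint /= -[in RHS]sx. Qed.

Let mul_bound (K K' M N c : R) (a b a' b' : A) :
  0 <= M -> 0 <= N -> 0 <= c -> cnorm a <= K -> cnorm b' <= K' ->
  cnorm (b - b') <= N * c -> cnorm (a - a') <= M * c ->
  cnorm a * cnorm (b - b') + cnorm (a - a') * cnorm b' <=
  (`|C| * (K * N + K' * M) + `|D| * (M * N) + (K * N + K' * M)) * c.
Proof.
move=> M0 N0 c0 aK bK bN aM.
have K0 : 0 <= K := le_trans (cnorm_ge0 _) aK.
have K'0 : 0 <= K' := le_trans (cnorm_ge0 _) bK.
apply: (@le_trans _ _ ((K * N + K' * M) * c)); last first.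
  rewrite ler_wpM2r // lerDr addr_ge0 // mulr_ge0 //.
    by rewrite addr_ge0 // mulr_ge0.
  by rewrite mulr_ge0.
rewrite mulrDl lerD //.
  by rewrite -mulrA ler_pM ?cnorm_ge0.
by rewrite mulrC -mulrA ler_pM ?cnorm_ge0.
Qed.

Let L_JL x y : tau_L tau x -> tau_L tau y -> tau_L tau (jordan x y) /\ tau_L tau (lie x y).
Proof.
move=> /evident_LP[sx cx [M xM]] /evident_LP[sy cy [N yN]].
have [M0 N0] := (bound_ge0 xM, bound_ge0 yN).
pose B := `|C| * (cnorm x * N + cnorm y * M) + `|D| * (M * N) +
  (cnorm x * N + cnorm y * M).
have BE : `|C| * (cnorm x * N + cnorm y * M) + `|D| * (M * N) <= B.
  by rewrite lerDl addr_ge0 // mulr_ge0 ?cnorm_ge0.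
have q1 n : (maxe (L (jordan (c1 x n) (c1 y n))) (L (lie (c1 x n) (c1 y n))) <=
    B%:E)%E.
  have [x1 x2 x3] := xM n; have [y1 y2 y3] := yN n.
  apply: le_trans (QL (sa_c1 n sx) (sa_c1 n sy) (c1_le x n) (c1_le y n) x1 y1) _.
  by rewrite lee_fin.
have q2 n : (maxe (L (jordan (c2 x n) (c2 y n))) (L (lie (c2 x n) (c2 y n))) <=
    B%:E)%E.
  have [x1 x2 x3] := xM n; have [y1 y2 y3] := yN n.
  apply: le_trans (QL (sa_c2 n sx) (sa_c2 n sy) (c2_le x n) (c2_le y n) x2 y2) _.
  by rewrite lee_fin.
have q3 n : cnorm (csub_val (c1 x n)) *
    cnorm (csub_val (c1 y n) - csub_val (c2 y n)) +
    cnorm (csub_val (c1 x n) - csub_val (c2 x n)) * cnorm (csub_val (c2 y n)) <=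
    B * (2 * beta n).
  have [x1 x2 x3] := xM n; have [y1 y2 y3] := yN n.
  by apply: mul_bound => //; [exact: ltW | exact: c1_le | exact: c2_le].
split; apply/evident_LP; split.
- exact: self_adjoint_jordan.
- by move=> n; rewrite -[LHS]/(jordan (c1 x n.+1) (c1 y n.+1)) cx cy.
- exists B => n; have := q1 n; have := q2 n; rewrite !ge_max.
  move=> /andP[j2 _] /andP[j1 _]; split=> //.
  exact: le_trans (cnorm_jordanB _ _ _ _) (q3 n).
- exact: self_adjoint_lie.
- by move=> n; rewrite -[LHS]/(lie (c1 x n.+1) (c1 y n.+1)) cx cy.
- exists B => n; have := q1 n; have := q2 n; rewrite !ge_max.
  move=> /andP[_ j2] /andP[_ j1]; split=> //.
  exact: le_trans (cnorm_lieB _ _ _ _) (q3 n).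
Qed.

Let S_pair x : tau_S tau x <->
  exists u v, [/\ tau_L tau u, tau_L tau v & x = u + 'i%C *: v].
Proof.
split=> [[Lre Lim]|[u [v [Lu Lv ->]]]].
  by exists (re_part x), (im_part x); split=> //; exact: re_imE.
have [su _ _] := (evident_LP u).1 Lu; have [sv _ _] := (evident_LP v).1 Lv.
by rewrite /tau_S /= re_part_pair // im_part_pair.
Qed.

Let L_S u : tau_L tau u -> tau_S tau u.
Proof.
move=> Lu; apply/S_pair; exists u, (0%:C *: u); split=> //; first exact: L_Z.
by rewrite scale0r scaler0 addr0.
Qed.

Let S_D x y : tau_S tau x -> tau_S tau y -> tau_S tau (x + y).
Proof.
move=> /S_pair[u [v [Lu Lv ->]]] /S_pair[u' [v' [Lu' Lv' ->]]]; apply/S_pair.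
exists (u + u'), (v + v'); split; [exact: L_D | exact: L_D |].
by rewrite addrACA scalerDr.
Qed.

Let S_Z (l : R[i]) x : tau_S tau x -> tau_S tau (l *: x).
Proof.
move=> /S_pair[u [v [Lu Lv ->]]]; case: l => p q; apply/S_pair.
exists (p%:C *: u + (- q)%:C *: v), (q%:C *: u + p%:C *: v); split.
- by apply: L_D; exact: L_Z.
- by apply: L_D; exact: L_Z.
- rewrite !scalerDr !scalerA addrACA -!scalerDl; congr (_ *: _ + _ *: _).
    by apply/eqP; rewrite eq_complex /= !(mul0r, mulr0, mul1r, subr0, addr0, add0r) !eqxx.
  apply/eqP; rewrite eq_complex /=.
  by rewrite !(mul0r, mulr0, mul1r, mulr1, subr0, sub0r, addr0, add0r) !eqxx.
Qed.

Let L_SM u v : tau_L tau u -> tau_L tau v -> tau_S tau (u * v).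
Proof.
move=> Lu Lv; have [LJ LL] := L_JL Lu Lv.
by rewrite jordan_lieE; apply: S_D; [|apply: S_Z]; exact: L_S.
Qed.

Let S_M x y : tau_S tau x -> tau_S tau y -> tau_S tau (x * y).
Proof.
move=> /S_pair[u [v [Lu Lv ->]]] /S_pair[u' [v' [Lu' Lv' ->]]].
rewrite mulrDl !mulrDr -!scalerAl -!scalerAr.
apply: S_D; first apply: S_D.
- exact: L_SM.
- exact/S_Z/L_SM.
apply: S_D; first exact/S_Z/L_SM.
exact/S_Z/S_Z/L_SM.
Qed.

Let S_star x : tau_S tau x -> tau_S tau (star x).
Proof.
move=> /S_pair[u [v [Lu Lv ->]]].
have [su _ _] := (evident_LP u).1 Lu; have [sv _ _] := (evident_LP v).1 Lv.
rewrite starD star_iZ // su -scaleN1r.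
by apply: S_D; [|do 2 apply: S_Z]; exact: L_S.
Qed.

Lemma evident_G_subalgebra : cstar_subalgebra (tau_G tau).
Proof.
apply: closure_cstar_subalgebra.
- exact/L_S/L_1.
- by move=> l x y Sx Sy; apply: S_D => //; exact: S_Z.
- exact: S_M.
- exact: S_star.
Qed.

End evident_algebra.

Section tau_space.
Variables (R : realType) (A : normedStarAlgType R) (An : nat -> cstar_sub A).
Variables (C D : R) (L : forall n, An n -> \bar R) (beta : nat -> R).
Hypothesis h : propinquity_approximable An C D L beta.

(* The C*-algebra G_0 of the evident tunnels, its ideal I_0 (tau_null), and
   the quotient F^tau = G_0 / I_0. *)
Definition tau_alg : cstar_sub (tau_prod (evident_tunnel L beta)) :=
  CStarSub (evident_G_subalgebra h).

Definition tau_null : set tau_alg :=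
  [set d : tau_alg | cnorm (bp_val (csub_val d) n) @[n --> \oo] --> (0 : R)].

Let tau_nullP (d : tau_alg) : tau_null d <-> forall e : R, 0 < e ->
  exists N, forall n, (N <= n)%N -> cnorm (bp_val (csub_val d) n) < e.
Proof.
rewrite /tau_null /=; split.
  move=> /cvgrPdist_lt d0 e e0; have [N _ dN] := d0 e e0.
  by exists N => n /dN; rewrite sub0r normrN ger0_norm // cnorm_ge0.
move=> d0; apply/cvgrPdist_lt => e e0; have [N dN] := d0 e e0.
by exists N => // n /= /dN; rewrite sub0r normrN ger0_norm // cnorm_ge0.
Qed.

Lemma tau_null_ideal : closed_star_ideal tau_null.
Proof.
split; last first.
  move=> /tau_nullP/(_ 1 ltr01)[N /(_ N (leqnn N))].
  by rewrite [X in X < _]cnorm1 ltxx.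
split.
- by apply/tau_nullP => e e0; exists 0%N => n _; rewrite [X in X < _]cnorm0.
- move=> a b /tau_nullP a0 /tau_nullP b0; apply/tau_nullP => e e0.
  have e20 : 0 < e / 2 by rewrite divr_gt0.
  have [N aN] := a0 _ e20; have [M bM] := b0 _ e20.
  exists (maxn N M) => n; rewrite geq_max => /andP[Nn Mn].
  apply: (le_lt_trans (cnormB (bp_val (csub_val a) n) (bp_val (csub_val b) n))).
  by rewrite [e]splitr ltrD // ?aN ?bM.
- move=> a b /tau_nullP b0.
  have a1 : 0 < cnorm (csub_val a) + 1 by rewrite ltr_wpDl // cnorm_ge0.
  have aub n : cnorm (bp_val (csub_val a) n) <= cnorm (csub_val a) + 1.
    by rewrite (le_trans (bp_cnorm_ub _ n)) // lerDl.
  split; apply/tau_nullP => e e0; have [N bN] := b0 _ (divr_gt0 e0 a1);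
    exists N => n /bN; rewrite ltr_pdivlMr // => bn.
    apply: le_lt_trans (cnormM (bp_val (csub_val a) n) (bp_val (csub_val b) n)) _.
    by apply: le_lt_trans bn; rewrite mulrC ler_wpM2l ?cnorm_ge0.
  apply: le_lt_trans (cnormM (bp_val (csub_val b) n) (bp_val (csub_val a) n)) _.
  by apply: le_lt_trans bn; rewrite ler_wpM2l ?cnorm_ge0.
- move=> a /tau_nullP a0; apply/tau_nullP => e /a0[N aN]; exists N => n /aN.
  by rewrite [X in _ -> X < _]cnorm_star.
- move=> a /closure_cnormP a0; apply/tau_nullP => e e0.
  have e20 : 0 < e / 2 by rewrite divr_gt0.
  have [b /tau_nullP/(_ _ e20)[N bN] ab] := a0 _ e20.
  exists N => n /bN bn.
  have -> : bp_val (csub_val a) n =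
      bp_val (csub_val a) n - bp_val (csub_val b) n + bp_val (csub_val b) n.
    by rewrite subrK.
  rewrite (le_lt_trans (cnormD _ _)) // [e]splitr ltrD //.
  by apply: le_lt_trans ab; exact: (bp_cnorm_ub (csub_val a - csub_val b) n).
Qed.

Definition tau_ideal : star_ideal tau_alg := StarIdeal tau_null_ideal.

Definition tau_space : normedStarAlgType R := quotient tau_ideal.

Definition tau_quot (d : tau_alg) : tau_space := quot_map tau_ideal d.

Definition tau_lip_norm : tau_space -> \bar R :=
  quotient_lip (fun d : tau_alg => tau_lip (csub_val d)) tau_quot.

End tau_space.

Arguments tau_quot {R A An C D L beta} h d.
Arguments tau_lip_norm {R A An C D L beta} h _.

Section psi.
Variables (R : realType) (A : normedStarAlgType R) (An : nat -> cstar_sub A).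
Variables (C D : R) (L : forall n, An n -> \bar R) (beta : nat -> R).
Hypotheses (hlim : inductive_limit An).
Hypotheses (h : propinquity_approximable An C D L beta).

(* [psi_coord n k a] is a, viewed in An k, if n <= k, and 0 otherwise. *)
Definition psi_coord n k (a : An n) : An k :=
  insubd (0 : An k) (if (n <= k)%N then csub_val a else 0).

Let An_le n k : (n <= k)%N -> csub_set (An n) `<=` csub_set (An k).
Proof.
move=> /subnK <-; elim: (k - n)%N => [//|m IH] a /IH.
by have [mono _] := hlim; exact: mono.
Qed.

Lemma psi_coordE n k (a : An n) :
  csub_val (psi_coord k a) = if (n <= k)%N then csub_val a else 0.
Proof.
apply: insubdK; apply/asboolP; case: ifPn => [nk|_].
  exact/(An_le nk)/csub_valP.
exact: (csub_valP (0 : An k)).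
Qed.

(* At n <= k this is (a, a), at n = k + 1 it is (0, a), and (0, 0) otherwise. *)
Let psi_bounded n (a : An n) : exists M : R, forall k,
  cnorm ((psi_coord k a, psi_coord k.+1 a) :
    tunnel_alg (evident_tunnel L beta k)) <= M.
Proof.
exists (cnorm a) => k.
have le j : cnorm (psi_coord j a) <= cnorm a.
  rewrite [leLHS](_ : _ = cnorm (csub_val (psi_coord j a))) // psi_coordE.
  by case: ifP => // _; rewrite cnorm0 cnorm_ge0.
rewrite [leLHS](_ : _ = pair_cnorm (psi_coord k a, psi_coord k.+1 a)) //.
by rewrite /pair_cnorm ge_max !le.
Qed.

Definition psi_seq n (a : An n) : tau_prod (evident_tunnel L beta) :=
  BoundedProduct (psi_bounded a).

Let coordB n k (a b : An n) :
  psi_coord k (a - b) = psi_coord k a - psi_coord k b.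
Proof.
apply: csub_val_inj.
rewrite -[RHS]/(csub_val (psi_coord k a) - csub_val (psi_coord k b)) !psi_coordE.
by case: ifP => // _; rewrite subr0.
Qed.

Let coord_star n k (a : An n) : psi_coord k (star a) = star (psi_coord k a).
Proof.
apply: csub_val_inj.
rewrite -[RHS]/(star (csub_val (psi_coord k a))) !psi_coordE.
by case: ifP => // _; rewrite star0.
Qed.

Let coord_re n k (a : An n) : psi_coord k (re_part a) = re_part (psi_coord k a).
Proof.
apply: csub_val_inj; rewrite psi_coordE.
rewrite -[RHS]/(re_part (csub_val (psi_coord k a))) psi_coordE.
by case: ifP => // _; rewrite /re_part star0 addr0 scaler0.
Qed.

Let coord_im n k (a : An n) : psi_coord k (im_part a) = im_part (psi_coord k a).
Proof.
apply: csub_val_inj; rewrite psi_coordE.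
rewrite -[RHS]/(im_part (csub_val (psi_coord k a))) psi_coordE.
by case: ifP => // _; rewrite /im_part star0 subrr scaler0.
Qed.

Let coord_le n k (a : An n) : cnorm (psi_coord k a) <= cnorm a.
Proof.
rewrite [leLHS](_ : _ = cnorm (csub_val (psi_coord k a))) // psi_coordE.
by case: ifP => // _; rewrite cnorm0 cnorm_ge0.
Qed.

Let L0 n : L (0 : An n) = 0%E.
Proof.
have [_ _ LZ] := pa_seminorm h n.
by have := LZ 0 0 I; rewrite scaler0 normr0 mul0e.
Qed.

Let L_ge0 n (a : An n) : (0 <= L a)%E.
Proof. by have [+ _ _] := pa_seminorm h n; exact. Qed.

Let coord_L n k (a : An n) : (L (psi_coord k a) <= L a)%E.
Proof.
have [nk|kn] := leqP n k; last first.
  suff -> : psi_coord k a = 0 by rewrite L0.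
  by apply: csub_val_inj; rewrite psi_coordE leqNgt kn.
move: nk => /subnK <-; elim: (k - n)%N => [|m IH].
  suff -> : psi_coord (0 + n) a = a by [].
  by apply: csub_val_inj; rewrite psi_coordE leq_addl.
apply: le_trans IH; apply: (pa_decr h).
by rewrite !psi_coordE leq_addl ifT // leqW // leq_addl.
Qed.

Let psi_L n (a : An n) : self_adjoint a -> (L a < +oo)%E ->
  tau_L (evident_tunnel L beta) (psi_seq a).
Proof.
move=> sa La; have fL : L a \is a fin_num by rewrite ge0_fin_numE.
have b0 : 0 < 2 * beta n.-1 by rewrite mulr_gt0 // (pa_beta_gt0 h).
apply/(evident_LP h); split=> //.
  apply: bp_eq => k.
  by rewrite -[LHS]/(star (psi_coord k a), star (psi_coord k.+1 a)) -!coord_star sa.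
exists (fine (L a) + cnorm a / (2 * beta n.-1)) => k.
have LaM : (L a <= (fine (L a) + cnorm a / (2 * beta n.-1))%:E)%E.
  rewrite -{1}(fineK fL) lee_fin lerDl divr_ge0 ?cnorm_ge0 //; exact: ltW.
split; [exact: le_trans (coord_L _ _) LaM | exact: le_trans (coord_L _ _) LaM |].
suff : cnorm (csub_val (psi_coord k a) - csub_val (psi_coord k.+1 a)) <=
  (fine (L a) + cnorm a / (2 * beta n.-1)) * (2 * beta k) by [].
rewrite !psi_coordE.
have M0 : 0 <= (fine (L a) + cnorm a / (2 * beta n.-1)) * (2 * beta k).
  rewrite mulr_ge0 // ?addr_ge0 ?divr_ge0 ?cnorm_ge0 ?fine_ge0 //; first exact: ltW.
  by rewrite mulr_ge0 // ltW // (pa_beta_gt0 h).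
have [nk|kn] := leqP n k; first by rewrite leqW // subrr cnorm0.
have [nk|_] := leqP n k.+1; last by rewrite subrr cnorm0.
have nE : n.-1 = k by apply/eqP; rewrite -eqSS (ltn_predK kn) eqn_leq nk kn.
rewrite sub0r cnormN; move: b0; rewrite nE => b0.
by rewrite mulrDl divfK ?gt_eqF // lerDr mulr_ge0 ?fine_ge0 // ltW.
Qed.

Lemma psi_seq_G n (a : An n) : tau_G (evident_tunnel L beta) (psi_seq a).
Proof.
have [domL domM domS dom_dense] := pa_dom h n.
apply/closure_cnormP => e e0.
have : closure [set b : An n | (L b < +oo)%E] a by rewrite dom_dense.
move=> /closure_cnormP/(_ _ e0)[b Lb ab]; exists (psi_seq b); last first.
  apply: le_lt_trans ab; apply: bp_cnorm_le => k.
  rewrite [leLHS](_ : _ = pair_cnorm (psi_coord k (a - b), psi_coord k.+1 (a - b))).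
    by rewrite /pair_cnorm ge_max !coord_le.
  by rewrite !coordB.
have dom0 : (L (0 : An n)%R < +oo)%E by rewrite L0 ltry.
have domZ (l : R[i]) (c : An n) : (L c < +oo)%E -> (L (l *: c)%R < +oo)%E.
  by move=> Lc; have := domL l c (0 : An n) Lc dom0; rewrite addr0.
have domD (c d : An n) : (L c < +oo)%E -> (L d < +oo)%E -> (L (c + d)%R < +oo)%E.
  by move=> Lc Ld; have := domL 1 c d Lc Ld; rewrite scale1r.
have psi_re : re_part (psi_seq b) = psi_seq (re_part b).
  apply: bp_eq => k; rewrite -[LHS]/(re_part (psi_coord k b), re_part (psi_coord k.+1 b)).
  by rewrite -!coord_re.
have psi_im : im_part (psi_seq b) = psi_seq (im_part b).
  apply: bp_eq => k; rewrite -[LHS]/(im_part (psi_coord k b), im_part (psi_coord k.+1 b)).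
  by rewrite -!coord_im.
rewrite /tau_S /= psi_re psi_im; split; apply: psi_L.
- exact: self_adjoint_re.
- by apply: domZ; apply: domD => //; exact: domS.
- exact: self_adjoint_im.
- by apply: (domZ); apply: domD => //; rewrite -scaleN1r; apply: (domZ); exact: domS.
Qed.

Arguments psi_seq_G [n] a.

Definition psi_map n (a : An n) : tau_space h :=
  tau_quot h (csub_elt (X := tau_alg h) (psi_seq_G a)).

End psi.

Arguments psi_map {R A An C D L beta} hlim h [n] a.

(* Main.v *)
(* A self-adjoint element of the product of the evident tunnels that satisfies
   the matching condition is a sequence a_n in A_n, and S_0 <= M means that
   L_n(a_n) <= M and |a_n - a_(n+1)| <= 2 M beta_n.  As beta is summable, such a
   sequence converges in A.  The elements of G_0 are exactly the sequences
   a_n in A_n that converge in A, so that F^tau = G_0 / I_0 is A, through the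
   limit, and L_tau(a) is the infimum of the bounds M over the sequences with
   limit a.  The bridges extend a sequence known from an index N on to all
   indices with the same bound, hence only tails matter.

   The tunnel from A_n to A is the direct sum with the seminorm
   max(L_n(a), L_A(b), |a - b| / (2 s_n)), where s_n is the sum of the beta_j
   for j >= n; its extent is at most 2 s_n because a state of a C*-subalgebra
   extends.  The Monge-Kantorovich metrics of A and of the direct sum metrize
   the weak* topology because states close at finitely many points of A_n are
   close for the metric of L_n, and every element of the Lip-ball of A is
   within O(s_n) of a multiple of the Lip-ball of A_n.

   Lower semicontinuity of L_A needs no compactness: for b^k -> a with
   L_A(b^k) <= r, a sequence with limit b^k is interpolated with one with limit
   b^(k+1), using weights that increase from 0 to 1 like ln(1 / s_n).  This
   costs arbitrarily little because s_n -> 0. *)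
Require Import Defs.
From HB Require Import structures.
From mathcomp Require Import all_boot all_order all_algebra.
From mathcomp Require Import complex.
From mathcomp Require Import all_classical all_reals.
From mathcomp Require Import ereal topology normedtype sequences exp.
From mathcomp Require Import ring lra.

Set Implicit Arguments.
Unset Strict Implicit.
Unset Printing Implicit Defensive.

Import Order.TTheory GRing.Theory Num.Theory.
Import numFieldNormedType.Exports.
Import ComplexField.Normc.

Local Open Scope classical_set_scope.
Local Open Scope complex_scope.
Local Open Scope ring_scope.

(** States carry the metric side of the proof, which rests on two facts: a self-adjoint element
    attains its norm at a state, and a positive functional extends along a unital isometric
    embedding. Both are built on positivity as a norm inequality: square roots come from an
    iteration dominated by a scalar one, and extension is a Hahn-Banach argument relative to the
    positive cone.

    Infima that need not be attained shape the rest. An element with L_A(a) <= M is a limit of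
    sequences of every bound M + e with e > 0, hence the slack e in the conditions on tunnels and in
    the description of the limit seminorm. The factor 2 in 2 beta_n is room of the same kind, as a
    bridge only bounds an infimum by beta_n.

    The results on the limit are proved for an algebra B mapped isometrically onto A, and then used
    for F^tau and for A itself. Likewise every tunnel is an instance of one construction from two
    embeddings into A, so that the Cauchy property comes from direct tunnels between A_m and A_n. *)

Lemma normc_real (R : realType) (r : R) : normc r%:C = `|r|.
Proof. by rewrite /= expr0n addr0 sqrtr_sqr. Qed.

(** * Norm limits of sequences and completeness *)

Section norm_topology.
Variables (R : realType) (A : normedStarAlgType R).
Implicit Types (a b x y : A) (r : R).

Lemma cnormRZ r a : cnorm (r%:C *: a) = `|r| * cnorm a.
Proof. by rewrite cnormZ normc_real. Qed.

Lemma cnorm_scalar r : cnorm (r%:C%:A : A) = `|r|.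
Proof. by rewrite cnormRZ cnorm1 mulr1. Qed.

Lemma cdist_tri b a c : cnorm (a - c) <= cnorm (a - b) + cnorm (b - c).
Proof.
by rewrite [X in cnorm X](_ : _ = (a - b) + (b - c)) ?cnormD // addrA subrK.
Qed.

Lemma cnorm_le_dist a b : cnorm a <= cnorm b + cnorm (a - b).
Proof. by rewrite -{1}(subrK b a) addrC cnormD. Qed.

Lemma nbhs_cnormP a (U : set A) :
  nbhs a U <-> exists2 e : R, 0 < e & norm_ball (@cnorm R A) a e `<=` U.
Proof.
rewrite -nbhs_entourageE /nbhs_ entourage_cnorm; split.
  move=> [E [e /= e0 eE] EU]; exists e => // b ab.
  by apply: EU; rewrite /xsection /= inE; apply: eE.
move=> [e e0 eU]; exists [set p | norm_ball (@cnorm R A) p.1 e p.2].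
  by exists e => // -[].
by move=> b; rewrite /xsection /= inE => ab; exact: eU.
Qed.

Lemma cauchy_cnormP (F : set_system A) : ProperFilter F ->
  cauchy F <-> forall e : R, 0 < e -> exists a, F (norm_ball (@cnorm R A) a e).
Proof.
move=> FF; split=> [Fc e e0|H].
  have /Fc [[P Q] [/= FP FQ] PQ] :
      entourage [set p : A * A | norm_ball (@cnorm R A) p.1 e p.2].
    by rewrite entourage_cnorm; exists e => // -[].
  have [x Px] := filter_ex FP; exists x; apply: filterS FQ => y Qy.
  exact: (PQ (x, y)).
move=> E; rewrite entourage_cnorm => -[e /= e0 eE].
have e20 : 0 < e / 2 by rewrite divr_gt0.
have [a Fa] := H _ e20.
exists (norm_ball (@cnorm R A) a (e / 2), norm_ball (@cnorm R A) a (e / 2)) => //.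
move=> [x y] /= [ax ay]; apply: eE.
rewrite /norm_ball /= (le_lt_trans (cdist_tri a _ _)) // [e]splitr ltrD //.
by rewrite cdistC.
Qed.

Lemma fcvg_cnormP (F : set_system A) a : Filter F ->
  F --> a <-> forall e : R, 0 < e -> F (norm_ball (@cnorm R A) a e).
Proof.
move=> FF; split=> [Fa e e0|H U /nbhs_cnormP[e e0 eU]].
  by apply: Fa; apply/nbhs_cnormP; exists e.
by apply: filterS (H e e0).
Qed.

Definition clim (u : nat -> A) a : Prop :=
  forall e : R, 0 < e -> exists N, forall n, (N <= n)%N -> cnorm (u n - a) < e.

Lemma clim_unique u a b : clim u a -> clim u b -> a = b.
Proof.
move=> ua ub; apply/eqP; rewrite -subr_eq0; apply/eqP/cnorm_eq0/le_anti.
rewrite cnorm_ge0 andbT; apply/ler_addgt0Pr => e e0; rewrite add0r.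
have e20 : 0 < e / 2 by rewrite divr_gt0.
have [N uN] := ua _ e20; have [M uM] := ub _ e20.
rewrite (le_trans (cdist_tri (u (maxn N M)) _ _)) // [e]splitr lerD ?ltW //.
  by rewrite cdistC uN // leq_maxl.
by rewrite uM // leq_maxr.
Qed.

Lemma clim_cst a : clim (fun=> a) a.
Proof. by move=> e e0; exists 0%N => n _; rewrite subrr cnorm0. Qed.

Lemma clim_tail N u v a : (forall n, (N <= n)%N -> u n = v n) -> clim u a -> clim v a.
Proof.
move=> uv ua e /ua[M uM]; exists (maxn N M) => n; rewrite geq_max => /andP[Nn Mn].
by rewrite -uv // uM.
Qed.

Lemma climD u v a b : clim u a -> clim v b -> clim (fun n => u n + v n) (a + b).
Proof.
move=> ua vb e e0; have e20 : 0 < e / 2 by rewrite divr_gt0.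
have [N uN] := ua _ e20; have [M vM] := vb _ e20; exists (maxn N M) => n.
rewrite geq_max => /andP[/uN un /vM vn].
by rewrite opprD addrACA (le_lt_trans (cnormD _ _)) // [e]splitr ltrD.
Qed.

Lemma climZ (l : R[i]) u a : clim u a -> clim (fun n => l *: u n) (l *: a).
Proof.
move=> ua e e0; have nl : 0 <= normc l by case: (l) => p q; exact: sqrtr_ge0.
have l1 : 0 < normc l + 1 by rewrite ltr_wpDl.
have [N uN] := ua _ (divr_gt0 e0 l1); exists N => n /uN.
rewrite ltr_pdivlMr // -scalerBr cnormZ => un; apply: le_lt_trans un.
by rewrite mulrDr mulr1 mulrC lerDl cnorm_ge0.
Qed.

Lemma clim_bounded u a : clim u a ->
  exists N, forall n, (N <= n)%N -> cnorm (u n) <= cnorm a + 1.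
Proof.
move=> /(_ 1 ltr01)[N uN]; exists N => n /uN un.
by rewrite (le_trans (cnorm_le_dist _ a)) // lerD2l ltW.
Qed.

Lemma climM u v a b : clim u a -> clim v b -> clim (fun n => u n * v n) (a * b).
Proof.
move=> ua vb e e0; have [K uK] := clim_bounded ua.
have e20 : 0 < e / 2 by rewrite divr_gt0.
have a0 := cnorm_ge0 a; have b0 := cnorm_ge0 b.
have c1 : 0 < cnorm a + 1 by rewrite ltr_wpDl.
have c2 : 0 < cnorm b + 1 by rewrite ltr_wpDl.
have [N uN] := ua _ (divr_gt0 e20 c2); have [M vM] := vb _ (divr_gt0 e20 c1).
exists (maxn K (maxn N M)) => n; rewrite !geq_max.
move=> /andP[/uK un /andP[/uN + /vM]].
rewrite (ltr_pdivlMr _ _ c1) (ltr_pdivlMr _ _ c2) => ua' vb'.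
have -> : u n * v n - a * b = u n * (v n - b) + (u n - a) * b.
  by rewrite mulrBr mulrBl addrA subrK.
rewrite (le_lt_trans (cnormD _ _)) // [e]splitr ltrD //.
  apply: le_lt_trans vb'; rewrite (le_trans (cnormM _ _)) // mulrC.
  by rewrite ler_wpM2l ?cnorm_ge0.
apply: le_lt_trans ua'; rewrite (le_trans (cnormM _ _)) //.
by rewrite ler_wpM2l ?cnorm_ge0 // lerDl.
Qed.

Lemma clim_star u a : clim u a -> clim (fun n => star (u n)) (star a).
Proof. by move=> ua e /ua[N uN]; exists N => n /uN; rewrite -starB cnorm_star. Qed.

Lemma clim_le u a r : clim u a -> (exists N, forall n, (N <= n)%N -> cnorm (u n) <= r) ->
  cnorm a <= r.
Proof.
move=> ua [M uM]; apply/ler_addgt0Pr => e /ua[N /(_ (maxn M N) (leq_maxr _ _)) uN].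
rewrite (le_trans (cnorm_le_dist _ (u (maxn M N)))) // lerD ?uM ?leq_maxl //.
by rewrite cdistC ltW.
Qed.

Lemma clim_norm u a b r : clim u a ->
  (exists N, forall n, (N <= n)%N -> cnorm (u n - b) <= r) -> cnorm (a - b) <= r.
Proof. by move=> ua uN; exact: clim_le (climD ua (clim_cst (- b))) uN. Qed.

Definition complete_norm : Prop := forall F : set_system A, ProperFilter F ->
  cauchy F -> exists a : A, F --> a.

Lemma seq_complete (u : nat -> A) : complete_norm ->
  (forall e : R, 0 < e -> exists N, forall n, (N <= n)%N -> cnorm (u N - u n) < e) ->
  exists a, clim u a.
Proof.
move=> cA uc; have [|a /fcvg_cnormP ua] := cA (u @ \oo) _.
  apply/cauchy_cnormP => e /uc[N uN]; exists (u N).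
  by exists N => // n /= /uN.
exists a => e /ua[N _ uN]; exists N => n Nn.
by rewrite cdistC; exact: (uN n).
Qed.

Lemma dist_telescope (u : nat -> A) (t : nat -> R) m n : (m <= n)%N ->
  (forall k, (m <= k)%N -> cnorm (u k.+1 - u k) <= t k.+1 - t k) ->
  cnorm (u n - u m) <= t n - t m.
Proof.
move=> mn ut; rewrite -(subnK mn); elim: (n - m)%N => [|k IH].
  by rewrite add0n !subrr cnorm0.
rewrite (le_trans (cdist_tri (u (k + m)%N) _ _)) // addSn.
have := ut (k + m)%N (leq_addl _ _); lra.
Qed.

End norm_topology.

Lemma seq_complete_lip (R : realType) (A : normedStarAlgType R) (u : nat -> A)
  (t : nat -> R) : complete_norm A -> cvgn t ->
  (forall k, cnorm (u k.+1 - u k) <= t k.+1 - t k) ->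
  exists2 a, clim u a & forall n, cnorm (u n - a) <= limn t - t n.
Proof.
move=> cA ct ut.
have tm : nondecreasing_seq t.
  apply/nondecreasing_seqP => n; rewrite -subr_ge0 (le_trans _ (ut n)) //.
  exact: cnorm_ge0.
have tl n : t n <= limn t by exact: nondecreasing_cvgn_le.
have [|a ua] := @seq_complete _ _ u cA.
  move=> e e0; have /cvgrPdist_lt/(_ _ e0)[N _ tN] := ct.
  exists N => n Nn; rewrite cdistC (le_lt_trans (dist_telescope Nn (fun k _ => ut k))) //.
  have := tN N (leqnn N); rewrite /= ger0_norm ?subr_ge0 //.
  by apply: le_lt_trans; rewrite lerD2r.
exists a => // n; rewrite cdistC; apply: (clim_norm ua); exists n => m nm.
rewrite (le_trans (dist_telescope nm (fun k _ => ut k))) //.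
by rewrite lerD2r.
Qed.

(** * Positive elements of a C*-algebra *)

Section positive_elements.
Variables (R : realType) (A : normedStarAlgType R).
Hypothesis hA : cstar_algebra A.
Implicit Types (a b c g h k x y z : A) (r : R).

Lemma scalar_comm (l : R[i]) a : l%:A * a = a * l%:A.
Proof. by rewrite -scalerAl mul1r -scalerAr mulr1. Qed.

Lemma starRZ r a : star (r%:C *: a) = r%:C *: star a.
Proof. by rewrite starZ /= oppr0. Qed.

Lemma star_scalar r : star (r%:C%:A : A) = r%:C%:A.
Proof. by rewrite starRZ star1. Qed.

Lemma cstarE a : cnorm (star a * a) = cnorm a ^+ 2.
Proof. by have [_] := hA; exact. Qed.

Lemma cnorm_sq a : star a = a -> cnorm (a * a) = cnorm a ^+ 2.
Proof. by move=> sa; rewrite -cstarE sa. Qed.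

Lemma normc_i : normc ('i : R[i]) = 1.
Proof. by rewrite /= expr0n add0r expr1n sqrtr1. Qed.

(** The element y is 1 - sqrt (1 - x), the limit of the iteration of y -> (x + y y) / 2 from 0. The
    real sequence [t] is the same iteration at x = 1; it increases, is bounded by 1, and dominates
    both the norms of [u] and the norms of its increments, so that convergence holds even when x has
    norm 1. Each iterate is a polynomial in x, whence the commutation. *)
Lemma sqrt_one_minus x : star x = x -> cnorm x <= 1 ->
  exists y, [/\ star y = y, cnorm y <= 1, y + y = x + y * y &
    forall z, z * x = x * z -> z * y = y * z].
Proof.
move=> sx x1; pose f y := (2^-1)%:C *: (x + y * y).
pose u n := iter n f 0.
pose t : nat -> R := fun n => iter n (fun s => (1 + s ^+ 2) / 2) 0.
have uS n : u n.+1 = (2^-1)%:C *: (x + u n * u n) by [].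
have tS n : t n.+1 = (1 + t n ^+ 2) / 2 by [].
have t01 n : 0 <= t n <= 1.
  elim: n => [|n IH]; first by rewrite /t /= lexx ler01.
  by rewrite tS; nra.
have tm n : t n <= t n.+1 by rewrite tS; have := sqr_ge0 (1 - t n); nra.
have ct : cvgn t.
  apply: nondecreasing_is_cvgn; first exact/nondecreasing_seqP.
  by exists 1 => _ [n _ <-]; have /andP[] := t01 n.
have V20 : `|2^-1 : R| = 2^-1 by rewrite ger0_norm.
have ut n : cnorm (u n) <= t n.
  elim: n => [|n IH]; first by rewrite /u /= cnorm0.
  rewrite uS tS cnormRZ V20 mulrC ler_pM2r ?invr_gt0 //.
  rewrite (le_trans (cnormD _ _)) // lerD // (le_trans (cnormM _ _)) // expr2.
  by rewrite ler_pM ?cnorm_ge0.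
have dut n : cnorm (u n.+1 - u n) <= t n.+1 - t n.
  elim: n => [|n IH].
    rewrite uS /u /t /= mulr0 addr0 subr0 cnormRZ V20 expr0n /=; lra.
  have -> : u n.+2 - u n.+1 = (2^-1)%:C *:
      (u n.+1 * (u n.+1 - u n) + (u n.+1 - u n) * u n).
    rewrite [u n.+2]uS {5}uS -scalerBr opprD addrACA subrr add0r mulrBr mulrBl.
    by rewrite addrA subrK.
  rewrite cnormRZ V20 mulrC -ler_pdivlMr ?invr_gt0 // invrK.
  rewrite (le_trans (cnormD _ _)) // (@le_trans _ _ ((t n.+1 + t n) * (t n.+1 - t n))) //.
    rewrite [leRHS]mulrDl lerD // (le_trans (cnormM _ _)) //; last rewrite mulrC.
      by rewrite ler_pM ?cnorm_ge0.
    by rewrite ler_pM ?cnorm_ge0.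
  by rewrite [t n.+2]tS [t n.+1]tS; lra.
have [y uy _] := seq_complete_lip hA.1 ct dut.
have uy1 : clim (fun n => u n.+1) y.
  by move=> e /uy[N uN]; exists N => n Nn; rewrite uN // leqW.
have yE : y = (2^-1)%:C *: (x + y * y).
  by apply: clim_unique uy1 _; apply: climZ; apply: climD; [exact: clim_cst|exact: climM].
exists y; split.
- apply: clim_unique (clim_star uy) _; rewrite (_ : (fun n => star (u n)) = u) //.
  apply/funext; elim=> [|n IH]; first by rewrite /u /= star0.
  by rewrite uS starRZ starD starM sx IH.
- apply: (clim_le uy); exists 0%N => n _; rewrite (le_trans (ut n)) //.
  by have /andP[] := t01 n.
- have h2 : 2^-1 + 2^-1 = 1 :> R by lra.
  by rewrite {1 2}yE -scalerDl -rmorphD h2 scale1r.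
- move=> z zx; apply: clim_unique (climM (clim_cst z) uy) _.
  rewrite (_ : (fun n => z * u n) = (fun n => u n * z)); last first.
    apply/funext; elim=> [|n IH]; first by rewrite /u /= mul0r mulr0.
    by rewrite uS -scalerAr -scalerAl mulrDr mulrDl zx mulrA IH -!mulrA IH.
  exact: climM uy (clim_cst z).
Qed.

(* Positivity is read off the norm, so that it does not depend on the
   C*-algebra in which the element is considered. *)
Definition cpos a : Prop :=
  star a = a /\ exists2 r, 0 <= r & cnorm (r%:C%:A - a) <= r.

Lemma cpos_le a r : star a = a -> cnorm a <= r -> cpos (r%:C%:A - a).
Proof.
move=> sa ar; split; first by rewrite starB star_scalar sa.
exists r; first exact: le_trans (cnorm_ge0 a) ar.
by rewrite opprB addrC subrK.
Qed.

Lemma cpos_scalar r : 0 <= r -> cpos (r%:C%:A).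
Proof.
by move=> r0; split; [exact: star_scalar | exists r; rewrite ?subrr ?cnorm0].
Qed.

Lemma cpos0 : cpos 0.
Proof. by have := cpos_scalar (lexx 0); rewrite scale0r. Qed.

Lemma cposD a b : cpos a -> cpos b -> cpos (a + b).
Proof.
move=> [sa [r r0 ra]] [sb [s s0 rb]]; split; first by rewrite starD sa sb.
exists (r + s); first exact: addr_ge0.
rewrite rmorphD scalerDl opprD addrACA (le_trans (cnormD _ _)) //.
exact: lerD.
Qed.

Lemma cposZ r a : 0 <= r -> cpos a -> cpos (r%:C *: a).
Proof.
move=> r0 [sa [s s0 ras]]; split; first by rewrite starRZ sa.
exists (r * s); first exact: mulr_ge0.
by rewrite rmorphM -scalerA -scalerBr cnormRZ ger0_norm // ler_wpM2l.
Qed.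

Lemma cpos_scalar_ge0 r : cpos (r%:C%:A) -> 0 <= r.
Proof.
move=> [_ [s s0]]; rewrite -scalerBl -rmorphB cnorm_scalar ler_norml; lra.
Qed.

(** If |r - a| <= r and x = 1 - a / r, then [sqrt_one_minus] gives y with (1 - y)^2 = a / r. The
    given bound [r0] may be 0; adding 1 keeps the inequality and allows the division. *)
Lemma cpos_sqrt a : cpos a -> exists m, [/\ cpos m, m * m = a &
  forall z, z * a = a * z -> z * m = m * z].
Proof.
move=> [sa [r0 r00 ra0]]; pose r := r0 + 1.
have r_gt0 : 0 < r by rewrite ltr_wpDl.
have rn0 : r != 0 by rewrite gt_eqF.
have ra : cnorm (r%:C%:A - a) <= r.
  rewrite rmorphD scalerDl addrAC (le_trans (cnormD _ _)) //.
  by rewrite cnorm_scalar normr1 lerD2r.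
pose x := r^-1%:C *: (r%:C%:A - a).
have [] := @sqrt_one_minus x.
- by rewrite starRZ starB star_scalar sa.
- by rewrite cnormRZ gtr0_norm ?invr_gt0 // mulrC ler_pdivrMr // mul1r.
move=> y [sy y1 yE cy].
have s0 : 0 <= Num.sqrt r := sqrtr_ge0 r.
exists ((Num.sqrt r)%:C *: (1 - y)); split.
- split; first by rewrite starRZ starB star1 sy.
  exists (Num.sqrt r) => //; rewrite -scalerBr opprB addrC subrK cnormRZ ger0_norm //.
  by rewrite ler_piMr.
- have yyE : (1 - y) * (1 - y) = 1 - x.
    rewrite mulrBl mul1r mulrBr mulr1 -[x in RHS](addrK (y * y)) -yE.
    by rewrite -addrA -opprD addrA.
  rewrite -scalerAl -scalerAr scalerA -rmorphM -expr2 sqr_sqrtr ?ltW // yyE.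
  by rewrite scalerBr /x scalerA -rmorphM divff // scale1r opprB addrC subrK.
- move=> z za; rewrite -scalerAr -scalerAl mulrBr mulrBl mulr1 mul1r cy //.
  by rewrite /x -scalerAr -scalerAl mulrBr mulrBl za scalar_comm.
Qed.

Let ii : 'i * 'i = -1 :> R[i].
Proof. by rewrite -expr2 sqr_i. Qed.

(* The element u = k + ih satisfies u'u = k^2 + h^2, where u' is the adjoint of
   u, and k is the real part of u. *)
Lemma comm_sum_sq h k r : star h = h -> star k = k -> h * k = k * h -> 0 <= r ->
  k * k + h * h = r%:C%:A -> cnorm k ^+ 2 <= r.
Proof.
move=> sh sk hk r0 khr; pose u := k + 'i *: h.
have su : star u = k - 'i *: h by rewrite starD sk star_iZ.
have ur : cnorm u ^+ 2 = r.
  rewrite -cstarE -[RHS](ger0_norm r0) -(cnorm_scalar A) -khr su; congr cnorm.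
  rewrite mulrDr !mulrBl -!scalerAl -!scalerAr scalerA ii hk.
  by rewrite scaleN1r opprK addrA subrK.
rewrite -ur ler_sqr ?nnegrE ?cnorm_ge0 //.
have h2 : 2^-1 + 2^-1 = 1 :> R by lra.
have -> : k = (2^-1)%:C *: (u + star u).
  by rewrite su addrACA subrr addr0 scalerDr -scalerDl -rmorphD h2 scale1r.
rewrite cnormRZ ger0_norm // ler_pdivrMl // (le_trans (cnormD _ _)) //.
by rewrite cnorm_star; lra.
Qed.

(** The root k of |h|^2 - h^2 commutes with h and k^2 + h^2 = |h|^2, so [comm_sum_sq] bounds the
    norm of k^2 by |h|^2. *)
Lemma cpos_sq h : star h = h -> cpos (h * h).
Proof.
move=> sh; have shh : star (h * h) = h * h by rewrite starM sh.
split=> //; exists (cnorm h ^+ 2); first exact: sqr_ge0.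
have [|k [[sk _] kk ck]] := @cpos_sqrt ((cnorm h ^+ 2)%:C%:A - h * h).
  by apply: cpos_le => //; rewrite expr2 cnormM.
rewrite -kk (le_trans (cnormM _ _)) // -expr2.
apply: (@comm_sum_sq h); rewrite ?sqr_ge0 ?kk ?subrK //.
by apply: ck; rewrite mulrBl mulrBr scalar_comm mulrA.
Qed.

Let bernoulli (q : R) n : 0 <= q -> 1 + q *+ n <= (1 + q) ^+ n.
Proof.
move=> q0; elim: n => [|n IH]; first by rewrite mulr0n addr0 expr0.
rewrite exprS mulrS; have nq : 0 <= q *+ n by rewrite mulrn_wge0.
by apply: le_trans (ler_wpM2l _ IH); nra.
Qed.

(* Put v = r - c'c.  The norm of c'c v^n = c' (r - cc')^n c is O(r^n), so that
   |v^n| / r^n grows at most linearly in n, while |v^n| = |v|^n when n is a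
   power of 2. *)
Lemma cpos_swap c : cpos (c * star c) -> cpos (star c * c).
Proof.
move=> [_ [r0 r00 r0c]]; split; first by rewrite starM starK.
pose r := r0 + 1; have r_gt0 : 0 < r by rewrite ltr_wpDl.
exists r; first exact: ltW.
set v := r%:C%:A - star c * c; pose w := r%:C%:A - c * star c.
have sv : star v = v by rewrite starB star_scalar starM starK.
have wr : cnorm w <= r.
  rewrite /w rmorphD scalerDl addrAC (le_trans (cnormD _ _)) //.
  by rewrite cnorm_scalar normr1 lerD2r.
have wc n : w ^+ n * c = c * v ^+ n.
  elim: n => [|n IH]; first by rewrite !expr0 mul1r mulr1.
  rewrite exprS -mulrA IH mulrA exprS mulrA; congr (_ * _).
  by rewrite mulrBl mulrBr scalar_comm mulrA.
have wn n : cnorm (w ^+ n) <= r ^+ n.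
  elim: n => [|n IH]; first by rewrite !expr0 cnorm1.
  by rewrite !exprS (le_trans (cnormM _ _)) // ler_pM ?cnorm_ge0.
pose K := cnorm c ^+ 2.
have K0 : 0 <= K by exact: sqr_ge0.
have vS n : cnorm (v ^+ n.+1) <= r * cnorm (v ^+ n) + K * r ^+ n.
  rewrite exprS {1}/v mulrBl -mulrA -wc (le_trans (cnormB _ _)) // lerD //.
    by rewrite (le_trans (cnormM _ _)) // cnorm_scalar gtr0_norm.
  rewrite (le_trans (cnormM _ _)) // cnorm_star /K expr2 -mulrA.
  rewrite ler_wpM2l ?cnorm_ge0 // mulrC (le_trans (cnormM _ _)) //.
  by rewrite ler_wpM2r ?cnorm_ge0.
pose s := K / r; have s0 : 0 <= s by rewrite divr_ge0 // ltW.
have KE : K = r * s by rewrite mulrC divfK ?gt_eqF.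
have vn n : cnorm (v ^+ n) <= r ^+ n * (1 + s *+ n).
  elim: n => [|n IH]; first by rewrite !expr0 cnorm1 mulr0n addr0 mulr1.
  apply: (le_trans (vS n)).
  apply: (@le_trans _ _ (r * (r ^+ n * (1 + s *+ n)) + K * r ^+ n)).
    by rewrite lerD2r ler_wpM2l // ltW.
  by rewrite exprS mulrS KE; lra.
have sX n : star (v ^+ n) = v ^+ n.
  elim: n => [|n IHn]; first by rewrite expr0 star1.
  by rewrite [in LHS]exprS starM IHn sv -exprSr.
have v2 j : cnorm (v ^+ (2 ^ j)) = cnorm v ^+ (2 ^ j).
  elim: j => [|j IH]; first by rewrite expn0 !expr1.
  by rewrite expnSr !exprM -IH -cnorm_sq ?expr2.
rewrite leNgt; apply/negP => rv.
pose q := cnorm v / r - 1; have q0 : 0 < q by rewrite subr_gt0 ltr_pdivlMr // mul1r.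
have vE : cnorm v = r * (1 + q) by rewrite /q addrC subrK mulrC divfK ?gt_eqF.
(* By Bernoulli, the power of exponent 2^(j+1) is at least the square of 1 + q 2^j: quadratic in
   2^j, against the linear bound of [vn]. *)
have qn j : (1 + q *+ (2 ^ j)) ^+ 2 <= 1 + s *+ (2 ^ j.+1).
  have := vn (2 ^ j.+1)%N; rewrite v2 vE exprMn ler_pM2l ?exprn_gt0 //.
  apply: le_trans; rewrite expnSr exprM ler_sqr ?nnegrE ?bernoulli ?ltW //.
    by rewrite ltr_wpDr // mulrn_wge0 // ltW.
  by rewrite exprn_gt0 // ltr_wpDr // ltW.
pose N := (Num.truncn (2 * s / q ^+ 2)).+1.
have NP : 2 * s / q ^+ 2 < N%:R by exact: truncnS_gt.
have N2 : (N <= 2 ^ N)%N by exact: ltnW (ltn_expl _ _).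
have {}NP : 2 * s < (2 ^ N)%:R * q ^+ 2.
  by rewrite -ltr_pdivrMr ?exprn_gt0 // (lt_le_trans NP) // ler_nat.
have := qn N; rewrite expnSr -[q *+ _]mulr_natr -[s *+ _]mulr_natr natrM.
have : 1 <= (2 ^ N)%:R :> R by rewrite ler1n expn_gt0.
move: NP; set M := (2 ^ N)%:R => MP M1 Mle.
have : 0 < M * (M * q ^+ 2 - 2 * s) by rewrite mulr_gt0 ?subr_gt0 //; lra.
have : 0 <= q * M by rewrite mulr_ge0 //; lra.
nra.
Qed.

(** The roots m of a and n of -a commute and m^2 + n^2 = 0, so [comm_sum_sq] with r = 0 gives m =
    0. *)
Lemma cpos_anti a : cpos a -> cpos (- a) -> a = 0.
Proof.
move=> pa pNa; have [m [[sm _] mm cm]] := cpos_sqrt pa.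
have [n [[sn _] nn cn]] := cpos_sqrt pNa.
have ma : m * a = a * m by rewrite (cm a).
have mn : m * n = n * m by apply: cn; rewrite mulrN mulNr ma.
have := comm_sum_sq sn sm (esym mn) (lexx 0).
rewrite mm nn subrr scale0r => /(_ erefl) m0.
have {}m0 : cnorm m = 0.
  by apply/eqP; rewrite -sqrf_eq0; apply/eqP/le_anti; rewrite m0 sqr_ge0.
by rewrite -mm (cnorm_eq0 _ m0) mul0r.
Qed.

(* Kaplansky's argument: with h = b'b, m = |h| and g = m - h, twice the
   negative part of h, the element c = bg has c'c = - m g^2 <= 0. *)
Lemma cpos_starM b : cpos (star b * b).
Proof.
set h := star b * b; have sh : star h = h by rewrite starM starK.
have [m [pm mm cm]] := cpos_sqrt (cpos_sq sh); have [sm _] := pm.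
have [n [[sn _] nn cn]] := cpos_sqrt pm.
have hm : h * m = m * h by apply: cm; rewrite mulrA.
have hn : h * n = n * h by exact: cn.
have mn : m * n = n * m by exact: cn.
pose g := m - h; have sg : star g = g by rewrite starB sm sh.
have gm : g * m = m * g by rewrite mulrBl mulrBr hm.
have gn : g * n = n * g by rewrite mulrBl mulrBr hn mn.
have hg : h * g = - (m * g).
  by apply/eqP; rewrite -addr_eq0 !mulrBr hm mm addrC addrA subrK subrr.
pose c := b * g; pose d := n * g.
have sd : star d = d by rewrite starM sn sg gn.
have ccE : star c * c = - (d * d).
  rewrite starM sg -mulrA [star b * _]mulrA -/h hg mulrN mulrA gm -nn /d.
  by rewrite -!mulrA [g * (n * g)]mulrA gn !mulrA.
have [x [y [sx sy cE]]] : exists x y, [/\ star x = x, star y = y & c = x + 'i *: y].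
  exists (re_part c), (im_part c); split; last exact: re_imE.
    exact: self_adjoint_re.
  exact: self_adjoint_im.
have E1 : c * star c = x * x + y * y + 'i *: (y * x - x * y).
  rewrite cE starD sx star_iZ // mulrDl !mulrBr -!scalerAl -!scalerAr scalerA ii.
  rewrite scaleN1r opprK scalerBr ['i *: _ + y * y]addrC addrACA.
  by rewrite ['i *: (y * x) - _]addrC.
have E2 : star c * c = x * x + y * y + 'i *: (x * y - y * x).
  rewrite cE starD sx star_iZ // mulrBl !mulrDr -!scalerAl -!scalerAr scalerA ii.
  by rewrite scaleN1r opprD opprK scalerBr [- _ + y * y]addrC addrACA.
(* The sum cc' + c'c is 2 (x^2 + y^2) and c'c is - d^2. Hence cc' is a sum of squares, and
   [cpos_swap] makes c'c positive although it is also the opposite of a square. *)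
have cc2 : c * star c = x * x + y * y + (x * x + y * y) + d * d.
  by rewrite -[d * d]opprK -ccE E1 E2 opprD addrA addrK -scalerN opprB.
have pcc : cpos (star c * c).
  by apply: cpos_swap; rewrite cc2; do !apply: cposD => //; apply: cpos_sq.
have c0 : d * d = 0.
  apply: cpos_anti; first exact: cpos_sq.
  by rewrite -ccE.
have g0 : g = 0.
  apply: cnorm_eq0; apply/eqP; rewrite -sqrf_eq0 -sqrf_eq0 -(cnorm_sq sg).
  rewrite -cnorm_sq; last by rewrite starM sg.
  (* From hg = - mg one gets g^2 = 2 mg, hence g^3 = 2 mg^2 = 2 d^2 = 0. *)
  have ggE : g * g = m * g + m * g.
    by rewrite {1}/g mulrBl hg opprK.
  have mgg : m * g * g = 0 by rewrite -c0 /d -nn -!mulrA [g * (n * g)]mulrA gn !mulrA.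
  by rewrite mulrA {1}ggE mulrDl mgg addr0 mul0r cnorm0.
by have -> : h = m by apply/eqP; rewrite eq_sym -subr_eq0 -/g g0.
Qed.

(** The roots m of r - a and n of r + a commute with each other and with a, so (mn)^2 + a^2 = r^2
    and [comm_sum_sq] applies. *)
Lemma cnorm_le_cpos a r : cpos (r%:C%:A - a) -> cpos (r%:C%:A + a) -> cnorm a <= r.
Proof.
move=> pB pD.
have r0 : 0 <= r.
  have := cposD pB pD; rewrite addrACA addNr addr0 -scalerDl -rmorphD.
  by move=> /cpos_scalar_ge0; lra.
have [m [[sm _] mm cm]] := cpos_sqrt pB; have [n [[sn _] nn cn]] := cpos_sqrt pD.
have sa : star a = a.
  by have [+ _] := pD; rewrite starD star_scalar => /addrI.
have am : a * m = m * a by apply: cm; rewrite mulrBl mulrBr scalar_comm.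
have an : a * n = n * a by apply: cn; rewrite mulrDl mulrDr scalar_comm.
have mn : m * n = n * m by apply: cn; rewrite mulrDl mulrDr scalar_comm am.
rewrite -ler_sqr ?nnegrE ?cnorm_ge0 //.
apply: (@comm_sum_sq (m * n)); rewrite ?sqr_ge0 //.
- by rewrite starM sm sn.
- by rewrite [a * _]mulrA am -!mulrA an.
have -> : m * n * (m * n) = (r%:C%:A - a) * (r%:C%:A + a).
  by rewrite -mm -nn -!mulrA [n * (m * n)]mulrA -mn !mulrA.
rewrite addrC mulrBl !mulrDr opprD addrA subrK (scalar_comm _ a) addrK.
by rewrite -scalerAl mul1r scalerA -rmorphM -expr2.
Qed.

End positive_elements.

(** * States *)

Section hahn_banach.
Variables (R : realType) (V : lmodType R[i]).
Implicit Types (p q : V -> R) (x y : V) (r t : R).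

Definition sublinear p : Prop := (forall x y, p (x + y) <= p x + p y) /\
  (forall r x, 0 < r -> p (r%:C *: x) <= r * p x).

Lemma sublinearZ p r x : sublinear p -> 0 < r -> p (r%:C *: x) = r * p x.
Proof.
move=> [_ pZ] r0; apply/le_anti; rewrite pZ //= mulrC -ler_pdivlMr // mulrC.
have {1}-> : x = (r^-1)%:C *: (r%:C *: x).
  by rewrite scalerA -rmorphM mulVf ?gt_eqF // scale1r.
by apply: pZ; rewrite invr_gt0.
Qed.

Lemma sublinear0 p : sublinear p -> p 0 = 0.
Proof.
by move=> pS; have := sublinearZ 0 pS (ltr0Sn R 1); rewrite scaler0; lra.
Qed.

Lemma sublinear_ge p x : sublinear p -> - p (- x) <= p x.
Proof.
by move=> pS; have := pS.1 x (- x); rewrite subrr sublinear0 //; lra.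
Qed.

(* This is a sublinear functional below [p].  If [p] is minimal, then the two
   are equal, which at - a gives p (- a) = - p a. *)
Let reduce p a x := inf [set p (x + t%:C *: a) - t * p a | t in [set t | 0 <= t]].

Let reduce_has p a x : sublinear p ->
  has_inf [set p (x + t%:C *: a) - t * p a | t in [set t | 0 <= t]].
Proof.
move=> pS; split; first by exists (p (x + 0%:C *: a) - 0 * p a), 0 => //=.
exists (- p (- x)) => _ [t /= t0 <-].
have [->|tn0] := eqVneq t 0.
  by rewrite scale0r addr0 mul0r subr0 sublinear_ge.
have := pS.1 (x + t%:C *: a) (- x); rewrite addrAC subrr add0r sublinearZ //.
  by lra.
by rewrite lt0r tn0.
Qed.

Let reduce_lb p a x t : sublinear p -> 0 <= t ->
  reduce p a x <= p (x + t%:C *: a) - t * p a.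
Proof.
by move=> pS t0; apply: ge_inf; [have [] := reduce_has a x pS | exists t].
Qed.

Let reduce_sublinear p a : sublinear p -> sublinear (reduce p a).
Proof.
move=> pS; split=> [x y|r x r0].
  apply/ler_addgt0Pr => e e0; have e20 : 0 < e / 2 by rewrite divr_gt0.
  have [_ [t /= t0 <-] ht] := inf_adherent e20 (reduce_has a x pS).
  have [_ [s /= s0 <-] hs] := inf_adherent e20 (reduce_has a y pS).
  have ts0 : 0 <= t + s by rewrite addr_ge0.
  apply: le_trans (reduce_lb a (x + y) pS ts0) _.
  have := pS.1 (x + t%:C *: a) (y + s%:C *: a).
  rewrite addrACA -scalerDl -rmorphD; move: ht hs; rewrite -/(reduce p a x).
  by rewrite -/(reduce p a y); lra.
rewrite mulrC -ler_pdivrMr //; apply: lb_le_inf; first by case: (reduce_has a x pS).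
move=> _ [t /= t0 <-]; rewrite ler_pdivrMr //.
have rt0 : 0 <= r * t by rewrite mulr_ge0 // ltW.
apply: le_trans (reduce_lb a (r%:C *: x) pS rt0) _.
by rewrite rmorphM -scalerA -scalerDr sublinearZ //; lra.
Qed.

Let reduce_le p a x : sublinear p -> reduce p a x <= p x.
Proof.
by move=> pS; have := reduce_lb a x pS (lexx 0); rewrite scale0r addr0 mul0r subr0.
Qed.

(** The functional is a minimal sublinear functional below [p]: [reduce] makes it odd, and an odd
    sublinear functional is real-linear. [Zorn] is applied to the reversed pointwise order; a chain
    is bounded by its pointwise infimum, which is finite because every member is at least - p (- x)
    at x. *)
Lemma hahn_banach p : sublinear p -> exists f : V -> R,
  [/\ forall x y, f (x + y) = f x + f y,
      forall r x, f (r%:C *: x) = r * f x & forall x, f x <= p x].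
Proof.
move=> pS; pose T := {q : V -> R | sublinear q /\ forall x, q x <= p x}.
pose mkT q (qS : sublinear q) (qp : forall x, q x <= p x) : T :=
  exist (fun q => sublinear q /\ forall x, q x <= p x) q (conj qS qp).
pose below (s t : T) := `[< forall x, sval t x <= sval s x >].
have [s|r s t|s t|X Xtot|] := @Zorn T below.
- exact/asboolP.
- by move=> /asboolP rs /asboolP st; apply/asboolP => x; exact: le_trans (st x) (rs x).
- move=> /asboolP + /asboolP; case: s t => [s ps] [t pt] /= st ts.
  by apply: eq_exist; apply/funext => x; apply/le_anti; rewrite st ts.
- have [X0|] := pselect (exists s, X s); last first.
    move=> X0; exists (mkT p pS (fun=> lexx _)) => s Xs.
    by exfalso; apply: X0; exists s.
  pose E x := [set sval s x | s in X].
  have Ehas x : has_inf (E x).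
    split; first by have [s Xs] := X0; exists (sval s x), s.
    exists (- p (- x)) => _ [[q [qS qp]] Xq <-] /=.
    by rewrite (le_trans _ (sublinear_ge x qS)) // lerN2.
  have Elb s x : X s -> inf (E x) <= sval s x.
    by move=> Xs; apply: ge_inf; [have [] := Ehas x | exists s].
  have ES : sublinear (fun x => inf (E x)).
    split=> [x y|r x r0].
      apply/ler_addgt0Pr => e e0; have e20 : 0 < e / 2 by rewrite divr_gt0.
      have [_ [s Xs <-] hs] := inf_adherent e20 (Ehas x).
      have [_ [t Xt <-] ht] := inf_adherent e20 (Ehas y).
      have [/asboolP st|/asboolP ts] := Xtot s t Xs Xt.
        have [[tS _] _] := svalP t.
        by have := Elb t (x + y) Xt; have := tS x y; have := st x; lra.
      have [[sS _] _] := svalP s.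
      by have := Elb s (x + y) Xs; have := sS x y; have := ts y; lra.
    rewrite mulrC -ler_pdivrMr //; apply: lb_le_inf; first by case: (Ehas x).
    move=> _ [s Xs <-]; rewrite ler_pdivrMr // (le_trans (Elb s _ Xs)) //.
    by have [sS _] := svalP s; rewrite sublinearZ // mulrC.
  have Ep x : inf (E x) <= p x.
    have [s Xs] := X0; rewrite (le_trans (Elb s _ Xs)) //.
    by have [_ sp] := svalP s.
  exists (mkT _ ES Ep) => s Xs; apply/asboolP => x; exact: Elb.
move=> [q [qS qp]] qmin; exists q.
have qred a : q = reduce q a.
  have rS := reduce_sublinear a qS.
  have rp x : reduce q a x <= p x := le_trans (reduce_le a x qS) (qp x).
  have := qmin (mkT _ rS rp); rewrite /below /=.
  by move=> /(_ (asboolT (fun x => reduce_le a x qS)))/(congr1 sval).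
have qN x : q (- x) = - q x.
  apply/le_anti; have := sublinear_ge x qS; rewrite lerNl => ->; rewrite andbT.
  have := reduce_lb x (- x) qS ler01; rewrite -qred scale1r addNr.
  by rewrite sublinear0 // sub0r mul1r.
split=> // [x y|r x].
  apply/le_anti; rewrite qS.1 /=.
  by have := qS.1 (x + y) (- y); rewrite addrK qN; lra.
have [r0|r0|->] := ltrgt0P r.
- exact: sublinearZ.
- have Nr0 : 0 < - r by rewrite oppr_gt0.
  have := sublinearZ x qS Nr0; rewrite rmorphN scaleNr qN; lra.
- by rewrite scale0r mul0r sublinear0.
Qed.

End hahn_banach.

Section positive_functionals.
Variables (R : realType) (A : normedStarAlgType R).
Hypothesis hA : cstar_algebra A.
Implicit Types (a b h x y : A) (r s t : R) (phi : A -> R[i]).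

Lemma re_partD x y : re_part (x + y) = re_part x + re_part y.
Proof. by rewrite /re_part starD addrACA scalerDr. Qed.

Lemma re_partZ r x : re_part (r%:C *: x) = r%:C *: re_part x.
Proof. by rewrite /re_part starRZ -scalerDr !scalerA mulrC. Qed.

Lemma re_partN x : re_part (- x) = - re_part x.
Proof. by rewrite /re_part starN -opprD scalerN. Qed.

Lemma re_part_sa x : star x = x -> re_part x = x.
Proof.
by move=> sx; have := re_part_pair sx (@star0 _ A); rewrite scaler0 addr0.
Qed.

Lemma re_part_i h : star h = h -> re_part ('i *: h) = 0.
Proof. by move=> sh; rewrite /re_part star_iZ // subrr scaler0. Qed.

Definition pos_functional phi : Prop :=
  scalar phi /\ forall a, 0 <= phi (star a * a).

(** The extension theorem of M. Riesz for the cone of positive elements. [K] is the graph of a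
    positive functional on a real space of self-adjoint elements that contains 1. A relation avoids
    a choice of preimages; positivity at 0 makes it single-valued. *)
Lemma riesz_extension (K : A -> R -> Prop) c :
  (forall x y s t, K x s -> K y t -> K (x + y) (s + t)) ->
  (forall r x s, K x s -> K (r%:C *: x) (r * s)) -> K 1 c ->
  (forall x s, K x s -> star x = x) ->
  (forall x s, K x s -> cpos x -> 0 <= s) ->
  exists phi, pos_functional phi /\ forall x s, K x s -> phi x = s%:C.
Proof.
move=> KD KZ K1 Ks Kpos.
(* The infimum of [E x] is an upper bound at the real part of x for every positive extension of [K].
   Multiples of 1 show that [E x] is nonempty and bounded below. Domination by it gives positivity,
   since 0 majorizes - x when x is positive. *)
pose E x := [set s | exists2 y, K y s & cpos (y - re_part x)].
have Ehas x : has_inf (E x).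
  have sx : star (re_part x) = re_part x by exact: self_adjoint_re.
  split.
    exists (cnorm (re_part x) * c), ((cnorm (re_part x))%:C *: 1); first exact: KZ.
    exact: cpos_le.
  exists (- (cnorm (re_part x) * c)) => s [y Kys yx].
  have := KD _ _ _ _ Kys (KZ (cnorm (re_part x)) _ _ K1).
  move=> /Kpos; rewrite -lerBlDr sub0r; apply.
  rewrite -[y](subrK (re_part x)) -addrA; apply: cposD => //.
  have : cpos ((cnorm (- re_part x))%:C%:A - (- re_part x)).
    by apply: cpos_le => //; rewrite starN sx.
  by rewrite cnormN opprK addrC.
pose p x := inf (E x).
have plb x y s : K y s -> cpos (y - re_part x) -> p x <= s.
  by move=> Ky yx; apply: ge_inf; [have [] := Ehas x | exists y].
have pS : sublinear p.
  split=> [x y|r x r0].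
    apply/ler_addgt0Pr => e e0; have e20 : 0 < e / 2 by rewrite divr_gt0.
    have [s [x' Kx xx] hs] := inf_adherent e20 (Ehas x).
    have [t [y' Ky yy] ht] := inf_adherent e20 (Ehas y).
    have := plb (x + y) (x' + y') (s + t) (KD _ _ _ _ Kx Ky).
    rewrite re_partD opprD addrACA => /(_ (cposD xx yy)).
    by move: hs ht; rewrite -/(p x) -/(p y); lra.
  rewrite mulrC -ler_pdivrMr //; apply: lb_le_inf; first by case: (Ehas x).
  move=> s [y Ky yx]; rewrite ler_pdivrMr // mulrC.
  apply: (plb _ (r%:C *: y)); first exact: KZ.
  by rewrite re_partZ -scalerBr; apply: cposZ => //; exact: ltW.
have K0 : K 0 0 by have := KZ 0 _ _ K1; rewrite scale0r mul0r.
have [f [fD fZ fp]] := hahn_banach pS.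
have f0 : f 0 = 0 by have := fZ 0 0; rewrite scaler0 mul0r.
have fN x : f (- x) = - f x.
  by apply/eqP; rewrite -addr_eq0 -fD addNr f0.
have fi h : star h = h -> f ('i *: h) = 0.
  move=> sh; have le0 k : star k = k -> f ('i *: k) <= 0.
    move=> sk; apply: le_trans (fp _) _; apply: (plb _ 0) => //.
    by rewrite re_part_i // subr0; exact: cpos0.
  apply/le_anti; rewrite le0 //= -oppr_le0 -fN -scalerN le0 //.
  by rewrite starN sh.
have fpos x : cpos x -> 0 <= f x.
  move=> px; rewrite -oppr_le0 -fN (le_trans (fp _)) //; apply: (plb _ 0) => //.
  have [sx _] := px; have sNx : star (- x) = - x by rewrite starN sx.
  by rewrite re_part_sa // opprK add0r.
have fK x s : K x s -> f x = s.
  have le y t : K y t -> f y <= t.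
    move=> Ky; apply: le_trans (fp _) _; apply: (plb _ _ _ Ky).
    by rewrite re_part_sa ?(Ks _ _ Ky) // subrr; exact: cpos0.
  move=> Kx; apply/le_anti; rewrite le //= -lerN2 -fN le //.
  by have := KZ (- 1) _ _ Kx; rewrite rmorphN scaleN1r mulN1r.
(* This is the complex-linear functional with real part [f]; it is real on self-adjoint elements
   because [f] vanishes on their multiples by i. *)
exists (fun x => f x +i* - f ('i *: x)); split; last first.
  by move=> x s Kx; rewrite (fK _ _ Kx) fi ?oppr0 // (Ks _ _ Kx).
split=> [k x y|a]; last first.
  rewrite lecE /= fi ?oppr0 ?eqxx /=; last by rewrite starM starK.
  exact/fpos/cpos_starM.
have kE (l : R[i]) (z : A) :
    l *: z = (complex.Re l : R)%:C *: z + (complex.Im l : R)%:C *: ('i *: z).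
  by rewrite {1}[l]complexE scalerDl scalerA mulrC.
have fk (l : R[i]) (z : A) : f (l *: z) = complex.Re l * f z + complex.Im l * f ('i *: z).
  by rewrite kE fD !fZ.
rewrite fD (fk k) scalerDr fD scalerA ['i * k]mulrC -scalerA (fk k).
have -> : f ('i *: ('i *: x)) = - f x.
  by rewrite scalerA -expr2 sqr_i scaleN1r fN.
apply/eqP; rewrite eq_complex; case: k => u v /=; apply/andP; split; apply/eqP; lra.
Qed.

Section pos_functional_theory.
Variable phi : A -> R[i].
Hypothesis pf : pos_functional phi.

Lemma pf0 : phi 0 = 0.
Proof. by have := pf.1 (-1) 0 0; rewrite scaler0 addr0 mulN1r addNr. Qed.

Lemma pfD x y : phi (x + y) = phi x + phi y.
Proof. by have := pf.1 1 x y; rewrite scale1r mul1r. Qed.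

Lemma pfZ (k : R[i]) x : phi (k *: x) = k * phi x.
Proof. by have := pf.1 k x 0; rewrite !addr0 pf0 addr0. Qed.

Lemma pfN x : phi (- x) = - phi x.
Proof. by rewrite -scaleN1r pfZ mulN1r. Qed.

Lemma pfB x y : phi (x - y) = phi x - phi y.
Proof. by rewrite pfD pfN. Qed.

Lemma pf_cpos a : cpos a -> 0 <= phi a.
Proof.
move=> /(cpos_sqrt hA)[m [[sm _] <- _]].
by rewrite -{1}sm; exact: pf.2.
Qed.

Lemma pf1_ge0 : 0 <= phi 1.
Proof. by have := pf.2 1; rewrite star1 mulr1. Qed.

Let Im_pf1 : complex.Im (phi 1) = 0.
Proof. by have := pf1_ge0; rewrite lecE /= => /andP[/eqP]. Qed.

Let Im_scalar r : complex.Im (phi (r%:C *: 1)) = 0.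
Proof.
by rewrite pfZ; move: Im_pf1; case: (phi 1) => u v /= ->; rewrite mulr0 mul0r addr0.
Qed.

Let Re_scalar r : complex.Re (phi (r%:C *: 1)) = r * complex.Re (phi 1).
Proof. by rewrite pfZ; case: (phi 1) => u v /=; rewrite mul0r subr0. Qed.

Lemma pf_Im a : star a = a -> complex.Im (phi a) = 0.
Proof.
move=> sa; have /pf_cpos := cpos_le sa (lexx (cnorm a)).
rewrite pfB lecE => /andP[/eqP + _]; rewrite raddfB /= Im_scalar sub0r.
by move=> /eqP; rewrite oppr_eq0 => /eqP.
Qed.

Lemma pf_real a : star a = a -> phi a = (complex.Re (phi a))%:C.
Proof. by move=> /pf_Im; case: (phi a) => u v /= ->. Qed.

Lemma pf_le a r : star a = a -> cnorm a <= r -> normc (phi a) <= r * complex.Re (phi 1).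
Proof.
move=> sa ar; rewrite pf_real // normc_real ler_norml -Re_scalar.
have sNa : star (- a) = - a by rewrite starN sa.
have rNa : cnorm (- a) <= r by rewrite cnormN.
have /pf_cpos := cpos_le sa ar; have /pf_cpos := cpos_le sNa rNa.
rewrite !pfB pfN opprK !lecE => /andP[_ p1] /andP[_ p2].
by move: p1 p2; rewrite raddfD raddfB /=; lra.
Qed.

End pos_functional_theory.

Lemma state_pf phi : state phi -> pos_functional phi.
Proof. by move=> [? _ ?]; split. Qed.

Lemma state_norm_sa phi a : state phi -> star a = a -> normc (phi a) <= cnorm a.
Proof.
move=> sp sa; have := pf_le (state_pf sp) sa (lexx _).
by have [_ -> _] := sp; rewrite mulr1.
Qed.

Lemma cnorm_re_part x : cnorm (re_part x) <= cnorm x.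
Proof.
rewrite cnormZ normcV2 ler_pdivrMl // (le_trans (cnormD _ _)) // cnorm_star; lra.
Qed.

(** On the span of 1 and a, one of the two functionals that send 1 to 1 and a to |a| or - |a| is
    positive, and it extends. If both failed, there would be r and q less than |a| with r - a and q
    + a positive, against [cnorm_le_cpos]. *)
Lemma exists_norming_state a : star a = a ->
  exists2 phi, state phi & normc (phi a) = cnorm a.
Proof.
move=> sa; set N := cnorm a.
have [e [e1 eP]] : exists e : R, `|e| = 1 /\
    forall s t, cpos (s%:C *: 1 + t%:C *: a) -> 0 <= s + t * (e * N).
  apply: contrapT => H.
  (* As s + |t| N >= 0 always holds for a positive s + tb, a failure forces t < 0, and division by -
     t gives the bound r = s / (- t). *)
  have key (b : A) s t : star b = b -> cnorm b = N ->
      cpos (s%:C *: 1 + t%:C *: b) -> s + t * N < 0 ->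
      exists2 r, r < N & cpos (r%:C *: 1 - b).
    move=> sb bN p neg.
    have st0 : 0 <= s + `|t| * N.
      have sz : star (t%:C *: b) = t%:C *: b by rewrite starRZ sb.
      have := cposD p (@cpos_le _ _ (t%:C *: b) (`|t| * N) sz _).
      rewrite addrACA addrN addr0 -scalerDl -rmorphD; move=> H1.
      by apply: cpos_scalar_ge0; apply: H1; rewrite cnormRZ bN.
    have t0 : t < 0 by rewrite ltNge; apply/negP => t0; move: st0; rewrite ger0_norm //; lra.
    have Nt0 : 0 < - t by rewrite oppr_gt0.
    exists (s / - t); first by rewrite ltr_pdivrMr //; lra.
    have Vt : 0 <= (- t)^-1 by rewrite invr_ge0 ltW.
    have tE : (- t)^-1 * t = - 1 by rewrite invrN mulNr mulVf // lt_eqF.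
    have := cposZ Vt p; rewrite scalerDr !scalerA -!rmorphM tE mulrC.
    by rewrite rmorphN scaleN1r.
  have [s [t [p1 n1]]] : exists s t, cpos (s%:C *: 1 + t%:C *: a) /\ s + t * N < 0.
    apply: contrapT => H'; apply: H; exists 1; split; first exact: normr1.
    move=> s t p; rewrite leNgt; apply/negP; rewrite mul1r => n.
    by apply: H'; exists s, t.
  have [u [v [p2 n2]]] : exists s t, cpos (s%:C *: 1 + t%:C *: a) /\ s - t * N < 0.
    apply: contrapT => H'; apply: H; exists (-1); split; first by rewrite normrN1.
    move=> u v p; rewrite leNgt; apply/negP; rewrite mulN1r mulrN => n.
    by apply: H'; exists u, v.
  have [r rN rp] := key a s t sa erefl p1 n1.
  have [||||q qN qp] := key (- a) u (- v).
  - by rewrite starN sa.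
  - by rewrite cnormN.
  - by rewrite rmorphN scaleNr scalerN opprK.
  - by rewrite mulNr.
  pose m := Num.max r q.
  have up (b : A) (w : R) : w <= m -> cpos (w%:C *: 1 - b) -> cpos (m%:C *: 1 - b).
    move=> wm pw; have := cposD (@cpos_scalar _ A (m - w) _) pw.
    by rewrite addrA -scalerDl -rmorphD subrK; apply; rewrite subr_ge0.
  have : N <= m.
    apply: (cnorm_le_cpos hA); first by apply: up rp; rewrite le_max lexx.
    by rewrite -[a]opprK; apply: up qp; rewrite le_max lexx orbT.
  by rewrite le_max => /orP[]; lra.
pose K x v := exists s t, x = s%:C *: 1 + t%:C *: a /\ v = s + t * (e * N).
have [|||||phi [pf phiK]] := @riesz_extension K 1.
- move=> _ _ _ _ [s [t [-> ->]]] [s' [t' [-> ->]]]; exists (s + s'), (t + t').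
  by rewrite addrACA -!scalerDl -!rmorphD; split=> //; lra.
- move=> r _ _ [s [t [-> ->]]]; exists (r * s), (r * t).
  by rewrite scalerDr !scalerA -!rmorphM; split=> //; lra.
- by exists 1, 0; rewrite scale1r scale0r addr0 mul0r addr0.
- by move=> _ _ [s [t [-> _]]]; rewrite starD star_scalar starRZ sa.
- by move=> _ _ [s [t [-> ->]]]; exact: eP.
exists phi.
  split; [exact: pf.1 | | exact: pf.2].
  by apply: phiK; exists 1, 0; rewrite scale1r scale0r addr0 mul0r addr0.
rewrite (phiK a (e * N)); last by exists 0, 1; rewrite scale1r scale0r add0r mul1r add0r.
by rewrite normc_real normrM e1 mul1r ger0_norm // cnorm_ge0.
Qed.

Lemma exists_state : exists phi : A -> R[i], state phi.
Proof. by have [phi sp _] := exists_norming_state (@star1 _ A); exists phi. Qed.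

End positive_functionals.

(** * Isometric embeddings and extension of positive functionals *)

Definition isometric_star (R : realType) (X A : normedStarAlgType R)
  (j : X -> A) : Prop := star_preserving j /\ forall x, cnorm (j x) = cnorm x.

Section state_extension.
Variables (R : realType) (X A : normedStarAlgType R).
Hypotheses (hX : cstar_algebra X) (hA : cstar_algebra A).
Variable j : {lrmorphism X -> A}.
Hypothesis hj : isometric_star j.

Lemma isometric_star_inj : injective j.
Proof.
move=> x y jxy; apply/eqP; rewrite -subr_eq0; apply/eqP/cnorm_eq0.
by rewrite -hj.2 raddfB /= jxy subrr cnorm0.
Qed.

Lemma iso_self_adjoint (x : X) : star (j x) = j x -> star x = x.
Proof. by rewrite -hj.1 => /isometric_star_inj. Qed.

(** Since [cpos] is a condition on norms and [j] is unital and isometric, a self-adjoint x with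
    positive image is positive in X; this is the positivity that [riesz_extension] asks of the
    graph. The functional is not normalized, because the restriction of a state to a direct summand
    is not. *)
Lemma pos_functional_extension (f : X -> R[i]) : pos_functional f ->
  exists2 F : A -> R[i], pos_functional F & forall x, F (j x) = f x.
Proof.
move=> pf; pose K y v := exists x, [/\ star x = x, y = j x & f x = v%:C].
have [|||||F [pF FK]] := @riesz_extension _ _ hA K (complex.Re (f 1)).
- move=> _ _ s t [x [sx -> fx]] [y [sy -> fy]]; exists (x + y).
  by rewrite starD sx sy (pfD pf) fx fy -rmorphD; split=> //; rewrite raddfD.
- move=> r _ s [x [sx -> fx]]; exists (r%:C *: x).
  by rewrite starRZ sx linearZ (pfZ pf) fx -rmorphM.
- exists 1; split; [exact: star1 | by rewrite rmorph1 |].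
  exact: (pf_real hX pf (@star1 _ X)).
- by move=> _ _ [x [sx -> _]]; rewrite -hj.1 sx.
- move=> _ s [x [sx -> fx]] [_ [r r0 rx]].
  have /(pf_cpos hX pf) : cpos x.
    split=> //; exists r => //.
    by rewrite -hj.2 raddfB /= linearZ /= rmorph1.
  by rewrite fx lecR.
have Fsa x : star x = x -> F (j x) = f x.
  move=> sx; rewrite (pf_real hX pf sx); apply: FK; exists x.
  by rewrite -(pf_real hX pf sx).
exists F => // x.
have sr : star (re_part x) = re_part x by exact: self_adjoint_re.
have si : star (im_part x) = im_part x by exact: self_adjoint_im.
have jx : j x = j (re_part x) + 'i *: j (im_part x).
  by rewrite {1}(re_imE x) raddfD; congr (_ + _); exact: linearZ_LR.
rewrite jx [in RHS](re_imE x) (pfD pF) (pfD pf) (pfZ pF) (pfZ pf).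
by rewrite (Fsa _ sr) (Fsa _ si).
Qed.

Lemma state_comp (phi : A -> R[i]) : star_preserving j -> state phi ->
  state (phi \o j).
Proof.
move=> js [p1 p2 p3]; split.
- by move=> k x y; rewrite /= raddfD /= linearZ /= p1.
- by rewrite /= rmorph1.
- by move=> a; rewrite /= rmorphM /= js.
Qed.

End state_extension.

(** * The Monge-Kantorovich metric *)

Section weak_topology.
Variables (R : realType) (A : normedStarAlgType R).
Implicit Types (a b x y : A) (r e d : R) (phi psi : A -> R[i]) (s : seq A).

Definition weak_near phi s d psi : Prop :=
  forall x, x \in s -> normc (phi x - psi x) < d.

Let normrE (z : R[i]) : `|z| = (normc z)%:C.
Proof. by rewrite normc_def; case: z. Qed.

Lemma nbhs_complexP (z : R[i]^o) (V : set R[i]^o) :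
  nbhs z V <-> exists2 d : R, 0 < d & forall w : R[i], normc (z - w) < d -> V w.
Proof.
split=> [/nbhs_ballP[e /= e0 eV]|[d d0 dV]]; last apply/nbhs_ballP.
  move: e0; rewrite ltcE /= => /andP[/eqP e1 e2].
  exists (complex.Re e) => // w zw; apply: eV.
  have eE : e = (complex.Re e)%:C by move: e1; case: (e) => u v /= ->.
  by rewrite /ball /= normrE eE ltcR.
exists (d%:C : R[i]); first by rewrite /= ltcR.
by move=> w; rewrite /ball /= normrE ltcR => /dV.
Qed.

(** The sets that contain some [weak_near phi s d] form a filter that converges pointwise to [phi],
    hence contains all neighbourhoods; conversely each such basic set is a finite intersection of
    neighbourhoods. *)
Lemma weak_nbhsP phi (U : set (A -> R[i])) :
  nbhs (phi : {ptws A -> R[i]^o}) U <->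
  exists s d, 0 < d /\ forall psi, weak_near phi s d psi -> U psi.
Proof.
pose G : set_system (A -> R[i]^o) :=
  fun U => exists s d, 0 < d /\ forall psi, weak_near phi s d psi -> U psi.
have GF : Filter G.
  split.
  - by exists [::], 1.
  - move=> P Q [s [d [d0 sP]]] [t [d' [d'0 tQ]]].
    exists (s ++ t), (Num.min d d'); split; first by rewrite lt_min d0.
    move=> psi near; split; [apply: sP|apply: tQ] => x xs;
      by apply: lt_le_trans (near x _) _; rewrite ?mem_cat ?xs ?orbT // ge_min lexx ?orbT.
  - move=> P Q PQ [s [d [d0 sP]]]; exists s, d; split=> // psi /sP; exact: PQ.
split=> [nU|[s [d [d0 sU]]]].
  suff : {ptws, G --> (phi : A -> R[i]^o)} by move=> /(_ U nU).
  apply/pointwise_cvgP => t V /nbhs_complexP[d d0 dV].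
  by exists [:: t], d; split=> // psi /(_ t); rewrite mem_head => /(_ isT)/dV.
pose N := nbhs (phi : {ptws A -> R[i]^o}).
have NF : Filter N by exact: nbhs_filter.
have Nx x : N [set psi | normc (phi x - psi x) < d].
  have /pointwise_cvgP/(_ x) : {ptws, N --> (phi : A -> R[i]^o)} by exact: cvg_id.
  by move=> /(_ [set w | normc (phi x - w) < d]); apply; apply/nbhs_complexP; exists d.
suff : N (weak_near phi s d) by apply: filterS => psi; exact: sU.
elim: s {sU} => [|x s IH]; first by apply: filterS filterT => psi _ x.
apply: filterS (filterI (Nx x) IH) => psi [px ps] y.
by rewrite inE => /orP[/eqP ->//|]; exact: ps.
Qed.

End weak_topology.

Section monge_kantorovich.
Variables (R : realType) (A : normedStarAlgType R).
Variable (L : A -> \bar R).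
Hypothesis hL : real_seminorm (@self_adjoint R A) L.
Implicit Types (a b x y : A) (r e d : R) (phi psi : A -> R[i]) (s : seq A).

Lemma lipN0 : L 0 = 0%E.
Proof.
have [_ _ LZ] := hL; have := LZ 0 0 (@star0 _ A).
by rewrite scaler0 normr0 mul0e.
Qed.

Lemma lip_ge0 a : star a = a -> (0 <= L a)%E.
Proof. by have [+ _ _] := hL; apply. Qed.

Lemma lip_scale a r M : 0 <= r -> star a = a -> (L a <= M%:E)%E ->
  (L (r%:C *: a) <= (r * M)%:E)%E.
Proof.
move=> r0 sa aM; have [_ _ ->//] := hL.
by rewrite ger0_norm // EFinM lee_wpmul2l // lee_fin.
Qed.

Lemma lip_add a b M N : star a = a -> star b = b -> (L a <= M%:E)%E ->
  (L b <= N%:E)%E -> (L (a + b)%R <= (M + N)%:E)%E.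
Proof.
move=> sa sb aM bN; have [_ LD _] := hL.
by rewrite (le_trans (LD _ _ sa sb)) // EFinD leeD.
Qed.

Lemma mk_leP phi psi r : (mk L phi psi <= r%:E)%E <->
  forall a, star a = a -> (L a <= 1)%E -> normc (phi a - psi a) <= r.
Proof.
split=> [mr a sa La|H].
  by rewrite -lee_fin; apply: le_trans mr; apply: ereal_sup_ubound; exists a.
by apply: ge_ereal_sup => _ [a [sa La] <-]; rewrite lee_fin H.
Qed.

Lemma mk_ge0 phi psi : pos_functional phi -> pos_functional psi ->
  (0 <= mk L phi psi)%E.
Proof.
move=> pphi ppsi; apply: ereal_sup_ubound; exists 0.
  by split; [exact: star0 | rewrite lipN0 lee01].
by rewrite (pf0 pphi) (pf0 ppsi) subrr normc0.
Qed.

Lemma mk_lip phi psi a (M : R) e : pos_functional phi -> pos_functional psi ->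
  (mk L phi psi <= e%:E)%E -> star a = a -> (L a <= M%:E)%E -> 0 < M ->
  normc (phi a - psi a) <= M * e.
Proof.
move=> pphi ppsi me sa aM M0; have M'0 : 0 <= M^-1 by rewrite invr_ge0 ltW.
have := (mk_leP _ _ _).1 me (M^-1%:C *: a).
rewrite starRZ sa => /(_ erefl).
have := lip_scale M'0 sa aM; rewrite mulVf ?gt_eqF // => H /(_ H).
rewrite (pfZ pphi) (pfZ ppsi) -mulrBr normcM normc_real ger0_norm //.
by rewrite ler_pdivrMl.
Qed.

Definition weak_mk_continuous phi : Prop := forall e, 0 < e ->
  exists s d, 0 < d /\ forall psi, state psi -> weak_near phi s d psi ->
  (mk L phi psi <= e%:E)%E.

Lemma mk_metrizes_continuous phi : mk_metrizes L -> state phi ->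
  weak_mk_continuous phi.
Proof.
move=> [_ H] sphi e e0.
have /(H _ sphi _).2 : exists2 d : R, (0 < d)%R &
    [set psi | state psi /\ (mk L phi psi < d%:E)%E] `<=`
    [set psi | state psi /\ (mk L phi psi < e%:E)%E] by exists e.
rewrite /within /= => /weak_nbhsP[s [d [d0 sd]]].
exists s, d; split=> // psi spsi near.
by have [|_ /ltW] := sd psi near.
Qed.

Hypothesis hA : cstar_algebra A.

Let mk_controls_sa phi a d : self_adjoint (A := A) `<=` closure (lip_dom L) ->
  state phi -> star a = a -> 0 < d -> exists2 e, 0 < e &
    forall psi, state psi -> (mk L phi psi < e%:E)%E -> normc (phi a - psi a) < d.
Proof.
move=> dense sphi sa d0; have d40 : 0 < d / 4 by rewrite divr_gt0.
have /closure_cnormP/(_ _ d40)[b [sb Lb] ab] := dense a sa.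
have fL : L b \is a fin_num by rewrite ge0_fin_numE // lip_ge0.
have Lb0 : 0 <= fine (L b) by rewrite fine_ge0 // lip_ge0.
pose M := fine (L b) + 1; have M0 : 0 < M by rewrite ltr_wpDl.
exists (d / 2 / M); first by rewrite !divr_gt0.
move=> psi spsi /ltW m.
have LbM : (L b <= M%:E)%E by rewrite -(fineK fL) lee_fin lerDl.
have := mk_lip (state_pf sphi) (state_pf spsi) m sb LbM M0.
rewrite mulrC divfK ?gt_eqF // => H.
have sab : star (a - b) = a - b by rewrite starB sa sb.
have p1 := state_norm_sa hA sphi sab; have p2 := state_norm_sa hA spsi sab.
have -> : phi a - psi a = phi (a - b) + (phi b - psi b) - psi (a - b).
  rewrite (pfB (state_pf sphi)) (pfB (state_pf spsi)) addrA subrK opprB addrA.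
  by rewrite subrK.
rewrite (le_lt_trans (le_normcD _ _)) // normcN.
have := le_normcD (phi (a - b)) (phi b - psi b); lra.
Qed.

(** One half of the metrization follows from density: an element is close to one with a finite
    seminorm, on which a small Monge-Kantorovich distance forces close values. What has to be
    checked for each L is that distances are finite and weak* continuous. *)
Lemma mk_metrizes_intro : self_adjoint (A := A) `<=` closure (lip_dom L) ->
  (forall phi psi, state phi -> state psi -> (mk L phi psi < +oo)%E) ->
  (forall phi, state phi -> weak_mk_continuous phi) -> mk_metrizes L.
Proof.
move=> dense fin cont; split=> // phi sphi U; split.
  rewrite /within /= => /weak_nbhsP[s [d [d0 sd]]].
  suff [e e0 eN] : exists2 e, 0 < e & forall psi, state psi ->
      (mk L phi psi < e%:E)%E -> weak_near phi s d psi.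
    by exists e => // psi [spsi /(eN _ spsi)/sd]; apply.
  elim: s {sd} => [|x s [e e0 eN]]; first by exists 1 => // psi _ _ x.
  have d20 : 0 < d / 2 by rewrite divr_gt0.
  have [e1 e10 H1] := mk_controls_sa dense sphi (self_adjoint_re x) d20.
  have [e2 e20 H2] := mk_controls_sa dense sphi (self_adjoint_im x) d20.
  exists (Num.min e (Num.min e1 e2)); first by rewrite !lt_min e0 e10.
  move=> psi spsi; rewrite /Num.min => m.
  have le (f g : R) : (mk L phi psi < (Num.min f g)%:E)%E ->
      (mk L phi psi < f%:E)%E /\ (mk L phi psi < g%:E)%E.
    by move=> H; split; apply: (lt_le_trans H); rewrite lee_fin ge_min lexx ?orbT.
  have [m0 /le[m1 m2]] := le _ _ m.
  move=> y; rewrite inE => /orP[/eqP ->|]; last exact: eN.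
  have p1 := H1 psi spsi m1; have p2 := H2 psi spsi m2.
  have pphi := state_pf sphi; have ppsi := state_pf spsi.
  rewrite (re_imE x) (pfD pphi) (pfD ppsi) (pfZ pphi) (pfZ ppsi) opprD addrACA.
  rewrite -mulrBr (le_lt_trans (le_normcD _ _)) // normcM normc_i mul1r.
  by rewrite [d]splitr ltrD.
move=> [e e0 eU]; have e20 : 0 < e / 2 by rewrite divr_gt0.
have [s [d [d0 sd]]] := cont phi sphi _ e20.
rewrite /within /=; apply/weak_nbhsP; exists s, d; split=> // psi near spsi.
apply: eU; split=> //; apply: le_lt_trans (sd _ spsi near) _.
by rewrite lte_fin; lra.
Qed.

End monge_kantorovich.

Section semicontinuity.
Variables (R : realType) (A : normedStarAlgType R) (L : A -> \bar R).

(** Outside the self-adjoint elements the [subspace] topology is discrete, so the condition is void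
    there. *)
Lemma lip_lscP :
  lower_semicontinuous (L : subspace (@self_adjoint R A) -> \bar R) <->
  forall a r, star a = a -> (r%:E < L a)%E -> exists2 e : R, 0 < e &
    forall b, star b = b -> cnorm (a - b) < e -> (r%:E < L b)%E.
Proof.
split=> [H a r sa /H[V]|H a r aL].
  case: (@nbhs_subspaceP _ (@self_adjoint R A) a) => // _.
  rewrite /within /= => /nbhs_cnormP[e e0 eV] VL.
  by exists e => // b sb ab; apply/VL/eV.
exists [set b | r%:E < L b]%E => //.
case: (@nbhs_subspaceP _ (@self_adjoint R A) a) => [sa|_]; last by move=> b ->.
have [e e0 eL] := H a r sa aL.
by apply/nbhs_cnormP; exists e => // b ab sb; exact: eL.
Qed.

End semicontinuity.

(** * Tunnels given by a distance in a common C*-algebra *)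

Section leibniz.
Variables (R : realType) (A : normedStarAlgType R) (L : A -> \bar R) (C D : R).
Hypotheses (hC : 0 <= C) (hD : 0 <= D).
Hypothesis hL : real_seminorm (@self_adjoint R A) L.

(** Real upper bounds replace the extended values, so that the later estimates take place in R. *)
Lemma quasi_leibnizP : quasi_leibniz C D L <->
  forall a b (M N : R), star a = a -> star b = b -> (L a <= M%:E)%E ->
  (L b <= N%:E)%E ->
  let K := (C * (cnorm a * N + cnorm b * M) + D * (M * N))%:E in
  (L (jordan a b) <= K)%E /\ (L (lie a b) <= K)%E.
Proof.
split=> [ql a b M N sa sb aM bN K|H a b [sa La] [sb Lb]].
  have da : lip_dom L a by split=> //; exact: le_lt_trans aM (ltry _).
  have db : lip_dom L b by split=> //; exact: le_lt_trans bN (ltry _).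
  have [a0 b0] := (lip_ge0 hL sa, lip_ge0 hL sb).
  suff : (maxe (L (jordan a b)) (L (lie a b)) <= K)%E by rewrite ge_max => /andP[].
  apply: le_trans (ql a b da db) _.
  have fa : L a \is a fin_num by rewrite ge0_fin_numE //; case: da.
  have fb : L b \is a fin_num by rewrite ge0_fin_numE //; case: db.
  move: a0 b0 aM bN; rewrite /K -(fineK fa) -(fineK fb) !lee_fin.
  set la := fine _; set lb := fine _ => a0 b0 aM bN.
  have [na nb] := (cnorm_ge0 a, cnorm_ge0 b).
  by rewrite lerD ?ler_wpM2l ?lerD ?ler_wpM2l ?ler_pM.
have fa : L a \is a fin_num by rewrite ge0_fin_numE // (lip_ge0 hL).
have fb : L b \is a fin_num by rewrite ge0_fin_numE // (lip_ge0 hL).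
have := H a b (fine (L a)) (fine (L b)) sa sb; rewrite !fineK // => /(_ (lexx _) (lexx _)).
by rewrite EFinD EFinM EFinD !EFinM !fineK // ge_max => -[-> ->].
Qed.

End leibniz.

Section product_cstar.
Variables (R : realType) (X Y : normedStarAlgType R).
Implicit Types d e : (X * Y)%type.

Lemma pair_cnormE d : cnorm d = Num.max (cnorm d.1) (cnorm d.2).
Proof. by []. Qed.

Lemma cnorm_fst d : cnorm d.1 <= cnorm d.
Proof. by rewrite pair_cnormE le_max lexx. Qed.

Lemma cnorm_snd d : cnorm d.2 <= cnorm d.
Proof. by rewrite pair_cnormE le_max lexx orbT. Qed.

Lemma star_pairP d : star d = d <-> star d.1 = d.1 /\ star d.2 = d.2.
Proof.
split=> [sd|[s1 s2]]; first by split; rewrite -{2}sd.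
by rewrite -[LHS]/(star d.1, star d.2) s1 s2 -surjective_pairing.
Qed.

Lemma cstar_product : cstar_algebra X -> cstar_algebra Y ->
  cstar_algebra (X * Y)%type.
Proof.
move=> [cX XE] [cY YE]; split=> [F FF|d]; last first.
  rewrite [LHS]pair_cnormE pair_cnormE [(star d * d).1]/(star d.1 * d.1).
  rewrite -[(star d * d).2]/(star d.2 * d.2) XE YE.
  have := cnorm_ge0 d.1; have := cnorm_ge0 d.2; move: (cnorm _) (cnorm _) => u v u0 v0.
  by rewrite /Num.max ltr_sqr ?nnegrE //; case: ifP.
move=> /cauchy_cnormP Fc.
have [|a Fa] := cX (fst @ F) _.
  apply/cauchy_cnormP => e /Fc[d Fd]; exists d.1.
  apply: (@filterS _ F _ _ _ _ Fd) => d'; rewrite /norm_ball /= => dd.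
  by apply: le_lt_trans dd; exact: (cnorm_fst (d - d')).
have [|b Fb] := cY (snd @ F) _.
  apply/cauchy_cnormP => e /Fc[d Fd]; exists d.2.
  apply: (@filterS _ F _ _ _ _ Fd) => d'; rewrite /norm_ball /= => dd.
  by apply: le_lt_trans dd; exact: (cnorm_snd (d - d')).
exists (a, b); apply/fcvg_cnormP => e e0.
move/fcvg_cnormP : Fa => /(_ e e0) Fa; move/fcvg_cnormP : Fb => /(_ e e0) Fb.
apply: (@filterS _ F _ _ _ _ (@filterI _ F _ _ _ Fa Fb)) => -[x y] [/= ax yb].
by rewrite /norm_ball /= pair_cnormE gt_max; apply/andP.
Qed.

End product_cstar.

Section weak_maps.
Variables (R : realType) (A B : normedStarAlgType R).
Variables (F : (A -> R[i]) -> (B -> R[i])) (phi : A -> R[i]).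

Lemma weak_near_sub s t (d e : R) psi : {subset t <= s} -> d <= e ->
  weak_near phi s d psi -> weak_near phi t e psi.
Proof. by move=> ts de near x /ts/near xd; exact: lt_le_trans xd de. Qed.

(** Weak* continuity of [F] at [phi] may be tested at one element of B at a time. *)
Lemma weak_near_pullback :
  (forall (x : B) (d : R), 0 < d -> exists s d', 0 < d' /\
    forall psi, weak_near phi s d' psi -> normc (F phi x - F psi x) < d) ->
  forall t (d : R), 0 < d -> exists s d', 0 < d' /\
    forall psi, weak_near phi s d' psi -> weak_near (F phi) t d (F psi).
Proof.
move=> H t d d0; elim: t => [|x t [s [d1 [d10 IH]]]]; first by exists [::], 1.
have [s' [d2 [d20 Hx]]] := H x d d0.
exists (s ++ s'), (Num.min d1 d2); split; first by rewrite lt_min d10.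
move=> psi near y; rewrite inE => /orP[/eqP ->|yt].
  apply: Hx; apply: weak_near_sub near; last by rewrite ge_min lexx orbT.
  by move=> z zs; rewrite mem_cat zs orbT.
apply: IH yt; apply: weak_near_sub near; last by rewrite ge_min lexx.
by move=> z zs; rewrite mem_cat zs.
Qed.

End weak_maps.

Lemma jordan_morph (R : realType) (X A : normedStarAlgType R)
  (j : {lrmorphism X -> A}) (a b : X) : j (jordan a b) = jordan (j a) (j b).
Proof. by rewrite /jordan linearZ_LR raddfD /= !rmorphM. Qed.

Lemma lie_morph (R : realType) (X A : normedStarAlgType R)
  (j : {lrmorphism X -> A}) (a b : X) : j (lie a b) = lie (j a) (j b).
Proof. by rewrite /lie linearZ_LR raddfB /= !rmorphM. Qed.

Section distance_tunnel.
Variables (R : realType) (X1 X2 A : normedStarAlgType R) (C D : R).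
Hypotheses (hC : 1 <= C) (hD : 0 <= D) (hA : cstar_algebra A).
Variables (L1 : X1 -> \bar R) (L2 : X2 -> \bar R).
Hypotheses (q1 : quasi_leibniz_cqms C D L1) (q2 : quasi_leibniz_cqms C D L2).
Variables (j1 : {lrmorphism X1 -> A}) (j2 : {lrmorphism X2 -> A}).
Hypotheses (hj1 : isometric_star j1) (hj2 : isometric_star j2).
Variable (lam : R).
Hypothesis (lam0 : 0 < lam).
(** With [close2], this makes both quotient seminorms of the direct sum equal to the given ones. The
    slack [e] is needed when one of the two is the seminorm of the limit, an infimum over
    sequences. *)
Hypothesis close1 : forall a (M e : R), star a = a -> (L1 a <= M%:E)%E -> 0 < e ->
  exists b, [/\ star b = b, (L2 b <= (M + e)%:E)%E &
    cnorm (j1 a - j2 b) <= (M + e) * lam].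
Hypothesis close2 : forall b (M e : R), star b = b -> (L2 b <= M%:E)%E -> 0 < e ->
  exists a, [/\ star a = a, (L1 a <= (M + e)%:E)%E &
    cnorm (j1 a - j2 b) <= (M + e) * lam].

Let T : normedStarAlgType R := (X1 * X2)%type.
Implicit Types (d : T) (r e M N : R).

Let hX1 : cstar_algebra X1 := cqm_cstar q1.1.
Let hX2 : cstar_algebra X2 := cqm_cstar q2.1.
Let s1 := cqm_seminorm q1.1.
Let s2 := cqm_seminorm q2.1.

Let dist d : R := cnorm (j1 d.1 - j2 d.2).

(** For the inclusions of A_n and A_(n+1) and lam = 2 beta_n this is [evident_lip]. General
    embeddings and [lam] cover A_m against A_n and A_n against the limit as well. *)
Definition distance_lip d : \bar R :=
  maxe (maxe (L1 d.1) (L2 d.2)) (cnorm (j1 d.1 - j2 d.2) / lam)%:E.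

Let LT := distance_lip.

Let LT_leP d M : (LT d <= M%:E)%E <->
  [/\ (L1 d.1 <= M%:E)%E, (L2 d.2 <= M%:E)%E & dist d <= M * lam].
Proof.
rewrite /LT /distance_lip !ge_max lee_fin ler_pdivrMr //.
by split=> [/andP[/andP[-> ->]]|[-> ->]].
Qed.

Let LT1 d : (L1 d.1 <= LT d)%E. Proof. by rewrite /LT /distance_lip !le_max lexx. Qed.
Let LT2 d : (L2 d.2 <= LT d)%E. Proof. by rewrite /LT /distance_lip !le_max lexx orbT. Qed.
Let LT3 d : ((dist d / lam)%:E <= LT d)%E.
Proof. by rewrite /LT /distance_lip !le_max lexx orbT. Qed.

Let distD d d' : dist (d + d') <= dist d + dist d'.
Proof.
rewrite /dist; have -> : j1 (d + d').1 - j2 (d + d').2 =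
  (j1 d.1 - j2 d.2) + (j1 d'.1 - j2 d'.2)
  by rewrite (raddfD j1 d.1) (raddfD j2 d.2) opprD addrACA.
exact: cnormD.
Qed.

Let distZ r d : dist (r%:C *: d) = `|r| * dist d.
Proof.
rewrite /dist; have -> : j1 (r%:C *: d).1 - j2 (r%:C *: d).2 =
  r%:C *: (j1 d.1 - j2 d.2)
  by rewrite scalerBr (linearZ_LR j1 r%:C d.1) (linearZ_LR j2 r%:C d.2).
exact: cnormRZ.
Qed.

Let dist_le d : dist d <= 2 * cnorm d.
Proof.
rewrite /dist (le_trans (cnormB _ _)) // hj1.2 hj2.2.
by have := cnorm_fst d; have := cnorm_snd d; lra.
Qed.

Let LT_ge0 d : (0 <= LT d)%E.
Proof.
by apply: le_trans (LT3 d); rewrite lee_fin divr_ge0 ?cnorm_ge0 // ltW.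
Qed.

Let LT_seminorm : real_seminorm (@self_adjoint R T) LT.
Proof.
split=> [d _|d d'|r d]; first exact: LT_ge0.
- move=> /star_pairP[a1 a2] /star_pairP[b1 b2].
  have [_ D1 _] := s1; have [_ D2 _] := s2.
  rewrite {1}/LT /distance_lip !ge_max; apply/andP; split; first apply/andP; first split.
  + exact: le_trans (D1 _ _ a1 b1) (leeD (LT1 _) (LT1 _)).
  + exact: le_trans (D2 _ _ a2 b2) (leeD (LT2 _) (LT2 _)).
  + apply: le_trans (leeD (LT3 _) (LT3 _)); rewrite -EFinD lee_fin -mulrDl.
    by rewrite ler_pM2r ?invr_gt0 //; exact: distD.
- move=> /star_pairP[a1 a2]; have [_ _ Z1] := s1; have [_ _ Z2] := s2.
  rewrite /LT /distance_lip; have -> : cnorm (j1 (r%:C *: d).1 - j2 (r%:C *: d).2) =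
    `|r| * dist d by exact: distZ.
  rewrite [L1 _](Z1 r d.1 a1) [L2 _](Z2 r d.2 a2) -mulrA EFinM.
  by rewrite !maxe_pMr ?abse_ge0 // lee_fin.
Qed.

Let LT_unital : lip_dom LT 1.
Proof.
split; first exact: star1.
have [_ u1] := cqm_unital q1.1; have [_ u2] := cqm_unital q2.1.
by rewrite /LT /distance_lip !gt_max u1 u2 ltry.
Qed.

Let LT_dense : self_adjoint (A := T) `<=` closure (lip_dom LT).
Proof.
move=> d /star_pairP[a1 a2]; apply/closure_cnormP => e e0.
have /closure_cnormP/(_ _ e0)[b1 [sb1 Lb1] ab1] := cqm_dense q1.1 a1.
have /closure_cnormP/(_ _ e0)[b2 [sb2 Lb2] ab2] := cqm_dense q2.1 a2.
exists (b1, b2); last by rewrite pair_cnormE gt_max ab1 ab2.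
by split; [exact/star_pairP | rewrite /LT /distance_lip !gt_max Lb1 Lb2 ltry].
Qed.

Let LT_kernel : [set d : T | self_adjoint d /\ LT d = 0%E] =
  range (fun r : R => r%:C%:A).
Proof.
rewrite eqEsubset; split=> [d [/star_pairP[a1 a2] d0]|_ [r _ <-]].
  have k1 : [set a | self_adjoint a /\ L1 a = 0%E] d.1.
    by split=> //; apply/le_anti; rewrite (lip_ge0 s1) // andbT -d0 LT1.
  have k2 : [set a | self_adjoint a /\ L2 a = 0%E] d.2.
    by split=> //; apply/le_anti; rewrite (lip_ge0 s2) // andbT -d0 LT2.
  move: k1 k2; rewrite !cqm_kernel; [|exact: q2.1|exact: q1.1].
  move=> [r _ r1] [t _ t2].
  have : dist d <= 0.
    have : (LT d <= 0%:E)%E by rewrite d0.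
    by move=> /LT_leP[_ _]; rewrite mul0r.
  rewrite /dist -r1 -t2 /= (linearZ_LR j1) (linearZ_LR j2) !rmorph1.
  rewrite -scalerBl -rmorphB cnorm_scalar normr_le0 subr_eq0 => /eqP rt; exists r => //.
  by rewrite [d]surjective_pairing -r1 -t2 rt.
have r1 : [set a | self_adjoint a /\ L1 a = 0%E] (r%:C%:A).
  by rewrite cqm_kernel; [exists r | exact: q1.1].
have r2 : [set a | self_adjoint a /\ L2 a = 0%E] (r%:C%:A).
  by rewrite cqm_kernel; [exists r | exact: q2.1].
split; first exact: star_scalar.
rewrite /LT /distance_lip -[(_%:A).1]/(r%:C%:A : X1) -[(_%:A).2]/(r%:C%:A : X2).
by rewrite r1.2 r2.2 (linearZ_LR j1) (linearZ_LR j2) !rmorph1 subrr cnorm0 mul0r !maxxx.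
Qed.

Let LT_leibniz : quasi_leibniz C D LT.
Proof.
have C0 : 0 <= C by exact: le_trans ler01 hC.
have [Q1 Q2] := (q1.2, q2.2); move: Q1 Q2.
move=> /(quasi_leibnizP C0 hD s1) Q1 /(quasi_leibnizP C0 hD s2) Q2.
apply/(quasi_leibnizP C0 hD LT_seminorm) => a b M N.
move=> /star_pairP[sa1 sa2] /star_pairP[sb1 sb2] /LT_leP[a1 a2 a3] /LT_leP[b1 b2 b3].
have M0 : 0 <= M by rewrite -lee_fin (le_trans (lip_ge0 s1 sa1)).
have N0 : 0 <= N by rewrite -lee_fin (le_trans (lip_ge0 s1 sb1)).
have [na1 nb1] := (cnorm_fst a, cnorm_fst b).
have [na2 nb2] := (cnorm_snd a, cnorm_snd b).
set K := (C * (cnorm a * N + cnorm b * M) + D * (M * N)) => /=.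
have KP (u v : R) : u <= cnorm a -> v <= cnorm b ->
    ((C * (u * N + v * M) + D * (M * N))%:E <= K%:E)%E.
  by move=> ua vb; rewrite lee_fin lerD2r ler_wpM2l // lerD // ler_wpM2r.
(* The distance term satisfies the Leibniz inequality with constant 1; here C >= 1 and D >= 0 are
   used. *)
have K3 : cnorm (j1 a.1) * cnorm (j1 b.1 - j2 b.2) +
    cnorm (j1 a.1 - j2 a.2) * cnorm (j2 b.2) <= K * lam.
  apply: (@le_trans _ _ ((cnorm a * N + cnorm b * M) * lam)).
    rewrite mulrDl lerD //; first by rewrite -mulrA ler_pM ?cnorm_ge0 // hj1.2.
    by rewrite mulrC -mulrA ler_pM ?cnorm_ge0 // hj2.2.
  rewrite ler_pM2r // /K; have x0 : 0 <= cnorm a * N + cnorm b * M.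
    by rewrite addr_ge0 // mulr_ge0 ?cnorm_ge0.
  by rewrite ler_wpDr ?ler_peMl // !mulr_ge0.
have [J1 I1] := Q1 _ _ _ _ sa1 sb1 a1 b1; have [J2 I2] := Q2 _ _ _ _ sa2 sb2 a2 b2.
split; apply/LT_leP; split.
- exact: le_trans J1 (KP _ _ na1 nb1).
- exact: le_trans J2 (KP _ _ na2 nb2).
- rewrite /dist -[(jordan a b).1]/(jordan a.1 b.1) -[(jordan a b).2]/(jordan a.2 b.2).
  by rewrite !jordan_morph (le_trans (cnorm_jordanB _ _ _ _)).
- exact: le_trans I1 (KP _ _ na1 nb1).
- exact: le_trans I2 (KP _ _ na2 nb2).
- rewrite /dist -[(lie a b).1]/(lie a.1 b.1) -[(lie a b).2]/(lie a.2 b.2).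
  by rewrite !lie_morph (le_trans (cnorm_lieB _ _ _ _)).
Qed.

Let LT_lsc : lower_semicontinuous (LT : subspace (@self_adjoint R T) -> \bar R).
Proof.
apply/lip_lscP => a r /star_pairP[a1 a2].
rewrite {1}/LT /distance_lip !lt_max => /orP[/orP[]|].
- have /lip_lscP H := cqm_lsc q1.1; move=> /(H _ _ a1)[e e0 eP].
  exists e => // b /star_pairP[b1 _] ab; apply: lt_le_trans (LT1 b); apply: eP => //.
  exact: le_lt_trans (cnorm_fst (a - b)) ab.
- have /lip_lscP H := cqm_lsc q2.1; move=> /(H _ _ a2)[e e0 eP].
  exists e => // b /star_pairP[_ b2] ab; apply: lt_le_trans (LT2 b); apply: eP => //.
  exact: le_lt_trans (cnorm_snd (a - b)) ab.
- rewrite lte_fin ltr_pdivlMr // => ar.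
  exists ((dist a - r * lam) / 2); first by rewrite divr_gt0 // subr_gt0.
  move=> b _ ab; apply: lt_le_trans (LT3 b); rewrite lte_fin ltr_pdivlMr //.
  have := distD (a - b) b; rewrite subrK; have := dist_le (a - b); lra.
Qed.

(* A state of the direct sum restricts to a multiple of a state on each
   summand, and the multiple may vanish; adding the missing mass along a fixed
   state [mu] of the common algebra gives states that depend continuously on
   the given one. *)
Section summand_states.
Variable mu : A -> R[i].
Hypothesis smu : state mu.

Definition summand1 (phi : T -> R[i]) (a : X1) : R[i] :=
  phi (a, 0) + phi (0, 1) * mu (j1 a).
Definition summand2 (phi : T -> R[i]) (b : X2) : R[i] :=
  phi (0, b) + phi (1, 0) * mu (j2 b).

Variable phi : T -> R[i].
Hypothesis sphi : state phi.

Let pphi := state_pf sphi.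

Lemma pair_unit : phi (1, 0) = 1 - phi (0, 1).
Proof.
have [_ <- _] := sphi; rewrite -(pfB pphi); congr phi.
by rewrite -[RHS]/(1 - 0, 1 - 1) subr0 subrr.
Qed.

Lemma pair_split a b : phi (a, b) = phi (a, 0) + phi (0, b).
Proof.
by rewrite -(pfD pphi) -[(a, 0) + (0, b)]/(a + 0, 0 + b) addr0 add0r.
Qed.

Lemma pair_pos1 (a : X1) : 0 <= phi (star a * a, 0).
Proof.
have := pphi.2 (a, 0).
by rewrite -[star (a, 0) * (a, 0)]/(star a * a, star 0 * 0) mulr0.
Qed.

Lemma pair_pos2 (b : X2) : 0 <= phi (0, star b * b).
Proof.
have := pphi.2 (0, b).
by rewrite -[star (0, b) * (0, b)]/(star 0 * 0, star b * b) mulr0.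
Qed.

Lemma pair_linear1 : scalar (fun a : X1 => phi (a, 0)).
Proof.
move=> k x y; rewrite -pphi.1; congr phi.
by rewrite -[RHS]/(k *: x + y, k *: 0 + 0) scaler0 addr0.
Qed.

Lemma pair_linear2 : scalar (fun b : X2 => phi (0, b)).
Proof.
move=> k x y; rewrite -pphi.1; congr phi.
by rewrite -[RHS]/(k *: 0 + 0, k *: x + y) scaler0 addr0.
Qed.

Lemma unit_ge0 : 0 <= phi (1, 0) /\ 0 <= phi (0, 1).
Proof.
by have := pair_pos1 1; have := pair_pos2 1; rewrite !star1 !mulr1.
Qed.

Lemma summand1_state : state (summand1 phi).
Proof.
split=> [k x y||a]; rewrite /summand1.
- have -> : j1 (k *: x + y) = k *: j1 x + j1 y by exact: linearP.
  by rewrite pair_linear1 (state_pf smu).1; ring.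
- by rewrite rmorph1; have [_ -> _] := smu; rewrite mulr1 pair_unit subrK.
- rewrite addr_ge0 ?pair_pos1 // mulr_ge0 ?unit_ge0.2 //.
  have -> : j1 (star a * a) = star (j1 a) * j1 a by rewrite rmorphM /= hj1.1.
  by have [_ _] := smu; exact.
Qed.

Lemma summand2_state : state (summand2 phi).
Proof.
split=> [k x y||a]; rewrite /summand2.
- have -> : j2 (k *: x + y) = k *: j2 x + j2 y by exact: linearP.
  by rewrite pair_linear2 (state_pf smu).1; ring.
- by rewrite rmorph1; have [_ -> _] := smu; rewrite mulr1 pair_unit addrC subrK.
- rewrite addr_ge0 ?pair_pos2 // mulr_ge0 ?unit_ge0.1 //.
  have -> : j2 (star a * a) = star (j2 a) * j2 a by rewrite rmorphM /= hj2.1.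
  by have [_ _] := smu; exact.
Qed.

End summand_states.

Let mk_bound mu phi psi (e1 e2 : R) : state mu -> state phi -> state psi ->
  (mk L1 (summand1 mu phi) (summand1 mu psi) <= e1%:E)%E ->
  (mk L2 (summand2 mu phi) (summand2 mu psi) <= e2%:E)%E ->
  (mk LT phi psi <= (e1 + e2 + lam * normc (phi (0, 1) - psi (0, 1)))%:E)%E.
Proof.
move=> smu sphi spsi /mk_leP H1 /mk_leP H2; apply/mk_leP => -[a b].
move=> /star_pairP[/= sa sb] /LT_leP[/= La Lb]; rewrite /dist /= mul1r => ab.
(* The values at (1, 0) and at (0, 1) sum to 1, so the masses added along [mu] change by opposite
   amounts. They leave the change of mass times mu (j1 a - j2 b), a factor of modulus at most
   [lam]. *)
have -> : phi (a, b) - psi (a, b) =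
    (summand1 mu phi a - summand1 mu psi a) +
    (summand2 mu phi b - summand2 mu psi b) -
    (phi (0, 1) - psi (0, 1)) * mu (j1 a - j2 b).
  rewrite (pair_split sphi a b) (pair_split spsi a b) (pfB (state_pf smu)).
  by rewrite /summand1 /summand2 (pair_unit sphi) (pair_unit spsi); ring.
rewrite (le_trans (le_normcD _ _)) // normcN normcM lerD //.
  by rewrite (le_trans (le_normcD _ _)) // lerD ?H1 ?H2.
rewrite mulrC ler_wpM2r //; first by case: (_ - _) => u v; exact: sqrtr_ge0.
apply: le_trans ab; apply: state_norm_sa => //.
by rewrite starB -hj1.1 -hj2.1 sa sb.
Qed.

Let LT_fin phi psi : state phi -> state psi -> (mk LT phi psi < +oo)%E.
Proof.
move=> sphi spsi; have [mu smu] := exists_state hA.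
have [f1 _] := cqm_mk q1.1; have [f2 _] := cqm_mk q2.1.
have t1 := summand1_state smu sphi; have t1' := summand1_state smu spsi.
have t2 := summand2_state smu sphi; have t2' := summand2_state smu spsi.
have g1 : mk L1 (summand1 mu phi) (summand1 mu psi) \is a fin_num.
  by rewrite ge0_fin_numE ?f1 //; apply: (mk_ge0 s1); exact: state_pf.
have g2 : mk L2 (summand2 mu phi) (summand2 mu psi) \is a fin_num.
  by rewrite ge0_fin_numE ?f2 //; apply: (mk_ge0 s2); exact: state_pf.
have m1 : (mk L1 (summand1 mu phi) (summand1 mu psi) <=
  (fine (mk L1 (summand1 mu phi) (summand1 mu psi)))%:E)%E by rewrite fineK.
have m2 : (mk L2 (summand2 mu phi) (summand2 mu psi) <=
  (fine (mk L2 (summand2 mu phi) (summand2 mu psi)))%:E)%E by rewrite fineK.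
exact: le_lt_trans (mk_bound smu sphi spsi m1 m2) (ltry _).
Qed.

Let pullback_bound (u v w : R[i]) (d : R) : 0 < d ->
  normc u < d / (2 + normc w) -> normc v < d / (2 + normc w) ->
  normc (u + v * w) < d.
Proof.
have nw : 0 <= normc w by case: (w) => p q; exact: sqrtr_ge0.
have w0 : 0 < 2 + normc w by rewrite ltr_wpDr.
move=> d0; rewrite !ltr_pdivlMr // => ud vd.
rewrite (le_lt_trans (le_normcD _ _)) // normcM.
have nu : 0 <= normc u by case: (u) => p q; exact: sqrtr_ge0.
have nv : 0 <= normc v by case: (v) => p q; exact: sqrtr_ge0.
nra.
Qed.

Let LT_continuous phi : state phi -> weak_mk_continuous LT phi.
Proof.
move=> sphi e e0; have [mu smu] := exists_state hA.
have e30 : 0 < e / 3 by rewrite divr_gt0.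
have w0 (w : R[i]) : 0 < 2 + normc w.
  by rewrite ltr_wpDr //; case: w => p q; exact: sqrtr_ge0.
have [t1 [d1 [d10 H1]]] :=
  mk_metrizes_continuous (cqm_mk q1.1) (summand1_state smu sphi) e30.
have [t2 [d2 [d20 H2]]] :=
  mk_metrizes_continuous (cqm_mk q2.1) (summand2_state smu sphi) e30.
have [|r1 [c1 [c10 P1]]] := @weak_near_pullback _ _ _ (summand1 mu) phi _ t1 d1 d10.
  move=> x d d0; exists [:: ((x, 0) : T); (0, 1)], (d / (2 + normc (mu (j1 x)))).
  split; first by rewrite divr_gt0.
  move=> psi near; rewrite /summand1 opprD addrACA -mulrBl.
  by apply: pullback_bound => //; apply: near; rewrite !inE eqxx ?orbT.
have [|r2 [c2 [c20 P2]]] := @weak_near_pullback _ _ _ (summand2 mu) phi _ t2 d2 d20.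
  move=> x d d0; exists [:: ((0, x) : T); (1, 0)], (d / (2 + normc (mu (j2 x)))).
  split; first by rewrite divr_gt0.
  move=> psi near; rewrite /summand2 opprD addrACA -mulrBl.
  by apply: pullback_bound => //; apply: near; rewrite !inE eqxx ?orbT.
exists ((0, 1) :: r1 ++ r2), (Num.min (e / 3 / lam) (Num.min c1 c2)).
split; first by rewrite !lt_min c10 c20 divr_gt0.
move=> psi spsi near.
have n1 : weak_near phi r1 c1 psi.
  apply: weak_near_sub near; last by rewrite !ge_min lexx !orbT.
  by move=> z zr; rewrite inE mem_cat zr !orbT.
have n2 : weak_near phi r2 c2 psi.
  apply: weak_near_sub near; last by rewrite !ge_min lexx !orbT.
  by move=> z zr; rewrite inE mem_cat zr !orbT.
have n3 : normc (phi (0, 1) - psi (0, 1)) < e / 3 / lam.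
  by apply: lt_le_trans (near _ (mem_head _ _)) _; rewrite ge_min lexx.
have := mk_bound smu sphi spsi (H1 _ (summand1_state smu spsi) (P1 _ n1))
  (H2 _ (summand2_state smu spsi) (P2 _ n2)).
move=> m; apply: le_trans m _; rewrite lee_fin.
by move: n3; rewrite ltr_pdivlMr //; lra.
Qed.

Lemma distance_quasi_leibniz_cqms : quasi_leibniz_cqms C D LT.
Proof.
split; last exact: LT_leibniz.
split; [|exact: LT_seminorm|exact: LT_unital|exact: LT_dense|exact: LT_kernel| |
  exact: LT_lsc].
  exact: cstar_product.
apply: (mk_metrizes_intro LT_seminorm); first exact: cstar_product.
- exact: LT_dense.
- exact: LT_fin.
- exact: LT_continuous.
Qed.

Definition distance_tunnel : tunnel X1 X2 :=
  @Tunnel R X1 X2 (X1 * X2)%type distance_lip (@fst X1 X2) (@snd X1 X2).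

Let quotient1 a : star a = a ->
  L1 a = quotient_lip (tunnel_lip distance_tunnel) (tunnel_fst distance_tunnel) a.
Proof.
move=> sa; apply/le_anti/andP; split.
  by apply: le_ereal_inf_tmp => _ [d [sd <-] <-]; exact: LT1.
have [->|] := eqVneq (L1 a) +oo%E; first exact: leey.
move=> aoo; have fa : L1 a \is a fin_num.
  by rewrite ge0_fin_numE ?lt_neqAle ?aoo ?leey //; exact: (lip_ge0 s1).
apply/lee_addgt0Pr => e e0.
have aM : (L1 a <= (fine (L1 a))%:E)%E by rewrite fineK.
have [b [sb Lb ab]] := close1 sa aM e0.
apply: (@le_trans _ _ (LT (a, b))).
  by apply: ereal_inf_lbound; exists (a, b) => //; split=> //; exact/star_pairP.
rewrite -(fineK fa) -EFinD; apply/LT_leP; split=> //=.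
by rewrite -(fineK fa) lee_fin lerDl ltW.
Qed.

Let quotient2 b : star b = b ->
  L2 b = quotient_lip (tunnel_lip distance_tunnel) (tunnel_snd distance_tunnel) b.
Proof.
move=> sb; apply/le_anti/andP; split.
  by apply: le_ereal_inf_tmp => _ [d [sd <-] <-]; exact: LT2.
have [->|] := eqVneq (L2 b) +oo%E; first exact: leey.
move=> boo; have fb : L2 b \is a fin_num.
  by rewrite ge0_fin_numE ?lt_neqAle ?boo ?leey //; exact: (lip_ge0 s2).
apply/lee_addgt0Pr => e e0.
have bM : (L2 b <= (fine (L2 b))%:E)%E by rewrite fineK.
have [a [sa La ab]] := close2 sb bM e0.
apply: (@le_trans _ _ (LT (a, b))).
  by apply: ereal_inf_lbound; exists (a, b) => //; split=> //; exact/star_pairP.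
rewrite -(fineK fb) -EFinD; apply/LT_leP; split=> //=.
by rewrite -(fineK fb) lee_fin lerDl ltW.
Qed.

Lemma distance_tunnelP : is_tunnel C D L1 L2 distance_tunnel.
Proof.
split; first exact: distance_quasi_leibniz_cqms.
- split; first by move=> d.
  by rewrite eqEsubset; split=> // a _; exists (a, 0).
- split; first by move=> d.
  by rewrite eqEsubset; split=> // b _; exists (0, b).
- exact: quotient1.
- exact: quotient2.
Qed.

Let hausdorff_le (Y : set (T -> R[i])) : Y `<=` @state R T ->
  (forall phi, state phi -> exists2 psi, Y psi & (mk LT phi psi <= lam%:E)%E) ->
  (hausdorff (mk LT) (@state R T) Y <= lam%:E)%E.
Proof.
move=> Ys H; rewrite /hausdorff ge_max; apply/andP; split.
  apply: ge_ereal_sup => _ [phi /H[psi Ypsi m] <-].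
  by apply: le_trans m; apply: ereal_inf_lbound; exists psi.
apply: ge_ereal_sup => _ [psi Ypsi <-]; apply: (@le_trans _ _ (mk LT psi psi)).
  by apply: ereal_inf_lbound; exists psi => //; exact: Ys.
by apply/mk_leP => a _ _; rewrite subrr normc0 ltW.
Qed.

Let Re_pos_functional1 (F : A -> R[i]) (z : R[i]) a : pos_functional F -> F 1 = z ->
  z <= 1 -> star a = a -> cnorm a <= lam -> normc (F a) <= lam.
Proof.
move=> pF F1 z1 sa al; apply: le_trans (pf_le hA pF sa al) _.
by rewrite F1 ger_pMr //; move: z1; rewrite lecE => /andP[].
Qed.

(** The part of a state on one summand is extended to a positive functional F on A and pulled back
    to the other summand, which yields a state there. The two states differ at (a, b) by F (j1 a -
    j2 b) up to sign, and F 1 <= 1 while the argument has norm at most [lam] on the Lip-ball. *)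
Lemma distance_extent : (extent distance_tunnel <= lam%:E)%E.
Proof.
rewrite /extent ge_max; apply/andP; split; apply: hausdorff_le.
- by move=> _ [phi sphi <-]; apply: state_comp.
- move=> phi sphi; have pphi := state_pf sphi.
  have [F pF FE] := pos_functional_extension hX2 hA hj2
    (conj (pair_linear2 sphi) (pair_pos2 sphi)).
  have F1 : F 1 = phi (0, 1) by rewrite -FE rmorph1.
  pose psi a := phi (a, 0) + F (j1 a).
  have spsi : state psi.
    split=> [k x y||a]; rewrite /psi.
    - have -> : j1 (k *: x + y) = k *: j1 x + j1 y by exact: linearP.
      by rewrite (pair_linear1 sphi) pF.1; ring.
    - by rewrite rmorph1 F1 (pair_unit sphi) subrK.
    - rewrite addr_ge0 ?(pair_pos1 sphi) //.
      have -> : j1 (star a * a) = star (j1 a) * j1 a by rewrite rmorphM /= hj1.1.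
      exact: pF.2.
  exists (psi \o (@fst X1 X2)); first by exists psi.
  apply/mk_leP => -[a b] /star_pairP[/= sa sb] /LT_leP[_ _].
  rewrite /dist /= mul1r => ab.
  have -> : phi (a, b) - psi a = F (- (j1 a - j2 b)).
    by rewrite /psi (pair_split sphi) (pfN pF) (pfB pF) FE; ring.
  apply: (Re_pos_functional1 pF F1); last by rewrite cnormN.
    by have [] := unit_ge0 sphi; rewrite (pair_unit sphi) subr_ge0.
  by rewrite starN starB -hj1.1 -hj2.1 sa sb.
- by move=> _ [phi sphi <-]; apply: state_comp.
- move=> phi sphi; have pphi := state_pf sphi.
  have [F pF FE] := pos_functional_extension hX1 hA hj1
    (conj (pair_linear1 sphi) (pair_pos1 sphi)).
  have F1 : F 1 = phi (1, 0) by rewrite -FE rmorph1.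
  pose psi b := phi (0, b) + F (j2 b).
  have spsi : state psi.
    split=> [k x y||b]; rewrite /psi.
    - have -> : j2 (k *: x + y) = k *: j2 x + j2 y by exact: linearP.
      by rewrite (pair_linear2 sphi) pF.1; ring.
    - by rewrite rmorph1 F1 (pair_unit sphi) addrC subrK.
    - rewrite addr_ge0 ?(pair_pos2 sphi) //.
      have -> : j2 (star b * b) = star (j2 b) * j2 b by rewrite rmorphM /= hj2.1.
      exact: pF.2.
  exists (psi \o (@snd X1 X2)); first by exists psi.
  apply/mk_leP => -[a b] /star_pairP[/= sa sb] /LT_leP[_ _].
  rewrite /dist /= mul1r => ab.
  have -> : phi (a, b) - psi b = F (j1 a - j2 b).
    by rewrite /psi (pair_split sphi) (pfB pF) FE; ring.
  apply: (Re_pos_functional1 pF F1) => //.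
    have [_] := unit_ge0 sphi; rewrite -[phi (0, 1)](subKr 1) -(pair_unit sphi).
    by rewrite subr_ge0.
  by rewrite starB -hj1.1 -hj2.1 sa sb.
Qed.

Lemma propinquity_le : (propinquity C D L1 L2 <= lam%:E)%E.
Proof.
apply: le_trans distance_extent; apply: ereal_inf_lbound.
by exists distance_tunnel => //; exact: distance_tunnelP.
Qed.

End distance_tunnel.

(** An extent is a supremum over the states of the tunnel, which would be -oo over the empty set; so
    the existence of a state matters. *)
Lemma propinquity_ge0 (R : realType) (X1 X2 : normedStarAlgType R) (C D : R)
  (L1 : X1 -> \bar R) (L2 : X2 -> \bar R) : (0 <= propinquity C D L1 L2)%E.
Proof.
apply: le_ereal_inf_tmp => _ [t [[cq _] _ _ _ _] ->].
have [phi sphi] := exists_state (cqm_cstar cq).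
rewrite /extent /hausdorff !le_max; apply/orP; left; apply/orP; left.
apply: le_trans; last by apply: ereal_sup_ubound; exists phi.
apply: le_ereal_inf_tmp => _ [_ [psi spsi <-] <-].
apply: ereal_sup_ubound; exists 0.
  by split; [exact: star0 | rewrite (lipN0 (cqm_seminorm cq)) lee01].
rewrite (pf0 (state_pf sphi)) /= raddf0 (pf0 (state_pf spsi)) subrr.
by rewrite normc0.
Qed.

(** * The Lip-norm of the inductive limit *)

(** For r nonzero, the scaling inequality for the inverse of r, applied to ra, gives the reverse
    inequality; it also shows that ra has an infinite value when a has. *)
Lemma real_seminorm_intro (R : realType) (A : normedStarAlgType R) (L : A -> \bar R) :
  (forall a, star a = a -> (0 <= L a)%E) -> (L 0%R <= 0)%E ->
  (forall a b (M N : R), star a = a -> star b = b -> (L a <= M%:E)%E ->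
     (L b <= N%:E)%E -> (L (a + b)%R <= (M + N)%:E)%E) ->
  (forall a (r M : R), star a = a -> (L a <= M%:E)%E ->
     (L (r%:C *: a) <= (`|r| * M)%:E)%E) ->
  real_seminorm (@self_adjoint R A) L.
Proof.
move=> L_ge0 L_0 LD LZ.
have fin a : star a = a -> L a != +oo%E -> L a = (fine (L a))%:E.
  by move=> sa aoo; rewrite fineK // ge0_fin_numE ?L_ge0 // lt_neqAle aoo leey.
split=> [a|a b sa sb|r a sa]; first exact: L_ge0.
  have [->|aoo] := eqVneq (L a) +oo%E.
    by rewrite addye ?leey // gt_eqF // (lt_le_trans _ (L_ge0 b sb)).
  have [->|boo] := eqVneq (L b) +oo%E.
    by rewrite addey ?leey // gt_eqF // (lt_le_trans _ (L_ge0 a sa)).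
  by rewrite (fin a) // (fin b) // LD // -fin.
have [->|r0] := eqVneq r 0.
  rewrite normr0 mul0e scale0r; apply/le_anti; rewrite L_0 L_ge0 //; exact: star0.
have nr0 : 0 < `|r| by rewrite normr_gt0.
have sra : star (r%:C *: a) = r%:C *: a by rewrite starRZ sa.
have aE : a = r^-1%:C *: (r%:C *: a).
  by rewrite scalerA -rmorphM mulVf // scale1r.
have [aoo|aoo] := eqVneq (L a) +oo%E.
  rewrite aoo gt0_muley ?lte_fin //; apply/eqP; apply: contraT => roo.
  have := LZ _ r^-1 (fine (L (r%:C *: a))) sra; rewrite -fin // => /(_ (lexx _)).
  by rewrite -aE aoo leye_eq.
have aM : (L a <= (fine (L a))%:E)%E by rewrite -fin.
have raM := LZ a r _ sa aM.
have roo : L (r%:C *: a) != +oo%E by rewrite -ltey (le_lt_trans raM) // ltry.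
rewrite (fin a) // -EFinM; apply/le_anti; rewrite raM /=.
have := LZ _ r^-1 (fine (L (r%:C *: a))) sra; rewrite -fin // => /(_ (lexx _)).
rewrite -aE [L (_ *: _)]fin // (fin a) // !lee_fin normfV.
by rewrite mulrC ler_pdivlMr // mulrC.
Qed.

Section lip_sequences.
Variables (R : realType) (A : normedStarAlgType R) (An : nat -> cstar_sub A).
Variables (C D : R) (L : forall n, An n -> \bar R) (beta : nat -> R).
Hypotheses (hC : 1 <= C) (hD : 0 <= D) (hA : cstar_algebra A).
Hypotheses (hlim : inductive_limit An).
Hypotheses (h : propinquity_approximable An C D L beta).
Implicit Types (y z : forall n, An n) (a b : A) (M r e : R) (N n : nat).

(** As [series beta n] sums the terms j < n, this is the sum over j >= n. *)
Definition tail_sum n : R := limn (series beta) - series beta n.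

Let beta_gt0 n : 0 < beta n. Proof. exact: pa_beta_gt0 h n. Qed.
Let beta2_gt0 n : 0 < 2 * beta n. Proof. by rewrite mulr_gt0. Qed.

Let cvg_beta : cvgn (series beta). Proof. exact: pa_beta_sum h. Qed.

Lemma series_step n : series beta n.+1 - series beta n = beta n.
Proof. by rewrite seriesSr addrAC subrr add0r. Qed.

Lemma tail_step n : tail_sum n - tail_sum n.+1 = beta n.
Proof. by rewrite -series_step /tail_sum; lra. Qed.

Let series_incr : nondecreasing_seq (series beta).
Proof. by apply/nondecreasing_seqP => n; rewrite -subr_ge0 series_step ltW. Qed.

Lemma tail_gt0 n : 0 < tail_sum n.
Proof.
have : 0 <= tail_sum n.+1 by rewrite subr_ge0; exact: nondecreasing_cvgn_le.
by have := tail_step n; have := beta_gt0 n; lra.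
Qed.

Lemma tail_decr m n : (m <= n)%N -> tail_sum n <= tail_sum m.
Proof. by move=> mn; rewrite lerD2l lerN2; exact: series_incr. Qed.

Lemma tail_small e : 0 < e -> exists N, forall n, (N <= n)%N -> tail_sum n < e.
Proof.
move=> e0; have /cvgrPdist_lt/(_ _ e0)[N _ uN] := cvg_beta.
by exists N => n Nn; rewrite (le_lt_trans (ler_norm _)) //; exact: uN.
Qed.

Let sm n := pa_seminorm h n.
Let cq n := (pa_lip h n).1.
Let ssm n := cqm_seminorm (cq n).

Lemma csub_star_val n (a : An n) : star a = a -> star (csub_val a) = csub_val a.
Proof. by move=> sa; rewrite -{2}sa. Qed.

Lemma csub_star_inj n (a : An n) : star (csub_val a) = csub_val a -> star a = a.
Proof. by move=> sa; apply: csub_val_inj; rewrite -[RHS]sa. Qed.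

Lemma psi_coord_star n k (a : An n) : star a = a ->
  star (psi_coord k a) = psi_coord k a.
Proof.
move=> sa; apply: csub_star_inj; rewrite (psi_coordE hlim).
by case: ifP => _; [exact: csub_star_val | exact: star0].
Qed.

Lemma psi_coord_L n k (a : An n) : (n <= k)%N -> (L (psi_coord k a) <= L a)%E.
Proof.
move=> /subnK <-; elim: (k - n)%N => [|m IH].
  suff -> : psi_coord (0 + n) a = a by [].
  by apply: csub_val_inj; rewrite (psi_coordE hlim) leq_addl.
apply: le_trans IH; apply: (pa_decr h).
by rewrite !(psi_coordE hlim) leq_addl ifT // leqW // leq_addl.
Qed.

(* [lip_tail 0 M y] says that d = ((y_n, y_(n+1)))_n is self-adjoint and that
   S_0(d) <= M. *)
Definition lip_tail N M y : Prop := forall n, (N <= n)%N ->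
  [/\ star (y n) = y n, (L (y n) <= M%:E)%E &
      cnorm (csub_val (y n) - csub_val (y n.+1)) <= M * (2 * beta n)].

Definition lip_seq M y a : Prop :=
  lip_tail 0 M y /\ clim (fun n => csub_val (y n)) a.

Lemma lip_tail_le N M M' y : M <= M' -> lip_tail N M y -> lip_tail N M' y.
Proof.
move=> MM yM n /yM[sy Ly dy]; split=> //.
  by rewrite (le_trans Ly) // lee_fin.
by rewrite (le_trans dy) // ler_wpM2r // ltW.
Qed.

Lemma lip_tail_ge0 N M y : lip_tail N M y -> 0 <= M.
Proof.
move=> /(_ N (leqnn N))[sy Ly _]; have [+ _ _] := sm N.
by move=> /(_ (y N) I) /le_trans/(_ Ly); rewrite lee_fin.
Qed.

Lemma lip_tail_dist N M y : lip_tail N M y -> forall m n, (N <= m)%N -> (m <= n)%N ->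
  cnorm (csub_val (y n) - csub_val (y m)) <= 2 * M * tail_sum m.
Proof.
move=> yM m n Nm mn; have M0 := lip_tail_ge0 yM.
pose t k := 2 * M * series beta k.
have : cnorm (csub_val (y n) - csub_val (y m)) <= t n - t m.
  apply: (dist_telescope mn (u := fun k => csub_val (y k))) => k mk.
  have [_ _] := yM k (leq_trans Nm mk); rewrite cdistC /t -mulrBr series_step.
  by rewrite mulrA [M * 2]mulrC.
move=> /le_trans; apply; rewrite /t -mulrBr ler_wpM2l ?mulr_ge0 // lerD2r.
exact: nondecreasing_cvgn_le.
Qed.

Lemma lip_seq_dist M y a n : lip_seq M y a ->
  cnorm (csub_val (y n) - a) <= 2 * M * tail_sum n.
Proof.
move=> [yM ya]; rewrite cdistC; apply: (clim_norm ya); exists n => m nm.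
exact: (lip_tail_dist yM).
Qed.

Lemma lip_tail_clim M y : lip_tail 0 M y -> exists a, clim (fun n => csub_val (y n)) a.
Proof.
move=> yM; have M0 := lip_tail_ge0 yM; apply: (seq_complete hA.1) => e e0.
have M1 : 0 < 2 * M + 1 by rewrite ltr_wpDl // mulr_ge0.
have [N tN] := tail_small (divr_gt0 e0 M1); exists N => n Nn.
rewrite cdistC (le_lt_trans (lip_tail_dist yM (leq0n N) Nn)) //.
have := tN N (leqnn N); rewrite ltr_pdivlMr //; apply: le_lt_trans.
by have := tail_gt0 N; nra.
Qed.

(** After rescaling to the Lip-ball, the bridge bounds an infimum of distances by beta_n; since
    beta_n < 2 beta_n, some element realizes 2 beta_n. *)
Let bridge_down n (b : An n.+1) M : star b = b -> (L b <= M%:E)%E -> 0 < M ->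
  exists a : An n, [/\ star a = a, (L a <= M%:E)%E &
    cnorm (csub_val a - csub_val b) <= M * (2 * beta n)].
Proof.
move=> sb bM M0; have V0 : 0 <= M^-1 by rewrite invr_ge0 ltW.
pose b1 : An n.+1 := M^-1%:C *: b.
have b1L : lip_ball (L (n := n.+1)) b1.
  split; first by rewrite /self_adjoint /= starRZ sb.
  by have := lip_scale (ssm n.+1) V0 sb bM; rewrite mulVf ?gt_eqF.
have /ereal_inf_lt : (ereal_inf [set (cnorm (a - csub_val b1))%:E |
    a in [set csub_val a | a in lip_ball (L (n := n))]] < (2 * beta n)%:E)%E.
  apply: (@le_lt_trans _ _ (beta n)%:E); last first.
    by rewrite lte_fin; have := beta_gt0 n; lra.
  have := pa_bridge h n; rewrite /hausdorff ge_max => /andP[_].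
  apply: le_trans; apply: ereal_sup_ubound; exists (csub_val b1) => //.
  by exists b1.
move=> [_ [_ [a [sa La] <-] <-]]; rewrite lte_fin => ab.
exists (M%:C *: a); split.
- by rewrite starRZ sa.
- by have := lip_scale (ssm n) (ltW M0) sa La; rewrite mulr1.
- have -> : csub_val b = M%:C *: csub_val b1.
    by rewrite /b1 csub_valZ scalerA -rmorphM mulfV ?gt_eqF // scale1r.
  rewrite csub_valZ -scalerBr cnormRZ gtr0_norm // ler_pM2l //; exact: ltW.
Qed.

Lemma lip_tail_extend N M y : 0 < M -> lip_tail N M y ->
  exists2 z, lip_tail 0 M z & forall n, (N <= n)%N -> z n = y n.
Proof.
move=> M0; elim: N y => [|N IH] y yM; first by exists y.
have [sy Ly _] := yM N.+1 (leqnn _).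
have [a [sa La ay]] := bridge_down sy Ly M0.
(* A tail says nothing about its entries before the start, so the entry at [N] can be overwritten by
   the one that the bridge provides for [y N.+1]. *)
pose y' := @dfwith _ (fun n => An n : Type) y N a.
have y'E n : (N < n)%N -> y' n = y n by move=> Nn; apply: dfwith_out; rewrite ltn_eqF.
have y'N : y' N = a by exact: dfwith_in.
have [n|z zM zy] := IH y'.
  rewrite leq_eqVlt => /orP[/eqP <-|Nn].
    by rewrite (y'E N.+1) // y'N.
  by rewrite !y'E // ?leqW //; exact: yM.
by exists z => // n Nn; rewrite zy ?y'E // ltnW.
Qed.

Lemma lip_seq_extend N M y a : 0 < M -> lip_tail N M y ->
  clim (fun n => csub_val (y n)) a ->
  exists2 z, lip_seq M z a & forall n, (N <= n)%N -> z n = y n.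
Proof.
move=> M0 /(lip_tail_extend M0)[z zM zy] ya; exists z => //; split=> //.
by apply: (@clim_tail _ _ N) ya => n Nn; rewrite zy.
Qed.

Lemma lip_seq_constant n (a : An n) M : star a = a -> (L a <= M%:E)%E -> 0 < M ->
  exists2 z, lip_seq M z (csub_val a) & z n = a.
Proof.
move=> sa aM M0.
have aE k : (n <= k)%N -> csub_val (psi_coord k a) = csub_val a.
  by move=> nk; rewrite (psi_coordE hlim) nk.
have [||z zM zE] := @lip_seq_extend n M (fun k => psi_coord k a) (csub_val a) M0.
- move=> k nk; split; first exact: psi_coord_star.
    exact: le_trans (psi_coord_L _ nk) aM.
  by rewrite !aE ?leqW // subrr cnorm0 mulr_ge0 // ltW.
- by apply: (@clim_tail _ _ n) (clim_cst _) => k nk; rewrite aE.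
- by exists z => //; rewrite zE //; apply: csub_val_inj; rewrite aE.
Qed.

Lemma lip_seqD M (N : R) y z a b : lip_seq M y a -> lip_seq N z b ->
  lip_seq (M + N) (fun n => y n + z n) (a + b).
Proof.
move=> [yM ya] [zN zb]; split=> [n _|]; last exact: climD.
have [sy Ly dy] := yM n isT; have [sz Lz dz] := zN n isT; split.
- by rewrite starD sy sz.
- exact: lip_add.
- rewrite !csub_valD opprD addrACA mulrDl (le_trans (cnormD _ _)) //.
  exact: lerD.
Qed.

Lemma lip_seqZ M y a r : lip_seq M y a ->
  lip_seq (`|r| * M) (fun n => r%:C *: y n) (r%:C *: a).
Proof.
move=> [yM ya]; split=> [n _|]; last exact: climZ.
have [sy Ly dy] := yM n isT; split.
- by rewrite starRZ sy.
- by have [_ _ ->] := sm n; rewrite // EFinM lee_wpmul2l.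
- by rewrite !csub_valZ -scalerBr cnormRZ -mulrA ler_wpM2l.
Qed.

Lemma lip_seq0 : lip_seq 0 (fun n => 0) 0.
Proof.
split=> [n _|]; last exact: clim_cst.
split; first exact: star0.
  by rewrite (lipN0 (ssm n)).
by rewrite subrr cnorm0 mul0r.
Qed.

Let QLn n := (quasi_leibnizP (le_trans ler01 hC) hD (ssm n)).1 (pa_lip h n).2.

(** The entries have norms close to those of a and b only from some index on, whence the slack [e];
    the products form a tail there, and [lip_seq_extend] completes it. As C >= 1, the step bound [S]
    is at most [K]. *)
Lemma lip_seq_leibniz M (N : R) y z a b e : lip_seq M y a -> lip_seq N z b -> 0 < e ->
  let K := C * (cnorm a * N + cnorm b * M) + D * (M * N) + e in
  (exists w, lip_seq K w (jordan a b)) /\ (exists w, lip_seq K w (lie a b)).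
Proof.
move=> [yM ya] [zN zb] e0 K.
have [M0 N0] := (lip_tail_ge0 yM, lip_tail_ge0 zN).
have C0 : 0 <= C := le_trans ler01 hC.
have X0 : 0 < C * (N + M) + 1 by rewrite ltr_wpDl // mulr_ge0 // addr_ge0.
(* The norms may exceed their limits by t, which adds t C (N + M) <= e to the bound; the 1 keeps the
   denominator positive. *)
pose t := e / (C * (N + M) + 1); have t0 : 0 < t by rewrite divr_gt0.
have tE : t * (C * (N + M) + 1) = e by rewrite divfK // gt_eqF.
have [n1 yn] := ya _ t0; have [n2 zn] := zb _ t0.
pose n0 := maxn n1 n2.
have ny n : (n0 <= n)%N -> cnorm (y n) <= cnorm a + t.
  rewrite geq_max => /andP[/yn /ltW yt _].
  by apply: le_trans (cnorm_le_dist (csub_val (y n)) a) _; rewrite lerD2l.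
have nz n : (n0 <= n)%N -> cnorm (z n) <= cnorm b + t.
  rewrite geq_max => /andP[_ /zn /ltW zt].
  by apply: le_trans (cnorm_le_dist (csub_val (z n)) b) _; rewrite lerD2l.
have [na nb] := (cnorm_ge0 a, cnorm_ge0 b).
pose S := (cnorm a + t) * N + (cnorm b + t) * M.
have S0 : 0 <= S by rewrite addr_ge0 // mulr_ge0 // addr_ge0 // ltW.
have DMN : 0 <= D * (M * N) by rewrite !mulr_ge0.
have KS : C * S + D * (M * N) <= K.
  have -> : C * S + D * (M * N) =
    C * (cnorm a * N + cnorm b * M) + D * (M * N) + t * (C * (N + M)).
    by rewrite /S; ring.
  by rewrite /K lerD2l -tE ler_pM2l // lerDl.
have SK : S <= K by apply: le_trans KS; rewrite ler_wpDr ?ler_peMl.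
have K0 : 0 < K.
  rewrite /K ltr_wpDl // addr_ge0 // mulr_ge0 // addr_ge0 //; exact: mulr_ge0.
have KP n : (n0 <= n)%N ->
    ((C * (cnorm (y n) * N + cnorm (z n) * M) + D * (M * N))%:E <= K%:E)%E.
  move=> n0n; rewrite lee_fin (le_trans _ KS) // lerD2r ler_wpM2l // /S.
  by rewrite lerD // ler_wpM2r ?ny ?nz.
have step n : (n0 <= n)%N -> cnorm (csub_val (y n)) *
    cnorm (csub_val (z n) - csub_val (z n.+1)) +
    cnorm (csub_val (y n) - csub_val (y n.+1)) * cnorm (csub_val (z n.+1)) <=
    K * (2 * beta n).
  move=> n0n; have [_ _ dy] := yM n isT; have [_ _ dz] := zN n isT.
  apply: (@le_trans _ _ (S * (2 * beta n))); last by rewrite ler_wpM2r // ltW.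
  rewrite /S mulrDl lerD //.
    by rewrite -mulrA ler_pM ?cnorm_ge0 ?(ny n n0n).
  by rewrite mulrC -mulrA ler_pM ?cnorm_ge0 ?(nz n.+1 (leqW n0n)).
split.
- have [||w wK _] := @lip_seq_extend n0 K (fun n => jordan (y n) (z n)) (jordan a b) K0.
  + move=> n n0n; have [sy Ly _] := yM n isT; have [sz Lz _] := zN n isT; split.
    * exact: self_adjoint_jordan.
    * exact: le_trans (QLn sy sz Ly Lz).1 (KP n n0n).
    * exact: le_trans (cnorm_jordanB _ _ _ _) (step n n0n).
  + by apply: climZ; apply: climD; apply: climM.
  + by exists w.
- have [||w wK _] := @lip_seq_extend n0 K (fun n => lie (y n) (z n)) (lie a b) K0.
  + move=> n n0n; have [sy Ly _] := yM n isT; have [sz Lz _] := zN n isT; split.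
    * exact: self_adjoint_lie.
    * exact: le_trans (QLn sy sz Ly Lz).2 (KP n n0n).
    * exact: le_trans (cnorm_lieB _ _ _ _) (step n n0n).
  + apply: climZ; apply: climD; first exact: climM.
    have := climZ (-1) (climM zb ya); rewrite scaleN1r.
    by apply: (@clim_tail _ _ 0) => n _; rewrite scaleN1r.
  + by exists w.
Qed.

End lip_sequences.

(** * Interpolation of sequences and closedness under limits *)

Section lip_sequence_limits.
Variables (R : realType) (A : normedStarAlgType R) (An : nat -> cstar_sub A).
Variables (C D : R) (L : forall n, An n -> \bar R) (beta : nat -> R).
Hypotheses (hlim : inductive_limit An).
Hypotheses (h : propinquity_approximable An C D L beta).
Implicit Types (y z : forall n, An n) (a b : A) (M r e : R) (N n : nat).

Let tail := tail_sum beta.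
Let ssm n := cqm_seminorm (pa_lip h n).1.

Let clamp (x : R) := Num.min 1 (Num.max 0 x).

Let clamp01 x : 0 <= clamp x <= 1.
Proof. by rewrite /clamp le_min ge_min le_max !lexx ler01. Qed.

Let clampB x w : x <= w -> 0 <= clamp w - clamp x <= w - x.
Proof.
rewrite /clamp /Num.min /Num.max => xw.
by case: (ltP 0 x) => ?; case: (ltP 0 w) => ?; repeat case: (ltP 1 _) => ?;
  apply/andP; split; lra.
Qed.

Let convex_step (V : lmodType R[i]) (p s t : R[i]) (u u' v v' : V) :
  p *: u + t *: u' - ((p - s) *: v + (t + s) *: v') =
  p *: (u - v) + t *: (u' - v') + s *: (v - v').
Proof.
rewrite scalerBl scalerDl !scalerBr !opprD opprK.
by rewrite [LHS](AC (2 * (2 * 2)) ((1 * 3) * (2 * 5) * (4 * 6))).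
Qed.

(* The steps of the weights th n = kappa (ln (s_N + d) - ln (s_n + d)), where
   s_n is the n-th tail of the series of the [beta n], are at most
   kappa beta_n / (s_(n+1) + d), while [y n.+1] and [y' n.+1] are at distance
   O (s_(n+1) + d).  As ln (s_n + d) is close to ln d, the weights reach 1
   when d is small. *)
Lemma lip_seq_interpolate M eta N : 0 < M -> 0 < eta ->
  exists d : R, 0 < d /\ forall M1 M2 y y' a a', M1 <= M -> M2 <= M1 ->
    lip_seq L beta M1 y a -> lip_seq L beta M2 y' a' -> cnorm (a - a') <= d ->
    exists z, lip_seq L beta (M1 + eta) z a' /\ forall n, (n <= N)%N -> z n = y n.
Proof.
(* The two sequences lie within 2 M tail n.+1 of limits at distance at most 4 M d, so [y n.+1] and
   [y' n.+1] are within 4 M (tail n.+1 + d). Times the weight step kappa beta_n / (tail n.+1 + d),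
   this is exactly eta (2 beta_n). *)
move=> M0 eta0; pose kappa := eta / (2 * M).
have k0 : 0 < kappa by rewrite divr_gt0 // mulr_gt0.
pose E := expR kappa^-1; have E0 : 0 < E by exact: expR_gt0.
have tail0 n : 0 < tail n := tail_gt0 h n.
(* As tail N = E d, any n with tail n < d / E satisfies tail N + d >= E (tail n + d), so that the
   weight has reached 1. *)
pose d := tail N / E; have d0 : 0 < d by rewrite divr_gt0.
have td n : 0 < tail n + d by rewrite addr_gt0.
exists (4 * M * d); split.
  exact: mulr_gt0 (mulr_gt0 (ltr0Sn _ 3) M0) d0.
move=> M1 M2 y y' a a' M1M M2M1 ya ya' aa'.
pose x n := kappa * (ln (tail N + d) - ln (tail n + d)).
pose th n := clamp (x n).
have th01 n : 0 <= th n <= 1 := clamp01 (x n).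
have dx n : 0 <= x n.+1 - x n <= kappa * (beta n / (tail n.+1 + d)).
  have -> : x n.+1 - x n = kappa * ln ((tail n + d) / (tail n.+1 + d)).
    by rewrite ln_div ?posrE // /x; ring.
  have -> : (tail n + d) / (tail n.+1 + d) = 1 + beta n / (tail n.+1 + d).
    have tn0 : tail n.+1 + d != 0 by rewrite gt_eqF.
    by rewrite -(tail_step beta n) -/tail; field.
  have q0 : 0 <= beta n / (tail n.+1 + d) by rewrite divr_ge0 ?ltW // (pa_beta_gt0 h).
  rewrite mulr_ge0 ?(ltW k0) ?ln_ge0 ?lerDl //= ler_wpM2l ?(ltW k0) //.
  by rewrite le_ln1Dx // (lt_le_trans _ q0) // ltrN10.
have dth n : 0 <= th n.+1 - th n <= kappa * (beta n / (tail n.+1 + d)).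
  have /andP[x1 x2] := dx n; have := @clampB (x n) (x n.+1).
  by rewrite -subr_ge0 => /(_ x1)/andP[-> /le_trans]; apply.
have thN n : (n <= N)%N -> th n = 0.
  move=> nN; have xn : x n <= 0.
    rewrite pmulr_rle0 // subr_le0 ler_ln ?posrE // lerD2r.
    exact: tail_decr h _ _ nN.
  by rewrite /th /clamp (max_idPl xn) min_r.
have [N' th1] : exists N', forall n, (N' <= n)%N -> th n = 1.
  have [N' tN'] := tail_small h (divr_gt0 d0 E0); exists N' => n /tN' tn.
  suff xn : 1 <= x n.
    by rewrite /th /clamp max_r ?(le_trans ler01) // min_l.
  rewrite /x -ler_pdivrMl // mulr1 lerBrDr -[kappa^-1]expRK -lnM ?posrE //.
  rewrite ler_ln ?posrE ?mulr_gt0 // -/E.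
  have dE : d * E = tail N by rewrite divfK ?gt_eqF.
  by move: tn; rewrite ltr_pdivlMr // -dE -/tail; lra.
pose z n := (1 - th n)%:C *: y n + (th n)%:C *: y' n.
have M10 : 0 <= M1 := lip_tail_ge0 h ya.1.
have M20 : 0 <= M2 := lip_tail_ge0 h ya'.1.
exists z; split; last first.
  by move=> n nN; rewrite /z thN // subr0 scale1r scale0r addr0.
split=> [n _|]; last first.
  apply: (@clim_tail _ _ N') ya'.2 => n Nn.
  by rewrite /z th1 // subrr scale0r scale1r add0r.
have /andP[t0 t1] := th01 n; have t1' : 0 <= 1 - th n by rewrite subr_ge0.
have [sy Ly dy] := ya.1 n isT; have [sy' Ly' dy'] := ya'.1 n isT.
split.
- by rewrite starD !starRZ sy sy'.
- have := lip_add (ssm n) _ _ (lip_scale (ssm n) t1' sy Ly) (lip_scale (ssm n) t0 sy' Ly').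
  rewrite !starRZ sy sy' => /(_ erefl erefl)/le_trans; apply.
  by rewrite lee_fin; nra.
- set u := csub_val (y n) in dy *; set v := csub_val (y n.+1) in dy *.
  set u' := csub_val (y' n) in dy' *; set v' := csub_val (y' n.+1) in dy' *.
  have /andP[dt0 dt] := dth n.
  have -> : csub_val (z n) - csub_val (z n.+1) =
    (1 - th n)%:C *: (u - v) + (th n)%:C *: (u' - v') +
    (th n.+1 - th n)%:C *: (v - v').
    rewrite /z !csub_valD !csub_valZ -/u -/u' -/v -/v'.
    have e1 : (1 - th n.+1)%:C = (1 - th n)%:C - (th n.+1 - th n)%:C.
      by rewrite -rmorphB; congr (_%:C); ring.
    have e2 : (th n.+1)%:C = (th n)%:C + (th n.+1 - th n)%:C.
      by rewrite -rmorphD; congr (_%:C); ring.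
    by rewrite -convex_step -e1 -e2.
  rewrite (le_trans (cnormD _ _)) // (le_trans (lerD (cnormD _ _) (lexx _))) //.
  rewrite !cnormRZ !ger0_norm //.
  have vv : cnorm (v - v') <= 4 * M * (tail n.+1 + d).
    have p1 := lip_seq_dist h n.+1 ya; have p2 := lip_seq_dist h n.+1 ya'.
    rewrite (le_trans (cdist_tri a _ _)) //.
    have := cdist_tri a' a v'; rewrite [cnorm (a' - v')]cdistC.
    have : 2 * M1 * tail n.+1 <= 2 * M * tail n.+1 by rewrite ler_pM2r // ler_pM2l.
    have : 2 * M2 * tail n.+1 <= 2 * M * tail n.+1.
      by rewrite ler_pM2r // ler_pM2l // (le_trans M2M1).
    move: p1 p2 aa'; rewrite -/tail -/v -/v'; lra.
  have b0 := pa_beta_gt0 h n.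
  have dthv : (th n.+1 - th n) * cnorm (v - v') <= eta * (2 * beta n).
    apply: (le_trans (ler_pM dt0 (cnorm_ge0 _) dt vv)).
    have -> : kappa * (beta n / (tail n.+1 + d)) * (4 * M * (tail n.+1 + d)) =
      eta * (2 * beta n).
      have tn0 : tail n.+1 + d != 0 by rewrite gt_eqF.
      have Mn0 : M != 0 by rewrite gt_eqF.
      by rewrite /kappa; field; rewrite Mn0 tn0.
    exact: lexx.
  have dyy : (1 - th n) * cnorm (u - v) + th n * cnorm (u' - v') <= M1 * (2 * beta n).
    have dy2 : cnorm (u' - v') <= M1 * (2 * beta n).
      by rewrite (le_trans dy') // ler_wpM2r // mulr_ge0 // ltW.
    by nra.
  by rewrite [leRHS]mulrDl; exact: lerD.
Qed.

(** A diagonal argument. Elements b_k tend to a; [zs k] has limit b_k and bound [Mk k], and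
    [zs k.+1] interpolates it with a sequence for b_(k+1) at cost [eta k], keeping the entries of
    index at most k. The costs are geometric and all bounds stay below M. *)
Lemma lip_seq_closed r a : 0 <= r ->
  (forall e, 0 < e -> exists b, cnorm (a - b) < e /\
     forall M, r < M -> exists y, lip_seq L beta M y b) ->
  forall M, r < M -> exists y, lip_seq L beta M y a.
Proof.
move=> r0 H M rM; pose eps := M - r; have eps0 : 0 < eps by rewrite subr_gt0.
pose Mk k := M - eps / 2 ^+ k.+1; pose eta k := eps / 2 ^+ k.+2.
have P2 k : 0 < 2 ^+ k :> R by rewrite exprn_gt0.
have eta0 k : 0 < eta k by rewrite divr_gt0.
have MkS k : Mk k + eta k = Mk k.+1.
  rewrite /Mk /eta [2 ^+ k.+2]exprS; have := P2 k.+1.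
  by move: (2 ^+ k.+1) => p p0; field; rewrite gt_eqF.
have MkM k : Mk k <= M by rewrite gerBl divr_ge0 // ltW.
have Mk0r : r < Mk 0 by rewrite /Mk expr1 /eps; lra.
have M0 : 0 < M by exact: le_lt_trans rM.
have Mkm k : Mk 0 <= Mk k.
  by elim: k => [|k IH] //; rewrite -MkS (le_trans IH) // lerDl ltW.
have /choice[d dP] : forall k, exists d : R, 0 < d /\
    forall M1 M2 y y' a a', M1 <= M -> M2 <= M1 ->
    lip_seq L beta M1 y a -> lip_seq L beta M2 y' a' -> cnorm (a - a') <= d ->
    exists z, lip_seq L beta (M1 + eta k) z a' /\ forall n, (n <= k)%N -> z n = y n.
  by move=> k; exact: lip_seq_interpolate.
(* The first two bounds put b_k and b_(k+1) within [d k], as interpolation requires; the third makes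
   b_k tend to a. At k = 0 the second repeats the first. *)
have /choice[b bP] : forall k, exists b, [/\ cnorm (a - b) <= d k / 2,
    cnorm (a - b) <= d k.-1 / 2, cnorm (a - b) <= tail k &
    exists y, lip_seq L beta (Mk 0) y b].
  move=> k; have [|b [ab bM]] := H (Num.min (d k / 2) (Num.min (d k.-1 / 2) (tail k))).
    by rewrite !lt_min !divr_gt0 ?(dP _).1 //; exact: tail_gt0 h k.
  move: ab; rewrite !lt_min => /andP[/ltW b1 /andP[/ltW b2 /ltW b3]].
  by exists b; split=> //; exact: bM.
have /choice[yy yyP] : forall k, exists y, lip_seq L beta (Mk 0) y (b k).
  by move=> k; have [_ _ _] := bP k.
(* The invariant is a premise of the chosen property, so that [F] is total and the recursion [zs]
   can be defined before the invariant is proved. *)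
have /choice[F FP] : forall kz : nat * (forall n, An n), exists z',
    lip_seq L beta (Mk kz.1) kz.2 (b kz.1) ->
    lip_seq L beta (Mk kz.1.+1) z' (b kz.1.+1) /\
    forall n, (n <= kz.1)%N -> z' n = kz.2 n.
  move=> [k z] /=; have [zP|nz] := pselect (lip_seq L beta (Mk k) z (b k)); last by exists z.
  have [|z' [z'P z'E]] := (dP k).2 _ _ _ _ _ _ (MkM k) (Mkm k) zP (yyP k.+1).
    have [b1 _ _ _] := bP k; have [_ b2 _ _] := bP k.+1.
    rewrite (le_trans (cdist_tri a _ _)) // [cnorm (b k - a)]cdistC.
    by rewrite [d k]splitr lerD.
  by exists z'; rewrite -MkS.
pose zs := fix zs k := if k is k'.+1 then F (k', zs k') else yy 0.
have zsP k : lip_seq L beta (Mk k) (zs k) (b k).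
  by elim: k => [|k IH]; [exact: yyP | have [] := FP (k, zs k) IH].
have zsE k n : (n <= k)%N -> zs k n = zs n n.
  elim: k => [|k IH]; first by rewrite leqn0 => /eqP ->.
  rewrite leq_eqVlt => /orP[/eqP -> //|nk].
  by rewrite -IH //; exact: (FP (k, zs k) (zsP k)).2.
exists (fun n => zs n n); split=> [n _|e e0].
  (* The diagonal entries of index n and n + 1 both belong to [zs n.+1], whose bounds therefore
     apply. *)
  rewrite -(zsE n.+1 n) //; have [sz Lz dz] := (zsP n.+1).1 n isT; split=> //.
    by rewrite (le_trans Lz) // lee_fin.
  by rewrite (le_trans dz) // ler_wpM2r // mulr_ge0 // ltW // (pa_beta_gt0 h).
have M1 : 0 < 2 * M + 1 by rewrite ltr_wpDl // mulr_ge0 // ltW.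
have [N tN] := tail_small h (divr_gt0 e0 M1); exists N => n /tN.
rewrite ltr_pdivlMr // => tn; apply: le_lt_trans tn.
have [_ _ bn _] := bP n; have zb := lip_seq_dist h n (zsP n).
rewrite (le_trans (cdist_tri (b n) _ _)) // [cnorm (b n - a)]cdistC.
have : 2 * Mk n * tail n <= 2 * M * tail n.
  by rewrite ler_wpM2r ?ler_wpM2l //; exact: ltW (tail_gt0 h n).
by move: zb bn; rewrite -/tail; lra.
Qed.

End lip_sequence_limits.

(* [LB] is, up to the isomorphism [j], the infimum of the bounds M for which
   an element is the limit of a sequence satisfying [lip_seq M]. *)
Section inductive_limit_lip_norm.
Variables (R : realType) (A : normedStarAlgType R) (An : nat -> cstar_sub A).
Variables (C D : R) (L : forall n, An n -> \bar R) (beta : nat -> R).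
Hypotheses (hC : 1 <= C) (hD : 0 <= D) (hA : cstar_algebra A).
Hypotheses (hlim : inductive_limit An).
Hypotheses (h : propinquity_approximable An C D L beta).
Variables (B : normedStarAlgType R) (j : {lrmorphism B -> A}).
Hypotheses (hB : cstar_algebra B) (hj : isometric_star j).
Hypothesis j_surj : forall a, exists b, j b = a.
Variable LB : B -> \bar R.
Hypothesis LB_le : forall b M y, lip_seq L beta M y (j b) -> (LB b <= M%:E)%E.
Hypothesis LB_lt : forall b M, (LB b < M%:E)%E ->
  exists y, lip_seq L beta M y (j b).
Implicit Types (a b : B) (M N r e : R) (phi psi : B -> R[i]).

Let tail := tail_sum beta.
Let tail0 n : 0 < tail n := tail_gt0 h n.
Let t20 n : 0 < 2 * tail n. Proof. by rewrite mulr_gt0. Qed.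
Let C0 : 0 <= C := le_trans ler01 hC.
Let ssm n := cqm_seminorm (pa_lip h n).1.

Lemma limit_lip_leP b M : (LB b <= M%:E)%E <->
  forall e, 0 < e -> exists y, lip_seq L beta (M + e) y (j b).
Proof.
split=> [bM e e0|H].
  by apply: LB_lt; apply: le_lt_trans bM _; rewrite lte_fin ltrDl.
apply/lee_addgt0Pr => e /H[y]; rewrite -EFinD; exact: LB_le.
Qed.

Let LB_ge0 b : (0 <= LB b)%E.
Proof.
rewrite leNgt; apply/negP => b0.
have [M M0 bM] : exists2 M : R, M < 0 & (LB b < M%:E)%E.
  case: (LB b) b0 => [r|//|_]; last by exists (-1); rewrite ?ltrN10 ?ltNyr.
  by rewrite lte_fin => r0; exists (r / 2); rewrite ?lte_fin; lra.
have [y [yM _]] := LB_lt bM.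
by have := lip_tail_ge0 h yM; rewrite leNgt M0.
Qed.

Let jD a b : j (a + b) = j a + j b. Proof. exact: raddfD. Qed.
Let jZ (k : R[i]) a : j (k *: a) = k *: j a. Proof. exact: linearZ_LR. Qed.

Let LB_seminorm : real_seminorm (@self_adjoint R B) LB.
Proof.
apply: real_seminorm_intro => [b _|||b r M sb]; first exact: LB_ge0.
- apply: (@LB_le _ _ (fun=> 0)).
  by rewrite raddf0; exact: lip_seq0 h.
- move=> a b M N sa sb /limit_lip_leP aM /limit_lip_leP bN.
  apply/limit_lip_leP => e e0; have e20 : 0 < e / 2 by rewrite divr_gt0.
  have [y yM] := aM _ e20; have [z zN] := bN _ e20.
  exists (fun n => y n + z n); rewrite jD [e]splitr addrACA; exact: (lip_seqD h yM zN).
- move=> /limit_lip_leP bM.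
  apply/limit_lip_leP => e e0.
  have r1 : 0 < `|r| + 1 by rewrite ltr_wpDl.
  have [y yM] := bM _ (divr_gt0 e0 r1).
  exists (fun n => r%:C *: y n); rewrite jZ; have [yr ya] := lip_seqZ h r yM.
  split=> //; apply: (lip_tail_le h _ yr).
  by rewrite mulrDr lerD2l mulrA ler_pdivrMr // mulrC ler_wpM2l ?lerDl // ltW.
Qed.

Lemma limit_lip_An n (a : An n) b M : star a = a -> (L a <= M%:E)%E ->
  j b = csub_val a -> star b = b /\ (LB b <= M%:E)%E.
Proof.
move=> sa aM jb; have sb : star b = b.
  by apply: (iso_self_adjoint hj); rewrite jb; exact: csub_star_val.
split=> //; apply/limit_lip_leP => e e0.
have M0 : 0 <= M.
  by have := le_trans (lip_ge0 (ssm n) sa) aM; rewrite lee_fin.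
have aMe : (L a <= (M + e)%:E)%E by rewrite (le_trans aM) // lee_fin lerDl ltW.
have Me0 : 0 < M + e by rewrite ltr_wpDl.
by have [z zM _] := lip_seq_constant hlim h sa aMe Me0; exists z; rewrite jb.
Qed.

Let LB_unital : lip_dom LB 1.
Proof.
split; first exact: star1.
have [_ L1] := cqm_unital (pa_lip h 0).1.
have fL : L (1 : An 0%N) \is a fin_num.
  by rewrite ge0_fin_numE // (lip_ge0 (ssm 0)) // star1.
have aM : (L (1 : An 0%N)%R <= (fine (L (1 : An 0%N)))%:E)%E by rewrite fineK.
have [|_ le] := @limit_lip_An 0 1 1 _ (@star1 _ (An 0%N)) aM; first by rewrite rmorph1.
exact: le_lt_trans le (ltry _).
Qed.

Let LB_dense : self_adjoint (A := B) `<=` closure (lip_dom LB).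
Proof.
move=> b sb; apply/closure_cnormP => e e0.
have e20 : 0 < e / 2 by rewrite divr_gt0.
have [_ dense] := hlim.
have : closure (\bigcup_n csub_set (An n)) (j b) by rewrite dense.
move=> /closure_cnormP/(_ _ e20)[a [n _ Aa] ba].
pose x : An n := re_part (csub_elt Aa).
have xE : csub_val x = re_part a by [].
have sx : self_adjoint x by exact: self_adjoint_re.
have /closure_cnormP/(_ _ e20)[c [sc Lc] xc] := cqm_dense (pa_lip h n).1 sx.
have fc : L c \is a fin_num by rewrite ge0_fin_numE // (lip_ge0 (ssm n)).
have [b' jb'] := j_surj (csub_val c).
have cM : (L c <= (fine (L c))%:E)%E by rewrite fineK.
have [sb' Lb'] := limit_lip_An sc cM jb'.
exists b'; first by split=> //; exact: le_lt_trans Lb' (ltry _).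
rewrite -hj.2 raddfB /= jb' (le_lt_trans (cdist_tri (csub_val x) _ _)) //.
rewrite [e]splitr ltrD //; apply: le_lt_trans ba; rewrite xE.
have sjb : star (j b) = j b by rewrite -hj.1 sb.
have <- : re_part (j b - a) = j b - re_part a.
  by rewrite re_partD re_partN (re_part_sa sjb).
exact: cnorm_re_part.
Qed.

Let pre (a : A) : B := sval (cid (j_surj a)).
Let preK (a : A) : j (pre a) = a. Proof. exact: svalP (cid (j_surj a)). Qed.

Let j_inj : injective j := isometric_star_inj hj.

Let restrict n phi (a : An n) : R[i] := phi (pre (csub_val a)).

Let restrict_state n phi : state phi -> state (@restrict n phi).
Proof.
move=> sphi; split=> [k x y||a]; rewrite /restrict.
- have -> : pre (csub_val (k *: x + y)) = k *: pre (csub_val x) + pre (csub_val y).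
    by apply: j_inj; rewrite jD jZ !preK.
  exact: (state_pf sphi).1.
- have -> : pre (csub_val (1 : An n)) = 1 by apply: j_inj; rewrite preK (rmorph1 j).
  by have [_ -> _] := sphi.
- have -> : pre (csub_val (star a * a)) = star (pre (csub_val a)) * pre (csub_val a).
    by apply: j_inj; rewrite (rmorphM j) /= hj.1 !preK.
  exact: (state_pf sphi).2.
Qed.

(** An element of the Lip-ball is the limit of a sequence of bound 1 + 1. Its n-th entry contributes
    2 m, and lies within 4 s_n of the element, which costs 8 s_n for the two states. *)
Let mk_restrict n phi psi m : state phi -> state psi ->
  (mk (L (n := n)) (restrict phi) (restrict psi) <= m%:E)%E ->
  (mk LB phi psi <= (2 * m + 8 * tail n)%:E)%E.
Proof.
move=> sphi spsi mr; apply/mk_leP => b sb /limit_lip_leP/(_ 1 ltr01)[y yP].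
have [yM _] := yP; have [sy Ly _] := yM n isT.
have two0 : 0 < 1 + 1 :> R by [].
have := mk_lip (ssm n) (state_pf (restrict_state n sphi))
  (state_pf (restrict_state n spsi)) mr sy Ly two0.
pose c := pre (csub_val (y n)); rewrite /restrict -/c => H.
have sc : star c = c.
  by apply: (iso_self_adjoint hj); rewrite preK; exact: csub_star_val.
have sbc : star (b - c) = b - c by rewrite starB sb sc.
have bc : cnorm (b - c) <= 4 * tail n.
  rewrite -hj.2 raddfB /= preK cdistC; have := lip_seq_dist h n yP.
  by rewrite -/tail; lra.
have p1 := state_norm_sa hB sphi sbc; have p2 := state_norm_sa hB spsi sbc.
have -> : phi b - psi b = phi (b - c) + (phi c - psi c) - psi (b - c).
  by rewrite (pfB (state_pf sphi)) (pfB (state_pf spsi)); ring.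
rewrite (le_trans (le_normcD _ _)) // normcN.
have := le_normcD (phi (b - c)) (phi c - psi c); lra.
Qed.

Let LB_fin phi psi : state phi -> state psi -> (mk LB phi psi < +oo)%E.
Proof.
move=> sphi spsi; have s1 := restrict_state 0 sphi; have s2 := restrict_state 0 spsi.
have [fin _] := cqm_mk (pa_lip h 0).1.
have fm : mk (L (n := 0)) (@restrict 0 phi) (@restrict 0 psi) \is a fin_num.
  by rewrite ge0_fin_numE ?fin //; apply: (mk_ge0 (ssm 0)); exact: state_pf.
have m : (mk (L (n := 0)) (@restrict 0 phi) (@restrict 0 psi) <=
  (fine (mk (L (n := 0)) (@restrict 0 phi) (@restrict 0 psi)))%:E)%E by rewrite fineK.
exact: le_lt_trans (mk_restrict sphi spsi m) (ltry _).
Qed.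

Let LB_continuous phi : state phi -> weak_mk_continuous LB phi.
Proof.
move=> sphi e e0; have e160 : 0 < e / 16 by rewrite divr_gt0.
have e40 : 0 < e / 4 by rewrite divr_gt0.
have [n /(_ n (leqnn n)) tn] := tail_small h e160.
have [t [d [d0 H]]] :=
  mk_metrizes_continuous (cqm_mk (pa_lip h n).1) (restrict_state n sphi) e40.
have [|s [d' [d'0 P]]] := @weak_near_pullback _ _ _ (@restrict n) phi _ t d d0.
  move=> x c c0; exists [:: pre (csub_val x)], c; split=> // psi near.
  exact: near (mem_head _ _).
exists s, d'; split=> // psi spsi near.
apply: le_trans (mk_restrict sphi spsi (H _ (restrict_state n spsi) (P _ near))) _.
by rewrite lee_fin; move: tn; rewrite -/tail; lra.
Qed.

Let LB1 : LB 1 = 0%E.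
Proof.
have : [set a : An 0%N | self_adjoint a /\ L a = 0%E] 1.
  by rewrite (cqm_kernel (pa_lip h 0).1); exists 1 => //; rewrite scale1r.
move=> [sa a0]; apply/le_anti; rewrite LB_ge0 // andbT.
have aM : (L (1 : An 0%N)%R <= 0%:E)%E by rewrite a0.
by have [|_ ->] := @limit_lip_An 0 1 1 _ sa aM; first by rewrite rmorph1.
Qed.

(** If b has seminorm 0, so have its multiples, and as the distance of two states is finite, all
    states agree at b. Then b minus this common value vanishes at every state, in particular at one
    that attains its norm. *)
Let LB_kernel : [set b : B | self_adjoint b /\ LB b = 0%E] =
  range (fun r : R => r%:C%:A).
Proof.
rewrite eqEsubset; split=> [b [sb b0]|_ [r _ <-]]; last first.
  split; first exact: star_scalar.
  have [_ _ LZ] := LB_seminorm; rewrite LZ ?LB1 ?mule0 //; exact: star1.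
have eq phi psi : state phi -> state psi -> phi b = psi b.
  move=> sphi spsi; apply/eqP; rewrite -subr_eq0; apply/eqP/eq0_normc/le_anti.
  have nn (w : R[i]) : 0 <= normc w by case: w => u v; exact: sqrtr_ge0.
  rewrite nn andbT; apply/ler_addgt0Pr => e e0; rewrite add0r.
  have [pphi ppsi] := (state_pf sphi, state_pf spsi).
  have m0 := mk_ge0 LB_seminorm pphi ppsi.
  have fm : mk LB phi psi \is a fin_num by rewrite ge0_fin_numE ?LB_fin.
  have m : (mk LB phi psi <= (fine (mk LB phi psi) + 1)%:E)%E.
    by rewrite EFinD fineK // leeDl // lee_fin.
  have m1 : 0 < fine (mk LB phi psi) + 1 by rewrite ltr_wpDl // fine_ge0.
  have be : (LB b <= (e / (fine (mk LB phi psi) + 1))%:E)%E.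
    by rewrite b0 lee_fin divr_ge0 // ltW.
  have := mk_lip LB_seminorm pphi ppsi m sb be (divr_gt0 e0 m1).
  by rewrite divfK // gt_eqF.
have [phi sphi] := exists_state hB.
have pphi := state_pf sphi.
have bE : phi b = (complex.Re (phi b))%:C by exact: (pf_real hB pphi sb).
set r := complex.Re (phi b) in bE *; exists r => //.
have sd : star (b - r%:C%:A) = b - r%:C%:A by rewrite starB star_scalar sb.
apply/esym/eqP; rewrite -subr_eq0; apply/eqP/cnorm_eq0.
have [psi spsi <-] := exists_norming_state hB sd.
have [_ psi1 _] := spsi.
rewrite (pfB (state_pf spsi)) (pfZ (state_pf spsi)) psi1 mulr1.
by rewrite (eq psi phi) // bE subrr normc0.
Qed.

Let LB_lsc : lower_semicontinuous (LB : subspace (@self_adjoint R B) -> \bar R).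
Proof.
apply/lip_lscP => b r sb rb; apply: contrapT => H.
have near e : 0 < e -> exists b', [/\ star b' = b', cnorm (b - b') < e &
    (LB b' <= r%:E)%E].
  move=> e0; apply: contrapT => H'; apply: H; exists e => // b' sb' bb'.
  by rewrite ltNge; apply/negP => rb'; apply: H'; exists b'.
have r0 : 0 <= r.
  have [b' [sb' _ rb']] := near 1 ltr01.
  by have := le_trans (LB_ge0 b') rb'; rewrite lee_fin.
move: rb; rewrite ltNge => /negP; apply; apply/limit_lip_leP => e e0.
apply: (lip_seq_closed h r0); last by rewrite ltrDl.
move=> d /near[b' [sb' bb' rb']]; exists (j b'); split.
  by rewrite -raddfB hj.2.
by move=> M rM; apply: LB_lt; apply: le_lt_trans rb' _; rewrite lte_fin.
Qed.

Let LB_leibniz : quasi_leibniz C D LB.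
Proof.
apply/(quasi_leibnizP C0 hD LB_seminorm) => a b M N sa sb.
move=> aM bN K.
have M0 : 0 <= M by have := le_trans (LB_ge0 a) aM; rewrite lee_fin.
have N0 : 0 <= N by have := le_trans (LB_ge0 b) bN; rewrite lee_fin.
have key e : 0 < e -> exists e1 e2 : R, [/\ 0 < e1, 0 < e2 &
    C * (cnorm a * (N + e1) + cnorm b * (M + e1)) + D * ((M + e1) * (N + e1)) + e2 <=
    C * (cnorm a * N + cnorm b * M) + D * (M * N) + e].
  move=> e0; have [na nb] := (cnorm_ge0 a, cnorm_ge0 b).
  pose S := C * (cnorm a + cnorm b) + D * (M + N + 1).
  have S0 : 0 <= S by rewrite addr_ge0 ?mulr_ge0 ?addr_ge0.
  have S1 : 0 < 2 * (S + 1) by rewrite mulr_gt0 // ltr_wpDl.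
  pose e1 := Num.min 1 (e / (2 * (S + 1))).
  have e10 : 0 < e1 by rewrite lt_min ltr01 divr_gt0.
  have e11 : e1 <= 1 by rewrite ge_min lexx.
  have e1e : e1 * (2 * (S + 1)) <= e by rewrite -ler_pdivlMr // ge_min lexx orbT.
  exists e1, (e / 2); split=> //; first by rewrite divr_gt0.
  have e1S : e1 * S <= e / 2 by nra.
  have De : D * (e1 * e1) <= D * e1 by rewrite ler_wpM2l // ger_pMr.
  move: e1S; rewrite /S; nra.
split; apply/lee_addgt0Pr => e /key[e1 [e2 [e10 e20 eK]]].
- have [y yM] := (limit_lip_leP _ _).1 aM _ e10.
  have [z zN] := (limit_lip_leP _ _).1 bN _ e10.
  have [[w wK] _] := lip_seq_leibniz hC hD h yM zN e20.
  rewrite -jordan_morph in wK; apply: le_trans (LB_le wK) _.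
  by rewrite !hj.2 lee_fin.
- have [y yM] := (limit_lip_leP _ _).1 aM _ e10.
  have [z zN] := (limit_lip_leP _ _).1 bN _ e10.
  have [_ [w wK]] := lip_seq_leibniz hC hD h yM zN e20.
  rewrite -lie_morph in wK; apply: le_trans (LB_le wK) _.
  by rewrite !hj.2 lee_fin.
Qed.

Lemma limit_quasi_leibniz_cqms : quasi_leibniz_cqms C D LB.
Proof.
split; last exact: LB_leibniz.
split; [exact: hB|exact: LB_seminorm|exact: LB_unital|exact: LB_dense|
  exact: LB_kernel| |exact: LB_lsc].
apply: (mk_metrizes_intro LB_seminorm hB).
- exact: LB_dense.
- exact: LB_fin.
- exact: LB_continuous.
Qed.

Let val_iso n : isometric_star (@csub_val R A (An n)).
Proof. by split. Qed.

Lemma limit_propinquity n : (propinquity C D (L (n := n)) LB <= (2 * tail n)%:E)%E.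
Proof.
apply: (propinquity_le hC hD hA (pa_lip h n) limit_quasi_leibniz_cqms
  (val_iso n) hj).
- exact: t20.
- move=> a M e sa aM e0; have [b jb] := j_surj (csub_val a).
  have [sb bM] := limit_lip_An sa aM jb.
  have M0 : 0 <= M by have := le_trans (lip_ge0 (ssm n) sa) aM; rewrite lee_fin.
  exists b; split=> //; first by rewrite (le_trans bM) // lee_fin lerDl ltW.
  by rewrite jb subrr cnorm0 mulr_ge0 ?(ltW (t20 _)) // addr_ge0 // ltW.
- move=> b M e sb /limit_lip_leP bM e0; have [y yP] := bM e e0.
  have [sy Ly _] := yP.1 n isT; exists (y n); split=> //.
  by rewrite (le_trans (lip_seq_dist h n yP)) // -/tail; lra.
Qed.

(** Up the sequence, the inclusion does not increase the seminorm. Down the sequence, the extension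
    given by [lip_seq_constant] is read at the smaller index. *)
Lemma step_propinquity m n :
  (propinquity C D (L (n := m)) (L (n := n)) <= (2 * tail (minn m n))%:E)%E.
Proof.
have fwd k l (a : An k) M e : (k <= l)%N -> star a = a -> (L a <= M%:E)%E -> 0 < e ->
    exists b : An l, [/\ star b = b, (L b <= (M + e)%:E)%E &
      cnorm (csub_val a - csub_val b) <= (M + e) * (2 * tail k)].
  move=> kl sa aM e0.
  have M0 : 0 <= M by have := le_trans (lip_ge0 (ssm k) sa) aM; rewrite lee_fin.
  exists (psi_coord l a); split; first exact: psi_coord_star.
    rewrite (le_trans (psi_coord_L hlim h a kl)) // (le_trans aM) //.
    by rewrite lee_fin lerDl ltW.
  rewrite (psi_coordE hlim) kl subrr cnorm0.
  by rewrite mulr_ge0 ?(ltW (t20 _)) // addr_ge0 // ltW.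
have bwd k l (b : An l) M e : (k <= l)%N -> star b = b -> (L b <= M%:E)%E -> 0 < e ->
    exists a : An k, [/\ star a = a, (L a <= (M + e)%:E)%E &
      cnorm (csub_val a - csub_val b) <= (M + e) * (2 * tail k)].
  move=> kl sb bM e0.
  have M0 : 0 <= M by have := le_trans (lip_ge0 (ssm l) sb) bM; rewrite lee_fin.
  have bMe : (L b <= (M + e)%:E)%E by rewrite (le_trans bM) // lee_fin lerDl ltW.
  have Me0 : 0 < M + e by rewrite ltr_wpDl.
  have [z zP _] := lip_seq_constant hlim h sb bMe Me0.
  have [sz Lz _] := zP.1 k isT; exists (z k); split=> //.
  by rewrite (le_trans (lip_seq_dist h k zP)) // -/tail; lra.
apply: (propinquity_le hC hD hA (pa_lip h m) (pa_lip h n) (val_iso m) (val_iso n)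
  (t20 _)).
- move=> a M e sa aM e0; have [mn|/ltnW nm] := leqP m n; first exact: fwd.
  have [b [sb bM ab]] := bwd _ _ _ _ _ nm sa aM e0.
  by exists b; split=> //; rewrite cdistC.
- move=> b M e sb bM e0; have [mn|/ltnW nm] := leqP m n; first exact: bwd.
  have [a [sa aM ab]] := fwd _ _ _ _ _ nm sb bM e0.
  by exists a; split=> //; rewrite cdistC.
Qed.

End inductive_limit_lip_norm.

(** * The space F^tau *)

Lemma cstar_isometric (R : realType) (A B : normedStarAlgType R)
  (j : {lrmorphism B -> A}) : isometric_star j -> (forall a, exists b, j b = a) ->
  cstar_algebra A -> cstar_algebra B.
Proof.
move=> hj j_surj [cA AE]; split=> [F FF|b]; last first.
  by rewrite -hj.2 rmorphM /= hj.1 AE hj.2.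
move=> /cauchy_cnormP Fc; have [|a Fa] := cA (j @ F) _.
  apply/cauchy_cnormP => e /Fc[b Fb]; exists (j b).
  apply: (@filterS _ F _ _ _ _ Fb) => b'; rewrite /norm_ball /= => bb.
  by rewrite -raddfB hj.2.
have [b jb] := j_surj a; exists b; apply/fcvg_cnormP => e e0.
move/fcvg_cnormP : Fa => /(_ e e0) Fa.
apply: (@filterS _ F _ _ _ _ Fa) => b'; rewrite /norm_ball /= -jb => bb.
by move: bb; rewrite -raddfB hj.2.
Qed.

Section tau_space_iso.
Variables (R : realType) (A : normedStarAlgType R) (An : nat -> cstar_sub A).
Variables (C D : R) (L : forall n, An n -> \bar R) (beta : nat -> R).
Hypotheses (hA : cstar_algebra A).
Hypotheses (hlim : inductive_limit An).
Hypotheses (h : propinquity_approximable An C D L beta).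
Implicit Types (y : forall n, An n) (a b : A) (M r e : R) (N n k : nat).

Let tau := evident_tunnel L beta.
Implicit Types (x : tau_prod tau) (d : tau_alg h).

Definition coord1 x n : An n := tunnel_fst (tau n) (bp_val x n).
Definition coord2 x n : An n.+1 := tunnel_snd (tau n) (bp_val x n).
Definition coord x n : A := csub_val (coord1 x n).

Lemma coord_le x n : cnorm (coord x n) <= cnorm x.
Proof. exact: le_trans (cnorm_fst (bp_val x n)) (bp_cnorm_ub x n). Qed.

Lemma coord2_le x n : cnorm (coord2 x n) <= cnorm x.
Proof. exact: le_trans (cnorm_snd (bp_val x n)) (bp_cnorm_ub x n). Qed.

Let tau_L_tail x : tau_L tau x ->
  (forall n, coord1 x n.+1 = coord2 x n) /\ exists M, lip_tail L beta 0 M (coord1 x).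
Proof.
move=> /(evident_LP h)[sx cx [M xM]]; split=> //; exists M => n _.
have [x1 x2 x3] := xM n; split=> //.
  by rewrite -[RHS]/(tunnel_fst (tau n) (bp_val x n)) -[in RHS]sx.
by rewrite [coord1 x n.+1]cx.
Qed.

Lemma tau_G_compat x : tau_G tau x -> forall n, coord1 x n.+1 = coord2 x n.
Proof.
move=> /closure_cnormP xS n; apply/eqP; rewrite -subr_eq0; apply/eqP.
apply: cnorm_eq0; apply/le_anti; rewrite cnorm_ge0 andbT.
apply/ler_addgt0Pr => e e0; rewrite add0r; have e20 : 0 < e / 2 by rewrite divr_gt0.
have [s [/tau_L_tail[cr _] /tau_L_tail[ci _]] xs] := xS _ e20.
have cs : coord1 s n.+1 = coord2 s n.
  rewrite (re_imE s) -[LHS]/(coord1 (re_part s) n.+1 + 'i *: coord1 (im_part s) n.+1).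
  by rewrite cr ci.
have -> : coord1 x n.+1 - coord2 x n = coord1 (x - s) n.+1 - coord2 (x - s) n.
  rewrite -[coord1 (x - s) _]/(coord1 x n.+1 - coord1 s n.+1).
  rewrite -[coord2 (x - s) _]/(coord2 x n - coord2 s n) cs opprB addrA.
  by rewrite subrK.
rewrite (le_trans (cnormB _ _)) // [e]splitr lerD //.
  exact: le_trans (coord_le (x - s) _) (ltW xs).
exact: le_trans (coord2_le (x - s) _) (ltW xs).
Qed.

Lemma tau_G_limit x : tau_G tau x -> exists a, clim (coord x) a.
Proof.
move=> /closure_cnormP xS; apply: (seq_complete hA.1) => e e0.
have e30 : 0 < e / 3 by rewrite divr_gt0.
have [s [/tau_L_tail[_ [M rM]] /tau_L_tail[_ [N' iM]]] xs] := xS _ e30.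
have [a ra] := lip_tail_clim hA h rM; have [b ib] := lip_tail_clim hA h iM.
have sab : clim (coord s) (a + 'i *: b).
  rewrite (re_imE s); exact: climD ra (climZ 'i ib).
have e60 : 0 < e / 6 by rewrite divr_gt0.
have [N sN] := sab _ e60; exists N => n Nn.
have sNn : cnorm (coord s N - coord s n) < e / 3.
  rewrite (le_lt_trans (cdist_tri (a + 'i *: b) _ _)) //.
  by have := sN N (leqnn N); have := sN n Nn; rewrite [X in X < _ -> _]cdistC; lra.
have xsk k : cnorm (coord x k - coord s k) < e / 3.
  exact: le_lt_trans (coord_le (x - s) k) xs.
rewrite (le_lt_trans (cdist_tri (coord s N) _ _)) //.
have := cdist_tri (coord s n) (coord s N) (coord x n).
by have := xsk N; have := xsk n; rewrite [X in X < _ -> _]cdistC; lra.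
Qed.

Let pair_bounded y M (yM : forall n, cnorm (y n) <= M) : exists M', forall n,
  cnorm ((y n, y n.+1) : tunnel_alg (tau n)) <= M'.
Proof.
by exists M => n; rewrite [leLHS](pair_cnormE (y n, y n.+1)) ge_max !yM.
Qed.

Definition pair_seq y M (yM : forall n, cnorm (y n) <= M) : tau_prod tau :=
  BoundedProduct (pair_bounded yM).

Lemma clim_norm_bounded y a : clim (fun n => csub_val (y n)) a ->
  exists M, forall n, cnorm (y n) <= M.
Proof.
move=> /clim_bounded[N yN]; exists (cnorm a + 1 + \sum_(k < N) cnorm (y k)) => n.
have s0 : 0 <= \sum_(k < N) cnorm (y k) by apply: sumr_ge0 => k _; exact: cnorm_ge0.
have [nN|/yN] := ltnP n N; last by move=> yn; rewrite (le_trans yn) // lerDl.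
rewrite (bigD1 (Ordinal nN)) //= addrCA lerDl addr_ge0 //.
  by rewrite addr_ge0 // cnorm_ge0.
by apply: sumr_ge0 => k _; exact: cnorm_ge0.
Qed.

Let GD x x' : tau_G tau x -> tau_G tau x' -> tau_G tau (x + x').
Proof.
have [_ GL _ _ _] := evident_G_subalgebra h => Gx Gx'.
by have := GL 1 x x' Gx Gx'; rewrite scale1r.
Qed.

(** Subtracting [psi_seq] of the jump from y_N to y_(N+1), an element of A_(N+1), moves the index of
    constancy from N + 1 down to N; at index 0 the sequence is itself some [psi_seq]. *)
Let tau_G_constant N x y : (forall n, bp_val x n = (y n, y n.+1)) ->
  (forall n, (N <= n)%N -> csub_val (y n) = csub_val (y N)) -> tau_G tau x.
Proof.
elim: N x y => [|N IH] x y xy yN.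
  suff -> : x = psi_seq L beta hlim (y 0) by exact: (@psi_seq_G _ _ _ _ _ _ _ hlim h).
  apply: bp_eq => n; rewrite xy; congr (_, _); apply: csub_val_inj.
    by rewrite (psi_coordE hlim) yN.
  by rewrite (psi_coordE hlim) yN.
pose c : An N.+1 := y N.+1 - psi_coord N.+1 (y N).
pose z n : An n := y n - psi_coord n c.
have -> : x = (x - psi_seq L beta hlim c) + psi_seq L beta hlim c by rewrite subrK.
apply: GD; last exact: (@psi_seq_G _ _ _ _ _ _ _ hlim h).
apply: (IH _ z) => n.
  by rewrite -[LHS]/(bp_val x n - (psi_coord n c, psi_coord n.+1 c)) xy.
have cE : csub_val c = csub_val (y N.+1) - csub_val (y N).
  by rewrite -[LHS]/(csub_val _ - csub_val _) (psi_coordE hlim) leqnSn.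
have zE m : csub_val (z m) = csub_val (y m) - csub_val (psi_coord m c) by [].
move=> Nn; rewrite !zE !(psi_coordE hlim) ltnn subr0.
move: Nn; rewrite leq_eqVlt => /orP[/eqP <-|Nn]; first by rewrite ltnn subr0.
by rewrite Nn yN // cE opprB addrC subrK.
Qed.

(** Freezing the sequence at a late index changes it uniformly little and gives an eventually
    constant one, and G_0 is closed. *)
Lemma pair_seq_G y M (yM : forall n, cnorm (y n) <= M) a :
  clim (fun n => csub_val (y n)) a -> tau_G tau (pair_seq yM).
Proof.
move=> ya; have [_ _ _ _ clG] := evident_G_subalgebra h.
apply: clG; apply/closure_cnormP => e e0.
have e40 : 0 < e / 4 by rewrite divr_gt0.
have [N yN] := ya _ e40.
pose z n : An n := if (n < N)%N then y n else psi_coord n (y N).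
have zM n : cnorm (z n) <= M.
  rewrite /z; case: ifP => // _.
  rewrite [leLHS](_ : _ = cnorm (csub_val (psi_coord n (y N)))) // (psi_coordE hlim).
  by case: ifP => _; [exact: yM | rewrite cnorm0 (le_trans (cnorm_ge0 _) (yM N))].
exists (pair_seq zM).
  apply: (@tau_G_constant N _ z) => // n Nn.
  by rewrite /z ltnn ltnNge Nn /= !(psi_coordE hlim) Nn leqnn.
have yz n : cnorm (y n - z n) <= e / 2.
  rewrite /z; case: ltnP => [_|Nn]; first by rewrite subrr cnorm0 divr_ge0 // ltW.
  rewrite [leLHS](_ : _ = cnorm (csub_val (y n) - csub_val (psi_coord n (y N)))) //.
  rewrite (psi_coordE hlim) Nn (le_trans (cdist_tri a _ _)) //.
  have := yN n Nn; have := yN N (leqnn N); rewrite [X in X < _ -> _]cdistC; lra.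
apply: (@le_lt_trans _ _ (e / 2)); last by lra.
apply: bp_cnorm_le => n.
rewrite [leLHS](_ : _ = cnorm ((y n - z n, y n.+1 - z n.+1) : An n * An n.+1)%type) //.
by rewrite pair_cnormE ge_max !yz.
Qed.

(** The n-th entry is within 1 / (n + 1) of realizing the distance from a to A_n, which tends to 0
    because the A_n increase to a dense subset. *)
Lemma approximating_sequence a : exists y, clim (fun n => csub_val (y n)) a.
Proof.
pose E n := [set cnorm (a - csub_val u) | u in [set: An n]].
have Einf n : has_inf (E n).
  split; first by exists (cnorm (a - csub_val (0 : An n))), 0.
  by exists 0 => _ [u _ <-]; exact: cnorm_ge0.
have yex n : exists u : An n, cnorm (a - csub_val u) < inf (E n) + n.+1%:R^-1.
  have n0 : 0 < n.+1%:R^-1 :> R by rewrite invr_gt0.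
  by have [_ [u _ <-] au] := inf_adherent n0 (Einf n); exists u.
pose y n : An n := sval (cid (yex n)).
have yP n : cnorm (a - csub_val (y n)) < inf (E n) + n.+1%:R^-1 := svalP (cid (yex n)).
exists y => e e0; have e20 : 0 < e / 2 by rewrite divr_gt0.
have [mono dense] := hlim.
have : closure (\bigcup_n csub_set (An n)) a by rewrite dense.
move=> /closure_cnormP/(_ _ e20)[b [N _ Ab] ab].
pose N' := Num.truncn (e / 2)^-1; exists (maxn N N') => n.
rewrite geq_max => /andP[Nn N'n]; rewrite cdistC (lt_trans (yP n)) // [e]splitr ltrD //.
  apply: le_lt_trans ab; apply: ge_inf; first by have [] := Einf n.
  exists (psi_coord n (csub_elt Ab)) => //.
  by rewrite (psi_coordE hlim) Nn.
rewrite invf_plt ?posrE //; apply: lt_le_trans (truncnS_gt _) _.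
by rewrite ler_nat ltnS.
Qed.

Let dcoord d := coord (csub_val d).

Lemma tau_alg_limit d : exists a, clim (dcoord d) a.
Proof. exact/tau_G_limit/(csub_valP d). Qed.

(** Replacing finitely many entries by 0 keeps the limit and removes the large norms; this yields
    the nontrivial inequality in [tau_lim_isometric]. *)
Lemma exists_tau_alg a e : 0 < e ->
  exists d, clim (dcoord d) a /\ cnorm d <= cnorm a + e.
Proof.
move=> e0; have [y ya] := approximating_sequence a.
have [N yN] := ya _ e0.
pose z n : An n := if (n < N)%N then 0 else y n.
have zM n : cnorm (z n) <= cnorm a + e.
  rewrite /z; case: ltnP => [_|/yN yn]; first by rewrite cnorm0 addr_ge0 ?cnorm_ge0 // ltW.
  rewrite (le_trans (cnorm_le_dist (csub_val (y n)) a)) // lerD2l; exact: ltW.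
have za : clim (fun n => csub_val (z n)) a.
  by apply: (@clim_tail _ _ N) ya => n Nn; rewrite /z ltnNge Nn.
exists (csub_elt (X := tau_alg h) (pair_seq_G (yM := zM) za)); split; first exact: za.
apply: bp_cnorm_le => n.
by rewrite [leLHS](pair_cnormE (z n, z n.+1)) ge_max !zM.
Qed.

Lemma tau_null_limit d : tau_null d <-> clim (dcoord d) 0.
Proof.
rewrite /tau_null /=; split=> [/cvgrPdist_lt H e e0|H].
  have [N _ dN] := H e e0; exists N => n /dN.
  rewrite sub0r normrN ger0_norm ?cnorm_ge0 // subr0; apply: le_lt_trans.
  exact: (cnorm_fst (bp_val (csub_val d) n)).
apply/cvgrPdist_lt => e /H[N dN]; exists N => // n /= Nn.
rewrite sub0r normrN ger0_norm ?cnorm_ge0 //.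
rewrite [X in X < _](pair_cnormE (bp_val (csub_val d) n)) gt_max.
have := dN n Nn; have := dN n.+1 (leqW Nn); rewrite !subr0 => d2 d1.
apply/andP; split; first exact: d1.
by have := tau_G_compat (csub_valP d) n; rewrite /coord2 => <-; exact: d2.
Qed.

Lemma tau_quot_eq d d' a b : clim (dcoord d) a -> clim (dcoord d') b ->
  tau_quot h d = tau_quot h d' <-> a = b.
Proof.
move=> da db; have dab : clim (dcoord (d - d')) (a - b).
  have := climD da (climZ (-1) db); rewrite scaleN1r.
  by apply: (@clim_tail _ _ 0) => n _; rewrite scaleN1r.
split=> [/quot_mapP/tau_null_limit d0|ab].
  by apply/eqP; rewrite -subr_eq0; apply/eqP; exact: clim_unique dab d0.
by apply/quot_mapP; apply/tau_null_limit; rewrite ab subrr in dab.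
Qed.

Let ex_lim (q : tau_space h) : exists a, exists2 d, tau_quot h d = q & clim (dcoord d) a.
Proof.
have [d dq] := quot_map_surj q; have [a da] := tau_alg_limit d.
by exists a, d.
Qed.

(** The inverse of psi is built first: limits respect all the operations at once, whereas psi is
    prescribed only on the union of the A_n. *)
Definition tau_lim (q : tau_space h) : A := sval (cid (ex_lim q)).

Lemma tau_limP d : clim (dcoord d) (tau_lim (tau_quot h d)).
Proof.
rewrite /tau_lim; case: cid => a /= [d' dd' d'a].
have [b db] := tau_alg_limit d.
by have /(tau_quot_eq d'a db) -> := dd'.
Qed.

Lemma tau_lim_quot d a : clim (dcoord d) a -> tau_lim (tau_quot h d) = a.
Proof. exact: clim_unique (tau_limP d). Qed.

Let tau_quotS (q : tau_space h) : exists d, tau_quot h d = q.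
Proof. exact: quot_map_surj. Qed.

Lemma tau_quotD d d' : tau_quot h d + tau_quot h d' = tau_quot h (d + d').
Proof. by rewrite /tau_quot quot_mapD. Qed.

Lemma tau_quotZ (l : R[i]) d : l *: tau_quot h d = tau_quot h (l *: d).
Proof. exact: quot_mapZ. Qed.

Lemma tau_quotM d d' : tau_quot h d * tau_quot h d' = tau_quot h (d * d').
Proof. exact: quot_mapM. Qed.

Lemma tau_quot_star d : star (tau_quot h d) = tau_quot h (star d).
Proof. exact: quot_map_star. Qed.

Let tau_lim_scalable : scalable tau_lim.
Proof.
move=> l q; have [d <-] := tau_quotS q; rewrite tau_quotZ; apply: tau_lim_quot.
exact: climZ (tau_limP d).
Qed.

Let tau_lim_zmod : zmod_morphism tau_lim.
Proof.
move=> q q'; have [d <-] := tau_quotS q; have [d' <-] := tau_quotS q'.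
rewrite -[- tau_quot h d']scaleN1r tau_quotZ tau_quotD -[- tau_lim _]scaleN1r.
apply: tau_lim_quot.
exact: climD (tau_limP d) (climZ (-1) (tau_limP d')).
Qed.

Let tau_lim_monoid : monoid_morphism tau_lim.
Proof.
split=> [|q q']; first by apply: (@tau_lim_quot 1); exact: clim_cst.
have [d <-] := tau_quotS q; have [d' <-] := tau_quotS q'.
rewrite tau_quotM; apply: tau_lim_quot; exact: climM (tau_limP d) (tau_limP d').
Qed.

HB.instance Definition _ :=
  GRing.isZmodMorphism.Build (tau_space h) A tau_lim tau_lim_zmod.
HB.instance Definition _ :=
  GRing.isScalable.Build R[i] (tau_space h) A *:%R tau_lim tau_lim_scalable.
HB.instance Definition _ :=
  GRing.isMonoidMorphism.Build (tau_space h) A tau_lim tau_lim_monoid.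

(** A limit has norm at most that of any representative, and [exists_tau_alg] supplies
    representatives whose norm is almost that of the limit. *)
Lemma tau_lim_isometric : isometric_star tau_lim.
Proof.
split=> [q|q]; have [d <-] := tau_quotS q.
  rewrite tau_quot_star; apply: tau_lim_quot; exact: clim_star (tau_limP d).
apply/le_anti/andP; split; apply/ler_addgt0Pr => e e0.
  have [d' dd' d'e] := quot_cnorm_lt (tau_quot h d) e0.
  rewrite -dd' in d'e *; apply: le_trans (ltW d'e).
  apply: (clim_le (tau_limP d')); exists 0%N => n _; exact: coord_le.
have [d' [d'a d'e]] := exists_tau_alg (tau_lim (tau_quot h d)) e0.
have -> := (tau_quot_eq (tau_limP d) d'a).2 erefl.
rewrite (tau_lim_quot d'a); apply: le_trans d'e; exact: quot_cnorm_lb.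
Qed.

Lemma tau_lim_surj a : exists q, tau_lim q = a.
Proof.
have [d [da _]] := exists_tau_alg a ltr01.
by exists (tau_quot h d); exact: tau_lim_quot.
Qed.

Definition tau_psi a : tau_space h := sval (cid (tau_lim_surj a)).

Lemma tau_psiK : cancel tau_psi tau_lim.
Proof. by move=> a; exact: svalP (cid (tau_lim_surj a)). Qed.

Let tau_lim_inj : injective tau_lim := isometric_star_inj tau_lim_isometric.

Lemma tau_limK : cancel tau_lim tau_psi.
Proof. by move=> q; apply: tau_lim_inj; rewrite tau_psiK. Qed.

Let tau_psi_scalable : scalable tau_psi.
Proof. by move=> l a; apply: tau_lim_inj; rewrite linearZ_LR /= !tau_psiK. Qed.

Let tau_psi_zmod : zmod_morphism tau_psi.
Proof. by move=> a b; apply: tau_lim_inj; rewrite raddfB /= !tau_psiK. Qed.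

Let tau_psi_monoid : monoid_morphism tau_psi.
Proof.
split=> [|a b]; apply: tau_lim_inj; first by rewrite tau_psiK rmorph1.
by rewrite rmorphM /= !tau_psiK.
Qed.

HB.instance Definition _ :=
  GRing.isZmodMorphism.Build A (tau_space h) tau_psi tau_psi_zmod.
HB.instance Definition _ :=
  GRing.isScalable.Build R[i] A (tau_space h) *:%R tau_psi tau_psi_scalable.
HB.instance Definition _ :=
  GRing.isMonoidMorphism.Build A (tau_space h) tau_psi tau_psi_monoid.

Lemma tau_psi_star : star_preserving tau_psi.
Proof.
move=> a; apply: tau_lim_inj; rewrite tau_psiK.
by have [-> _] := tau_lim_isometric; rewrite tau_psiK.
Qed.

Lemma tau_psi_bij : bijective tau_psi.
Proof. by exists tau_lim; [exact: tau_psiK | exact: tau_limK]. Qed.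

Lemma tau_psi_map n (a : An n) : tau_psi (csub_val a) = psi_map hlim h a.
Proof.
apply: tau_lim_inj; rewrite tau_psiK; apply/esym/tau_lim_quot.
apply: (@clim_tail _ _ n) (clim_cst _) => k nk.
by rewrite -[RHS]/(csub_val (psi_coord k a)) (psi_coordE hlim) nk.
Qed.

Let beta2 n : 0 < 2 * beta n. Proof. by rewrite mulr_gt0 // (pa_beta_gt0 h). Qed.

(** This and [tau_lip_norm_lt] are the two conditions on [LB] under which the limit seminorm was
    studied. *)
Lemma tau_lip_norm_le (q : tau_space h) M y : lip_seq L beta M y (tau_lim q) ->
  (tau_lip_norm h q <= M%:E)%E.
Proof.
move=> [yM yq]; have [K yK] := clim_norm_bounded yq.
pose d := csub_elt (X := tau_alg h) (pair_seq_G (yM := yK) yq).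
apply: (@le_trans _ _ (tau_lip (csub_val d))).
  apply: ereal_inf_lbound; exists d => //; split.
    apply: csub_val_inj; apply: bp_eq => n.
    rewrite -[LHS]/(star (y n), star (y n.+1)).
    by have [-> _ _] := yM n isT; have [-> _ _] := yM n.+1 isT.
  by rewrite -[q]tau_limK; apply: tau_lim_inj; rewrite tau_psiK; exact: tau_lim_quot.
apply: ge_ereal_sup => _ [n _ <-]; rewrite /= /evident_lip !ge_max /=.
have [_ -> dy] := yM n isT; have [_ -> _] := yM n.+1 isT.
by rewrite lee_fin ler_pdivrMr.
Qed.

Lemma tau_lip_norm_lt (q : tau_space h) M : (tau_lip_norm h q < M%:E)%E ->
  exists y, lip_seq L beta M y (tau_lim q).
Proof.
move=> /ereal_inf_lt[_ [d [sd <-] <-] dM].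
exists (coord1 (csub_val d)); split; last exact: tau_limP.
move=> n _; have : (evident_lip L beta (bp_val (csub_val d) n) <= M%:E)%E.
  by apply: le_trans (ltW dM); apply: ereal_sup_ubound; exists n.
rewrite /evident_lip !ge_max => /andP[/andP[d1 _]]; rewrite lee_fin ler_pdivrMr // => d3.
split=> //.
  have sd' : star (csub_val d) = csub_val d by rewrite -[in RHS]sd.
  by rewrite -[RHS]/(tunnel_fst (tau n) (bp_val (csub_val d) n)) -[in RHS]sd'.
by rewrite (tau_G_compat (csub_valP d)).
Qed.

End tau_space_iso.

Lemma nneseries_tail_sum (R : realType) (beta : nat -> R) n : cvgn (series beta) ->
  (\sum_(n <= j <oo) (beta j)%:E = (tail_sum beta n)%:E)%E.
Proof.
move=> cb; apply/cvg_lim => //.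
apply: (@cvg_trans _ ((EFin \o (fun k => series beta k - series beta n)) @ \oo)).
  apply: near_eq_cvg; exists n => // k /= nk.
  by rewrite sumEFin -sub_series_geq.
apply: cvg_EFin; first by apply: nearW.
by apply: cvgB => //; exact: cvg_cst.
Qed.

Unset Implicit Arguments.
Local Close Scope complex_scope.
Local Open Scope ereal_scope.

Theorem theorem2p15 (R : realType) (C D : R) (hC : (1 <= C)%R) (hD : (0 <= D)%R)
  (A : normedStarAlgType R) (hA : cstar_algebra A)
  (An : nat -> cstar_sub A) (hlim : inductive_limit An)
  (L : forall n, An n -> \bar R) (beta : nat -> R)
  (h : propinquity_approximable An C D L beta) :
  cstar_convergent C D A L (tau_lip_norm h) /\
  exists psi : {lrmorphism A -> tau_space h},
    [/\ star_preserving psi, bijective psi,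
        forall n (a : An n), psi (csub_val a) = psi_map hlim h a &
        let LA := tau_lip_norm h \o psi in
        [/\ quasi_leibniz_cqms C D LA,
            \bigcup_n [set csub_val a | a in lip_dom (L n)] `<=` lip_dom LA,
            forall n, propinquity C D (L n) LA <=
              4%:E * \sum_(n <= j <oo) (beta j)%:E &
            propinquity C D (L n) LA @[n --> \oo] --> 0]].
Proof.
pose psi : {lrmorphism A -> tau_space h} := tau_psi hA hlim h.
pose lim : {lrmorphism tau_space h -> A} := tau_lim hA (h := h).
pose LA := tau_lip_norm h \o psi.
have lim_iso : isometric_star lim by exact: tau_lim_isometric.
have id_iso : isometric_star (idfun : {lrmorphism A -> A}) by [].
have psiK a : lim (psi a) = a by exact: tau_psiK.
have lim_surj a : exists q, lim q = a by exists (psi a).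
have id_surj (a : A) : exists b, (idfun : {lrmorphism A -> A}) b = a by exists a.
have hF : cstar_algebra (tau_space h) := cstar_isometric lim_iso lim_surj hA.
have F_le q M y : lip_seq L beta M y (lim q) -> tau_lip_norm h q <= M%:E.
  exact: tau_lip_norm_le.
have F_lt q (M : R) : tau_lip_norm h q < M%:E ->
    exists y, lip_seq L beta M y (lim q).
  exact: tau_lip_norm_lt.
have A_le a M y : lip_seq L beta M y a -> LA a <= M%:E.
  by have := F_le (psi a) M y; rewrite psiK.
have A_lt a (M : R) : LA a < M%:E -> exists y, lip_seq L beta M y a.
  by move=> /F_lt; rewrite psiK.
have cvg0 (B : normedStarAlgType R) (LB : B -> \bar R) :
    (forall n, propinquity C D (L n) LB <= (2 * tail_sum beta n)%:E) ->
    propinquity C D (L n) LB @[n --> \oo] --> 0.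
  move=> le2; apply: (@squeeze_cvge _ _ _ _ (cst 0) _ (fun n => (2 * tail_sum beta n)%:E)).
  - by apply: nearW => n; rewrite propinquity_ge0 le2.
  - exact: cvg_cst.
  - apply: cvg_EFin; first exact: nearW.
    apply/cvgrPdist_lt => e e0; have e20 : (0 < e / 2)%R by rewrite divr_gt0.
    have [N tN] := tail_small h e20; exists N => // n /= /tN tn.
    have t0 := tail_gt0 h n.
    by rewrite sub0r normrN gtr0_norm ?mulr_gt0 //; lra.
have le4 n : (2 * tail_sum beta n)%:E <= 4%:E * \sum_(n <= j <oo) (beta j)%:E.
  rewrite (nneseries_tail_sum _ (pa_beta_sum h)) -EFinM lee_fin.
  by have := tail_gt0 h n; lra.
(* The results on the limit are used twice: for F^tau through the limit map, and for A with the
   transported seminorm through the identity. *)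
have qF := limit_quasi_leibniz_cqms hC hD hlim h hF lim_iso lim_surj F_le F_lt.
have pF := limit_propinquity hC hD hA hlim h hF lim_iso lim_surj F_le F_lt.
have qA := limit_quasi_leibniz_cqms hC hD hlim h hA id_iso id_surj A_le A_lt.
have pA := limit_propinquity hC hD hA hlim h hA id_iso id_surj A_le A_lt.
split.
  split=> //.
  - exact: pa_lip h.
  - move=> e e0; have e20 : (0 < e / 2)%R by rewrite divr_gt0.
    have [N tN] := tail_small h e20; exists N => m n Nm Nn.
    apply: le_lt_trans (step_propinquity hC hD hA hlim h m n) _.
    have /tN : (N <= minn m n)%N by rewrite leq_min Nm Nn.
    by rewrite lte_fin; lra.
  - exact: cvg0.
  - by exists psi; [exact: tau_psi_bij | exact: tau_psi_star].
exists psi; split=> //.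
- exact: tau_psi_star.
- exact: tau_psi_bij.
- exact: tau_psi_map.
split=> //.
- move=> _ [n _ [a [sa La] <-]].
  have fa : L n a \is a fin_num.
    by rewrite ge0_fin_numE // (lip_ge0 (cqm_seminorm (pa_lip h n).1)).
  have aM : L n a <= (fine (L n a))%:E by rewrite fineK.
  have [sb Lb] := limit_lip_An hlim h id_iso A_le A_lt sa aM (erefl (csub_val a)).
  by split=> //; exact: le_lt_trans Lb (ltry _).
- by move=> n; exact: le_trans (pA n) (le4 n).
- exact: cvg0.
Qed.
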